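(* Consider the planar analytic system $$\dot x = x^2,\qquad \dot y = -y(1+a^0x)+g^0(x,y),\qquad g^0=f^0+\mu h^0,$$ with $a^0>-2$ and $f^0,h^0,\mu$ as in the context. Let $W^c:\ y=m^0(x)$, $m^0(0)=\frac{dm^0}{dx}(0)=0$, with $m^0$ defined in a neighborhood of $x=0$, denote the center manifold of $(x,y)=(0,0)$. Then there is a $\mu_0>0$ such that for all $0\le\mu<\mu_0$ the following holds. 1. There exists a number $S^0_\infty\in\mathbb R$, depending on the full jet of $g^0$, such that (a) $\displaystyle \frac{(-1)^k}{\Gamma(k+a^0)}\,\frac{1}{k!}\frac{d^k m^0}{dx^k}(0)\to S^0_\infty$ as $k\to\infty$; (b) the center manifold $W^c$ is nonanalytic if $S_\infty^0\neq 0$. 2. Regarded as a function of the coefficient $f^0_2\in I$, $S^0_\infty=S^0_\infty(f^0_2)$ is $C^1$ (and it is likewise $C^1$ with respect to the other parameters of the system), and $$\frac{\partial S^0_\infty}{\partial f^0_2}(f^0_2)=\frac{1}{\Gamma(2+a^0)}+\mathcal O(\mu)\neq 0\qquad \forall\,\mu\in[0,\mu_0),\quad \mu_0=\mu_0(I)>0.$$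
   Context: Setting: $\rho>0$ and $B>0$ are fixed, $a^0\in\mathbb R$ with $a^0>-2$, $\mu\ge 0$ is a real parameter, and $$f^0(x)=\sum_{k=2}^\infty f^0_kx^k,\qquad h^0(x,y)=\sum_{k=1}^\infty\sum_{l=2}^\infty h^0_{k,l}x^ky^l$$ are real power series (fixed, independent of $\mu$) with $|f^0_k|\le B\rho^{-k}$ and $|h^0_{k,l}|\le\rho^{-k-l}$. When $f^0_2$ is treated as a parameter, all other data are kept fixed, $f^0_2$ ranges over a fixed compact interval $I\subset\mathbb R$, and $B$ is taken large enough that $|f^0_k|\le B\rho^{-k}$ holds for all $f^0_2\in I$. The ''other parameters of the system'' are $\mu$, $a^0$ and the remaining coefficients of $f^0,h^0$, subject to these standing bounds. $\Gamma$ is the gamma function. A center manifold is a ($C^\infty$) invariant manifold of graph form $y=m^0(x)$ tangent to $y=0$ at the origin, i.e. $m^0$ solves $x^2y'+y(1+a^0x)=g^0(x,y)$. It is in general not unique, but its Taylor series at $x=0$ is the unique formal power series solution $\sum_{k\ge2}m^0_kx^k$ of this equation. *)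

(* Defs.v *)
From Stdlib Require Import Reals.
From Coquelicot Require Import Coquelicot.

Open Scope R_scope.

(* Only meaningful for 0 < z, where the integral converges. *)
Definition Gamma (z : R) : R :=
  RInt_gen (fun t => Rpower t (z - 1) * exp (- t))
    (at_right 0) (Rbar_locally p_infty).

(* The data (a^0, mu, f^0, h^0) of the system
     x' = x^2,   y' = - y (1 + a^0 x) + f^0(x) + mu h^0(x,y).
   The coefficient sequences are indexed from 0; the vanishing of the
   low-order coefficients is part of [admissible]. *)
Record params : Type := Params {
  lin : R;
  mu : R;
  fc : nat -> R;
  hc : nat -> nat -> R
}.

Definition params_sub (p q : params) : params :=
  Params (lin p - lin q) (mu p - mu q)
    (fun k => fc p k - fc q k) (fun k l => hc p k l - hc q k l).

Definition params_add (p q : params) : params :=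
  Params (lin p + lin q) (mu p + mu q)
    (fun k => fc p k + fc q k) (fun k l => hc p k l + hc q k l).

Definition params_scal (s : R) (p : params) : params :=
  Params (s * lin p) (s * mu p)
    (fun k => s * fc p k) (fun k l => s * hc p k l).

Definition with_f2 (p : params) (t : R) : params :=
  Params (lin p) (mu p)
    (fun k => if Nat.eqb k 2 then t else fc p k) (hc p).

Definition admissible (rho B c d : R) (p : params) : Prop :=
  fc p 0 = 0 /\ fc p 1 = 0 /\
  c <= fc p 2 <= d /\
  (forall k, Rabs (fc p k) <= B / rho ^ k) /\
  (forall k l, (k < 1)%nat \/ (l < 2)%nat -> hc p k l = 0) /\
  (forall k l, Rabs (hc p k l) <= / rho ^ (k + l)).

Definition param_domain (rho B c d a0 eps mu0 : R) (p : params) : Prop :=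
  admissible rho B c d p /\
  -2 < lin p /\ Rabs (lin p - a0) < eps /\
  0 <= mu p < mu0.

Definition gfun (p : params) (x y : R) : R :=
  PSeries (fc p) x + mu p * PSeries (fun k => PSeries (hc p k) y) x.

Definition center_manifold (p : params) (m : R -> R) : Prop :=
  m 0 = 0 /\ Derive m 0 = 0 /\
  locally 0 (fun x =>
    (forall n, ex_derive_n m n x) /\
    x ^ 2 * Derive m x + m x * (1 + lin p * x) = gfun p x (m x)).

Definition analytic_at_0 (m : R -> R) : Prop :=
  exists c : nat -> R, locally 0 (fun x => is_pseries c x (m x)).

Fixpoint PS_pow (u : nat -> R) (l : nat) : nat -> R :=
  match l with
  | O => fun n => match n with O => 1 | S _ => 0 end
  | S l' => PS_mult u (PS_pow u l')
  end.

(* The coefficient of x^k in g(x, u(x)), for a formal power series u with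
   u 0 = 0: then u(x)^l starts at order l, so truncating at l <= k is exact. *)
Definition g_coef (p : params) (u : nat -> R) (k : nat) : R :=
  fc p k +
  mu p * sum_f_R0 (fun i =>
           sum_f_R0 (fun l => hc p i l * PS_pow u l (k - i)%nat) k) k.

(* x^2 u' + u (1 + a^0 x) = g(x, u), coefficient by coefficient. *)
Definition formal_solution (p : params) (u : nat -> R) : Prop :=
  u 0%nat = 0 /\ u 1%nat = 0 /\
  forall k, PS_incr_n (PS_derive u) 2 k + (u k + lin p * PS_incr_1 u k)
            = g_coef p u k.

(* [params_norm_le rho v r] says that v has norm at most r for the sup norm
   weighted as in the bounds of [admissible]:
   max (|a|, |mu|, sup_k |f_k| rho^k, sup_{k,l} |h_{k,l}| rho^(k+l)) <= r. *)
Definition params_norm_le (rho : R) (v : params) (r : R) : Prop :=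
  Rabs (lin v) <= r /\ Rabs (mu v) <= r /\
  (forall k, Rabs (fc v k) <= r / rho ^ k) /\
  (forall k l, Rabs (hc v k l) <= r / rho ^ (k + l)).

Definition bounded_linear (rho : R) (L : params -> R) : Prop :=
  (forall v w r s, params_norm_le rho v r -> params_norm_le rho w s ->
     L (params_add v w) = L v + L w) /\
  (forall t v r, params_norm_le rho v r -> L (params_scal t v) = t * L v) /\
  (exists C, forall v r, params_norm_le rho v r -> Rabs (L v) <= C * r).

(* F is continuously Frechet differentiable on D, relative to D (one-sided at
   boundary points of D), for the weighted sup norm. *)
Definition C1_on (rho : R) (D : params -> Prop) (F : params -> R) : Prop :=
  exists L : params -> params -> R,
    (forall p, D p -> bounded_linear rho (L p)) /\
    (forall p, D p -> forall eps, 0 < eps -> exists delta, 0 < delta /\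
       forall q r, D q -> r < delta -> params_norm_le rho (params_sub q p) r ->
         Rabs (F q - F p - L p (params_sub q p)) <= eps * r) /\
    (forall p, D p -> forall eps, 0 < eps -> exists delta, 0 < delta /\
       forall q, D q -> params_norm_le rho (params_sub q p) delta ->
         forall v r, params_norm_le rho v r ->
           Rabs (L q v - L p v) <= eps * r).

(* Main.v *)
Require Import Defs.
From Stdlib Require Import Reals Factorial Lra Lia Arith.
From Stdlib Require Import FunctionalExtensionality IndefiniteDescription.
From Coquelicot Require Import Coquelicot.

(** The coefficients of the formal solution u satisfy
      u_k = - (k - 1 + a) u_(k-1) + g_k,
    where g_k is the coefficient of x^k in g(x, u(x)).  Dividing by
    (-1)^k Gamma(k + a) makes the linear part telescope ([fsol_telescope]):
      (-1)^k u_k / Gamma(k + a) = sum of (-1)^j g_j / Gamma(j + a), 2 <= j <= k.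
    The limit exists once the series on the right converges, and it is then the
    sum of that series.

    Convergence rests on factorial growth.  Every monomial of h carries a factor
    x y^2 and u starts at x^2, so the nonlinear part of g_k only involves u_j with
    j <= k - 3.  If |u_j| <= M Gamma(j + a), a convolution of such sequences is
    controlled by its two end terms ([poch_conv_le]); hence u^l loses two orders
    for each further factor ([PS_pow_poch2_le]), the double sum over the monomials
    of h converges geometrically ([nonlinear_term_le]), and the nonlinear part of
    g_k is O(Gamma(k - 3 + a)).  Relative to Gamma(k + a) this is O(k^(-3)), with a
    factor mu in front, so for small mu the bound |u_j| <= M Gamma(j + a)
    reproduces itself ([fsol_growth]).

    Smoothness in all parameters at once comes from running the same estimates in
    a different algebra.  Functions of the parameters that are bounded, with a
    bounded Lipschitz derivative, form an algebra with the submultiplicative norm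
    sup |F| + c Lip(F) + (c^2 / 2) Lip(DF) ([C11_le], [C11_le_mult]), and a series
    that converges in this norm has a C^1 sum ([C11_le_series]).  The recursion
    only feeds in the norms of k + a and of 1 / (k + a).  When a stays close to
    a^0 and c is small they are at most k + A + 1 and 1 / (k + A) for some A > -2:
    compared with the scalar estimate a single power of k is lost, and the terms
    of the series are still O(k^(-2)).  The remaining factor 1 / Gamma(2 + a) is
    treated by differentiating the integral for Gamma ([Gamma_taylor_bounds]).

    This gives S = (F + mu H) / Gamma(2 + a), where F is linear in f and increases
    by t - f_2 when f_2 is replaced by t ([lin_sum_with_f2]), while H is Lipschitz.
    So the difference quotients of S in f_2, and with them the derivative, lie
    within O(mu) of 1 / Gamma(2 + a).

    For a center manifold m, inserting asymptotic expansions at 0 into the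
    differential equation shows that the Taylor coefficients of m solve the formal
    equation ([center_manifold_formal]), whose solution is unique.  If m is
    analytic, its coefficients grow at most geometrically, so division by
    Gamma(k + a) sends them to 0 and S = 0 ([geometric_growth_limit]). *)

Open Scope R_scope.

(** * Gamma as an improper integral *)

Definition is_RInt_pos (f : R -> R) (l : R) : Prop :=
  is_RInt_gen f (at_right 0) (Rbar_locally p_infty) l.

Definition continuous_pos (f : R -> R) : Prop :=
  forall t, 0 < t -> continuous f t.

Lemma ex_RInt_pos f a b :
  continuous_pos f -> 0 < a -> 0 < b -> ex_RInt f a b.
Proof.
  intros Hf Ha Hb; apply (ex_RInt_continuous (V := R_CompleteNormedModule)).
  intros z [Hz _]; apply Hf.
  apply Rlt_le_trans with (2 := Hz); apply Rmin_glb_lt; assumption.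
Qed.

Lemma abs_RInt_le_dominated f g a b :
  continuous_pos f -> continuous_pos g ->
  (forall t, 0 < t -> Rabs (f t) <= g t) -> 0 < a -> 0 < b ->
  Rabs (RInt f a b) <= Rabs (RInt g a b).
Proof.
  intros Hf Hg Hfg.
  assert (H : forall u v, 0 < u -> u <= v ->
            Rabs (RInt f u v) <= Rabs (RInt g u v)).
  { intros u v Hu Huv.
    apply Rle_trans with (2 := Rle_abs _).
    apply (norm_RInt_le f g u v).
    - exact Huv.
    - intros x Hx; apply Hfg; lra.
    - apply (RInt_correct (V := R_CompleteNormedModule)), ex_RInt_pos; trivial; lra.
    - apply (RInt_correct (V := R_CompleteNormedModule)), ex_RInt_pos; trivial; lra. }
  intros Ha Hb; destruct (Rle_dec a b) as [Hab | Hab].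
  - now apply H.
  - rewrite <- (opp_RInt_swap f) by (apply ex_RInt_pos; trivial).
    rewrite <- (opp_RInt_swap g) by (apply ex_RInt_pos; trivial).
    unfold opp; simpl; rewrite 2!Rabs_Ropp; apply H; lra.
Qed.

Lemma filter_prod_pos (P : R * R -> Prop) :
  (forall a b, 0 < a < 1 -> 1 < b -> P (a, b)) ->
  filter_prod (at_right 0) (Rbar_locally p_infty) P.
Proof.
  intros HP.
  apply (Filter_prod _ _ _ (fun a => 0 < a < 1) (fun b => 1 < b)).
  - exists (mkposreal 1 Rlt_0_1); intros y Hy Hy0.
    apply Rabs_lt_between in Hy; unfold minus, plus, opp in Hy; simpl in Hy.
    lra.
  - now exists 1.
  - intros a b; apply HP.
Qed.

Lemma is_RInt_pos_abs_le f g lf lg :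
  (forall t, 0 < t -> Rabs (f t) <= g t) ->
  is_RInt_pos f lf -> is_RInt_pos g lg -> Rabs lf <= lg.
Proof.
  intros Hfg Hlf Ig.
  apply (RInt_gen_norm (Fa := at_right 0) (Fb := Rbar_locally p_infty) f g lf lg).
  - apply filter_prod_pos; simpl; intros; lra.
  - apply filter_prod_pos; simpl; intros; apply Hfg; lra.
  - exact Hlf.
  - exact Ig.
Qed.

(** Domination turns the Cauchy criterion for the integrals of g over large
    intervals into the one for f: changing one end point changes the integral of f
    by no more than it changes the integral of g. *)
Lemma improper_dominated f g lg :
  continuous_pos f -> continuous_pos g ->
  (forall t, 0 < t -> Rabs (f t) <= g t) ->
  is_RInt_pos g lg ->
  exists lf, is_RInt_pos f lf /\ Rabs lf <= lg.
Proof.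
  intros Hf Hg Hfg Ig.
  assert (Hex : exists lf, is_RInt_pos f lf).
  { destruct (proj1 (filterlim_locally_cauchy (U := R_CompleteSpace)
       (F := filter_prod (at_right 0) (Rbar_locally p_infty))
       (fun ab => RInt f (fst ab) (snd ab)))) as [y Hy].
    - intros eps.
      assert (He : 0 < eps / 4) by (destruct eps; simpl; lra).
      destruct (Ig _ (locally_ball lg (mkposreal _ He))) as [P Q HP HQ HPQ].
      exists (fun ab => (P (fst ab) /\ 0 < fst ab < 1) /\
                        (Q (snd ab) /\ 1 < snd ab)).
      split.
      { assert (H1 := filter_prod_pos
          (fun ab => 0 < fst ab < 1 /\ 1 < snd ab)
          (fun a b H1 H2 => conj H1 H2)).
        generalize (filter_and _ _ H1
          (Filter_prod _ _ (fun ab => P (fst ab) /\ Q (snd ab)) P Q HP HQ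
            (fun a b H1 H2 => conj H1 H2))).
        apply filter_imp; intros ab; tauto. }
      intros [a b] [a' b'] [[Pa Ha] [Qb Hb]] [[Pa' Ha'] [Qb' Hb']]; simpl in *.
      assert (Hg1 : forall u v, P u -> 0 < u < 1 -> Q v -> 1 < v ->
                Rabs (RInt g u v - lg) < eps / 4).
      { intros u v Pu Hu Qv Hv; destruct (HPQ u v Pu Qv) as [w [Hw Bw]].
        simpl in Hw; rewrite (is_RInt_unique _ _ _ _ Hw); exact Bw. }
      assert (Ch : forall k u v w, continuous_pos k -> 0 < u -> 0 < v -> 0 < w ->
                RInt k u w = RInt k u v + RInt k v w).
      { intros k u v w Hk Hu Hv Hw; symmetry.
        apply (RInt_Chasles k u v w); apply ex_RInt_pos; trivial. }
      assert (E1 : Rabs (RInt f a a') <= Rabs (RInt g a a'))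
        by (apply abs_RInt_le_dominated; trivial; lra).
      assert (E2 : Rabs (RInt f b b') <= Rabs (RInt g b b'))
        by (apply abs_RInt_le_dominated; trivial; lra).
      assert (K1 := Ch f a a' b' Hf ltac:(lra) ltac:(lra) ltac:(lra)).
      assert (K2 := Ch f a b b' Hf ltac:(lra) ltac:(lra) ltac:(lra)).
      assert (K3 := Ch g a a' b' Hg ltac:(lra) ltac:(lra) ltac:(lra)).
      assert (K4 := Ch g a b b' Hg ltac:(lra) ltac:(lra) ltac:(lra)).
      assert (G1 := Hg1 a b Pa Ha Qb Hb).
      assert (G2 := Hg1 a b' Pa Ha Qb' Hb').
      assert (G3 := Hg1 a' b' Pa' Ha' Qb' Hb').
      change (Rabs (RInt f a' b' - RInt f a b) < eps).
      apply Rabs_lt_between in G1; apply Rabs_lt_between in G2;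
      apply Rabs_lt_between in G3.
      assert (E3 : Rabs (RInt g a a') < eps / 2) by (apply Rabs_lt_between; lra).
      assert (E4 : Rabs (RInt g b b') < eps / 2) by (apply Rabs_lt_between; lra).
      assert (E5 : Rabs (RInt f a a') < eps / 2) by lra.
      assert (E6 : Rabs (RInt f b b') < eps / 2) by lra.
      apply Rabs_lt_between in E5; apply Rabs_lt_between in E6.
      apply Rabs_lt_between; lra.
    - exists y; intros S HS.
      assert (Hy' : filter_prod (at_right 0) (Rbar_locally p_infty)
                (fun ab => S (RInt f (fst ab) (snd ab)))) by exact (Hy S HS).
      refine (filter_imp (F := filter_prod (at_right 0) (Rbar_locally p_infty))
        _ _ _ (filter_and _ _ Hy'
        (filter_prod_pos (fun ab => ex_RInt f (fst ab) (snd ab))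
          (fun a b Ha Hb => ex_RInt_pos f a b Hf _ _)))); simpl; try lra.
      intros ab [H1 H2].
      exists (RInt f (fst ab) (snd ab)); split; [| exact H1].
      apply (RInt_correct (V := R_CompleteNormedModule)), H2. }
  destruct Hex as [lf Hlf]; exists lf; split; [exact Hlf |].
  exact (is_RInt_pos_abs_le f g lf lg Hfg Hlf Ig).
Qed.

Definition gamma_density (z t : R) : R := Rpower t (z - 1) * exp (- t).

Lemma continuous_pos_derive f :
  (forall t, 0 < t -> ex_derive f t) -> continuous_pos f.
Proof. intros H t Ht; apply (ex_derive_continuous f), H, Ht. Qed.

Lemma is_derive_Rpower_l z t : 0 < t ->
  is_derive (fun s => Rpower s z) t (z * Rpower t (z - 1)).
Proof.
  intros Ht; apply is_derive_Reals, derivable_pt_lim_power, Ht.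
Qed.

Lemma gamma_density_continuous z : continuous_pos (gamma_density z).
Proof.
  apply continuous_pos_derive; intros t Ht; unfold gamma_density.
  apply (ex_derive_mult (fun t => Rpower t (z - 1)) (fun t => exp (- t))).
  - exists ((z - 1) * Rpower t (z - 1 - 1)); now apply is_derive_Rpower_l.
  - auto_derive; trivial.
Qed.

Lemma Rpower_lim_0 z : 0 < z ->
  filterlim (fun t => Rpower t z) (at_right 0) (locally 0).
Proof.
  intros Hz; apply (proj2 (filterlim_locally _ _)); intros eps.
  exists (mkposreal (Rpower eps (/ z)) (exp_pos _)).
  intros t Ht Ht0.
  apply Rabs_lt_between in Ht; unfold minus, plus, opp in Ht; simpl in Ht.
  change (Rabs (Rpower t z - 0) < eps).
  rewrite Rminus_0_r, Rabs_right by (left; apply exp_pos).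
  assert (E : pos eps = Rpower (Rpower eps (/ z)) z).
  { rewrite Rpower_mult, Rinv_l, Rpower_1; trivial; [apply eps | lra]. }
  rewrite E; apply Rlt_Rpower_l; lra.
Qed.

Lemma pow_div_fact_le_exp x n : 0 <= x -> x ^ n / INR (fact n) <= exp x.
Proof.
  intros Hx; apply Rle_trans with (2 := exp_ge_taylor x n Hx).
  destruct n as [| n]; [simpl; lra |]; rewrite tech5.
  assert (0 <= sum_f_R0 (fun k => x ^ k / INR (fact k)) n).
  { apply cond_pos_sum; intros k; apply Rmult_le_pos;
      [now apply pow_le | left; apply Rinv_0_lt_compat, INR_fact_lt_0]. }
  lra.
Qed.

(** For t >= 1 compare with an integer power t^n, which is one term of the
    exponential series of t / 2 up to the factor 2^n n!. *)
Lemma Rpower_le_exp_half z : exists K, 0 < K /\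
  forall t, 0 < t -> 0 <= z -> Rpower t z <= K * exp (t / 2).
Proof.
  destruct (INR_unbounded z) as [n Hn].
  assert (Hf : 0 < INR (fact n)) by (apply INR_fact_lt_0).
  assert (H2 : 0 < 2 ^ n) by (apply pow_lt; lra).
  exists (1 + 2 ^ n * INR (fact n)); split; [nra |].
  intros t Ht Hz.
  assert (He : 1 <= exp (t / 2)) by (generalize (exp_ineq1_le (t / 2)); lra).
  assert (HK : 0 < 2 ^ n * INR (fact n)) by nra.
  destruct (Rle_dec t 1) as [H1 | H1].
  - apply Rle_trans with 1; [| nra].
    rewrite <- (Rpower_O 1) by lra.
    destruct (Req_dec z 0) as [-> | Hz0]; [rewrite 2!Rpower_O; lra |].
    apply Rle_trans with (Rpower 1 z).
    + apply Rle_Rpower_l; lra.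
    + unfold Rpower; rewrite ln_1, !Rmult_0_r; lra.
  - apply Rle_trans with (Rpower t (INR n)).
    + apply Rle_Rpower; lra.
    + rewrite Rpower_pow by lra.
      assert (Ht2 : 0 <= t / 2) by lra.
      assert (Hle := pow_div_fact_le_exp (t / 2) n Ht2).
      replace (t ^ n) with (2 ^ n * INR (fact n) * ((t / 2) ^ n / INR (fact n))).
      2:{ unfold Rdiv at 2; rewrite Rpow_mult_distr, pow_inv; field; split; lra. }
      nra.
Qed.

Lemma Rpower_exp_lim_infty z : 0 <= z ->
  filterlim (fun t => Rpower t z * exp (- t)) (Rbar_locally p_infty) (locally 0).
Proof.
  intros Hz; destruct (Rpower_le_exp_half z) as [K [HK H]].
  apply (filterlim_le_le (fun _ => 0) _ (fun t => K * exp (- (t / 2))) 0).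
  - exists 1; intros t Ht; split.
    + apply Rmult_le_pos; left; apply exp_pos.
    + replace (- (t / 2)) with (t / 2 + - t) by field.
      rewrite exp_plus, <- Rmult_assoc.
      apply Rmult_le_compat_r; [left; apply exp_pos | apply H; lra].
  - apply filterlim_const.
  - replace 0 with (K * 0) by ring.
    apply (is_lim_scal_l (fun t => exp (- (t / 2))) K p_infty 0).
    apply (is_lim_comp exp (fun t => - (t / 2)) p_infty 0 m_infty).
    + apply is_lim_exp_m.
    + apply (is_lim_ext (fun t => (- / 2) * t)); [intros; field |].
      replace m_infty with (Rbar_mult (- / 2) p_infty).
      2:{ simpl; case Rle_dec; intros H1; [exfalso; lra | reflexivity]. }
      apply is_lim_scal_l, is_lim_id.
    + now exists 0.
Qed.

Lemma is_RInt_pos_derive (f f' : R -> R) (la lb : R) :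
  (forall t, 0 < t -> is_derive f t (f' t)) -> continuous_pos f' ->
  filterlim f (at_right 0) (locally la) ->
  filterlim f (Rbar_locally p_infty) (locally lb) ->
  is_RInt_pos f' (lb - la).
Proof.
  intros Hd Hc H0 H1.
  assert (Hpos : forall a b x, 0 < a < 1 -> 1 < b ->
            Rmin a b <= x <= Rmax a b -> 0 < x).
  { intros a b x Ha Hb Hx; rewrite Rmin_left in Hx; lra. }
  refine (is_RInt_gen_ext (V := R_NormedModule) (Fa := at_right 0)
            (Fb := Rbar_locally p_infty) (Derive f) f' (lb - la) _ _).
  - apply filter_prod_pos; simpl; intros a b Ha Hb x Hx.
    apply is_derive_unique, Hd, (Hpos a b); lra.
  - apply is_RInt_gen_Derive; trivial.
    + apply filter_prod_pos; simpl; intros a b Ha Hb x Hx.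
      exists (f' x); apply Hd, (Hpos a b); trivial.
    + apply filter_prod_pos; simpl; intros a b Ha Hb x Hx.
      assert (Hx0 : 0 < x) by (apply (Hpos a b); trivial).
      apply (continuous_ext_loc _ f').
      * exists (mkposreal x Hx0); intros y Hy.
        apply Rabs_lt_between in Hy; unfold minus, plus, opp in Hy; simpl in Hy.
        symmetry; apply is_derive_unique, Hd; lra.
      * apply Hc, Hx0.
Qed.

Lemma is_RInt_pos_scal k f l :
  is_RInt_pos f l -> is_RInt_pos (fun t => k * f t) (k * l).
Proof.
  exact (is_RInt_gen_scal (V := R_NormedModule) (Fa := at_right 0)
           (Fb := Rbar_locally p_infty) f k l).
Qed.

Lemma is_RInt_pos_plus f g lf lg :
  is_RInt_pos f lf -> is_RInt_pos g lg ->
  is_RInt_pos (fun t => f t + g t) (lf + lg).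
Proof.
  exact (is_RInt_gen_plus (V := R_NormedModule) (Fa := at_right 0)
           (Fb := Rbar_locally p_infty) f g lf lg).
Qed.

Lemma is_RInt_pos_minus f g lf lg :
  is_RInt_pos f lf -> is_RInt_pos g lg ->
  is_RInt_pos (fun t => f t - g t) (lf - lg).
Proof.
  exact (is_RInt_gen_minus (V := R_NormedModule) (Fa := at_right 0)
           (Fb := Rbar_locally p_infty) f g lf lg).
Qed.

Lemma is_RInt_pos_ext f g l :
  (forall t, 0 < t -> f t = g t) -> is_RInt_pos f l -> is_RInt_pos g l.
Proof.
  intros H; apply is_RInt_gen_ext, filter_prod_pos; simpl.
  intros a b Ha Hb x Hx; rewrite Rmin_left in Hx; [apply H |]; lra.
Qed.

Lemma Rpower_lim_infty_inv z : 0 < z ->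
  filterlim (fun t => / (1 + Rpower t z)) (Rbar_locally p_infty) (locally 0).
Proof.
  intros Hz; apply (proj2 (filterlim_locally _ _)); intros eps.
  exists (Rpower (/ eps) (/ z)); intros t Ht.
  change (Rabs (/ (1 + Rpower t z) - 0) < eps).
  assert (He : 0 < / eps) by (apply Rinv_0_lt_compat, eps).
  assert (Hp : 0 < Rpower t z) by apply exp_pos.
  rewrite Rminus_0_r, Rabs_right by (left; apply Rinv_0_lt_compat; lra).
  rewrite <- (Rinv_inv eps); apply Rinv_lt_contravar.
  - apply Rmult_lt_0_compat; lra.
  - apply Rlt_trans with (Rpower t z); [| lra].
    replace (/ eps) with (Rpower (Rpower (/ eps) (/ z)) z).
    + apply Rlt_Rpower_l; [lra |]. split; [apply exp_pos | exact Ht].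
    + rewrite Rpower_mult, Rinv_l, Rpower_1; lra.
Qed.

(** The dominating function is a multiple of the derivative of t^z / (1 + t^z).
    This primitive has finite limits at both ends, and its derivative has the right
    order t^(z-1) at 0; at infinity the exponential wins. *)
Lemma is_RInt_Gamma z : 0 < z -> is_RInt_pos (gamma_density z) (Gamma z).
Proof.
  intros Hz.
  (* Primitive - 1 / (1 + t^z), from -1 at 0 to 0 at infinity. *)
  set (h t := z * Rpower t (z - 1) / (1 + Rpower t z) ^ 2).
  assert (Hp : forall t, 0 < Rpower t z) by (intros; apply exp_pos).
  assert (Ch : continuous_pos h).
  { apply continuous_pos_derive; intros t Ht; unfold h; specialize (Hp t).
    assert (D1 : ex_derive (fun t => Rpower t (z - 1)) t)
      by (eexists; apply is_derive_Rpower_l, Ht).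
    assert (D2 : ex_derive (fun t => Rpower t z) t)
      by (eexists; apply is_derive_Rpower_l, Ht).
    apply (ex_derive_mult (fun t => z * Rpower t (z - 1))).
    - apply (ex_derive_scal (fun t => Rpower t (z - 1)) z), D1.
    - apply ex_derive_inv.
      + apply ex_derive_pow, (ex_derive_plus (fun _ => 1)), D2.
        apply ex_derive_const.
      + apply pow_nonzero; lra. }
  assert (Hh : is_RInt_pos h (0 - -1)).
  { apply (is_RInt_pos_derive (fun t => - / (1 + Rpower t z))).
    - intros t Ht; unfold h; specialize (Hp t).
      evar_last.
      { apply (is_derive_opp (fun t => / (1 + Rpower t z))).
        apply (is_derive_inv (fun t => 1 + Rpower t z)); [| lra].
        apply (is_derive_plus (fun _ => 1) (fun t => Rpower t z));
          [apply is_derive_const | apply is_derive_Rpower_l, Ht]. }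
      unfold opp, plus, zero; simpl; field; lra.
    - exact Ch.
    - replace (locally (-1)) with (locally (opp (/ (1 + 0))))
        by (f_equal; unfold opp; simpl; field).
      apply (filterlim_comp _ _ _ (fun t => / (1 + Rpower t z)) opp _
               (locally (/ (1 + 0)))); [| apply (filterlim_opp (/ (1 + 0)))].
      apply (filterlim_comp _ _ _ (fun t => Rpower t z) (fun x => / (1 + x)) _
               (locally 0)); [now apply Rpower_lim_0 |].
      apply (ex_derive_continuous (fun x : R => / (1 + x)) 0); auto_derive; lra.
    - replace (locally 0) with (locally (opp 0))
        by (f_equal; unfold opp; simpl; ring).
      apply (filterlim_comp _ _ _ (fun t => / (1 + Rpower t z)) opp _
               (locally 0)); [| apply (filterlim_opp 0)].
      now apply Rpower_lim_infty_inv. }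
  destruct (Rpower_le_exp_half z) as [K [HK H]].
  set (C := (1 + K) ^ 2 / z).
  destruct (improper_dominated (gamma_density z) (fun t => C * h t) (C * (0 - -1)))
    as [l [Hl _]].
  - apply gamma_density_continuous.
  - intros t Ht; apply (continuous_scal_r C h), Ch, Ht.
  - intros t Ht; unfold gamma_density, h, C.
    assert (H1 : 0 < Rpower t (z - 1)) by apply exp_pos.
    assert (H2 : 0 < exp (- t)) by apply exp_pos.
    assert (H3 : exp (t / 2) * exp (t / 2) * exp (- t) = 1).
    { rewrite <- 2!exp_plus, <- exp_0; f_equal; field. }
    assert (H4 : 1 <= exp (t / 2)) by (generalize (exp_ineq1_le (t / 2)); lra).
    assert (H5 := H t Ht ltac:(lra)); specialize (Hp t).
    rewrite Rabs_right by (left; apply Rmult_lt_0_compat; trivial).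
    set (P := Rpower t (z - 1)) in *; set (Q := Rpower t z) in *.
    replace ((1 + K) ^ 2 / z * (z * P / (1 + Q) ^ 2))
      with (P * ((1 + K) ^ 2 / (1 + Q) ^ 2)) by (field; lra).
    apply Rmult_le_compat_l; [lra |].
    apply Rmult_le_reg_r with ((1 + Q) ^ 2); [apply pow_lt; lra |].
    replace ((1 + K) ^ 2 / (1 + Q) ^ 2 * (1 + Q) ^ 2) with ((1 + K) ^ 2)
      by (field; lra).
    assert (H6 : 1 + Q <= (1 + K) * exp (t / 2)) by nra.
    apply Rle_trans with (exp (- t) * ((1 + K) * exp (t / 2)) ^ 2).
    + apply Rmult_le_compat_l; [lra |]. apply pow_incr; lra.
    + right; replace (exp (- t) * ((1 + K) * exp (t / 2)) ^ 2)
        with ((1 + K) ^ 2 * (exp (t / 2) * exp (t / 2) * exp (- t))) by ring.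
      rewrite H3; ring.
  - apply (is_RInt_pos_scal C h _ Hh).
  - refine (RInt_gen_correct (V := R_CompleteNormedModule) (Fa := at_right 0)
      (Fb := Rbar_locally p_infty) (gamma_density z) _).
    exists l; exact Hl.
Qed.

Lemma is_RInt_pos_unique f l1 l2 :
  is_RInt_pos f l1 -> is_RInt_pos f l2 -> l1 = l2.
Proof.
  intros H1 H2.
  transitivity (RInt_gen f (at_right 0) (Rbar_locally p_infty)).
  - symmetry; apply is_RInt_gen_unique, H1.
  - apply is_RInt_gen_unique, H2.
Qed.

(** Integration by parts: z t^(z-1) e^(-t) - t^z e^(-t) is the derivative of
    t^z e^(-t), which vanishes at both ends. *)
Lemma Gamma_succ z : 0 < z -> Gamma (1 + z) = z * Gamma z.
Proof.
  intros Hz.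
  assert (H : is_RInt_pos
            (fun t => z * gamma_density z t - gamma_density (1 + z) t)
            (0 - 0)).
  { apply (is_RInt_pos_derive (fun t => Rpower t z * exp (- t))).
    - intros t Ht; evar_last.
      { apply (is_derive_mult (fun t => Rpower t z) (fun t => exp (- t)) t
                 (z * Rpower t (z - 1)) (- exp (- t))).
        - now apply is_derive_Rpower_l.
        - auto_derive; trivial; ring.
        - intros; apply Rmult_comm. }
      unfold gamma_density, plus, mult; simpl.
      replace (1 + z - 1) with z by ring; ring.
    - intros t Ht.
      apply (continuous_minus (fun t => z * gamma_density z t)).
      + apply (continuous_scal_r z (gamma_density z)), gamma_density_continuous, Ht.
      + apply gamma_density_continuous, Ht.
    - apply (filterlim_le_le (fun _ => 0) _ (fun t => Rpower t z) 0).
      + exists (mkposreal 1 Rlt_0_1); intros t _ Ht.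
        assert (H1 : 0 < Rpower t z) by apply exp_pos.
        assert (H2 : 0 < exp (- t)) by apply exp_pos.
        assert (H3 : exp (- t) < 1) by (rewrite <- exp_0; apply exp_increasing; lra).
        split; [apply Rmult_le_pos; lra | nra].
      + apply filterlim_const.
      + now apply Rpower_lim_0.
    - apply Rpower_exp_lim_infty; lra. }
  assert (H' := is_RInt_pos_minus _ _ _ _
    (is_RInt_pos_scal z _ _ (is_RInt_Gamma z Hz))
    (is_RInt_Gamma (1 + z) ltac:(lra))).
  generalize (is_RInt_pos_unique _ _ _ H H'); lra.
Qed.

(** Enlarging the interval increases the integral, so the limit is at least the
    integral over [1, 2]. *)
Lemma Gamma_pos z : 0 < z -> 0 < Gamma z.
Proof.
  intros Hz.
  assert (Hc := gamma_density_continuous z).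
  assert (Hd : forall t, 0 < gamma_density z t)
    by (intros t; apply Rmult_lt_0_compat; apply exp_pos).
  set (m := RInt (gamma_density z) 1 2).
  assert (Hm : 0 < m).
  { apply RInt_gt_0; [lra | intros; apply Hd | intros t Ht; apply Hc; lra]. }
  apply Rlt_le_trans with (1 := Hm), Rnot_lt_le; intros Hlt.
  assert (He : 0 < m - Gamma z) by lra.
  destruct (is_RInt_Gamma z Hz _ (locally_ball _ (mkposreal _ He)))
    as [P Q [d HP] [N HQ] HPQ].
  set (a := Rmin (d / 2) (1 / 2)); set (b := Rmax (N + 1) 3).
  assert (Hd0 : 0 < d) by apply d.
  assert (Ha : 0 < a) by (apply Rmin_glb_lt; lra).
  assert (Ha1 : a <= 1 / 2) by apply Rmin_r.
  assert (Ha2 : a <= d / 2) by apply Rmin_l.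
  assert (Hb : 3 <= b) by apply Rmax_r.
  assert (Hb2 : N + 1 <= b) by apply Rmax_l.
  destruct (HPQ a b) as [v [Hv Bv]].
  - apply HP; [| exact Ha].
    apply Rabs_lt_between; unfold minus, plus, opp; simpl; lra.
  - apply HQ; lra.
  - simpl in Hv; rewrite <- (is_RInt_unique _ _ _ _ Hv) in Bv.
    apply Rabs_lt_between in Bv; unfold minus, plus, opp in Bv; simpl in Bv.
    assert (C1 : RInt (gamma_density z) a b =
                 RInt (gamma_density z) a 1 + m + RInt (gamma_density z) 2 b).
    { unfold m; rewrite <- (RInt_Chasles (gamma_density z) a 2 b)
        by (apply ex_RInt_pos; trivial; lra).
      rewrite <- (RInt_Chasles (gamma_density z) a 1 2)
        by (apply ex_RInt_pos; trivial; lra).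
      reflexivity. }
    assert (C2 : 0 <= RInt (gamma_density z) a 1).
    { apply RInt_ge_0; [lra | apply ex_RInt_pos; trivial; lra |].
      intros; left; apply Hd. }
    assert (C3 : 0 <= RInt (gamma_density z) 2 b).
    { apply RInt_ge_0; [lra | apply ex_RInt_pos; trivial; lra |].
      intros; left; apply Hd. }
    lra.
Qed.

(** * Regularity of the Gamma function *)

(** Convexity: the chord slope lies between the slopes at the end points. *)
Lemma exp_chord_bounds u v :
  (v - u) * exp u <= exp v - exp u <= (v - u) * exp v.
Proof.
  assert (H1 := exp_ineq1_le (v - u)); assert (H2 := exp_ineq1_le (u - v)).
  assert (E1 : exp v = exp u * exp (v - u)) by (rewrite <- exp_plus; f_equal; ring).
  assert (E2 : exp u = exp v * exp (u - v)) by (rewrite <- exp_plus; f_equal; ring).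
  assert (P1 := exp_pos u); assert (P2 := exp_pos v).
  split.
  - rewrite E1 at 1; nra.
  - rewrite E2 at 1; nra.
Qed.

(** First order expansion of z -> exp (z s) and of its derivative.  The bound m is
    required only at the two points z and w: by [exp_chord_bounds] all errors are
    controlled by the values there. *)
Lemma exp_taylor_bounds s z w m :
  Rabs s * exp (z * s) <= m -> Rabs s * exp (w * s) <= m ->
  s ^ 2 * exp (z * s) <= m -> s ^ 2 * exp (w * s) <= m ->
  Rabs (exp (w * s) - exp (z * s)) <= Rabs (w - z) * m /\
  Rabs (exp (w * s) - exp (z * s) - (w - z) * (s * exp (z * s)))
    <= (w - z) ^ 2 * m /\
  Rabs (s * exp (w * s) - s * exp (z * s)) <= Rabs (w - z) * m.
Proof.
  destruct (exp_chord_bounds (z * s) (w * s)) as [H1 H2].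
  assert (PX := exp_pos (z * s)); assert (PY := exp_pos (w * s)).
  set (X := exp (z * s)) in *; set (Y := exp (w * s)) in *.
  replace (w * s - z * s) with ((w - z) * s) in * by ring.
  set (d := w - z) in *; intros Hz1 Hw1 Hz2 Hw2.
  assert (B1 : Rabs (Y - X) <= Rmax (Rabs (d * s) * X) (Rabs (d * s) * Y)).
  { apply Rabs_le; split.
    - apply Rle_trans with (- (Rabs (d * s) * X)); [| ].
      + apply Ropp_le_contravar, Rmax_l.
      + assert (H3 := Rle_abs (- (d * s))); rewrite Rabs_Ropp in H3; nra.
    - apply Rle_trans with (Rabs (d * s) * Y); [| apply Rmax_r].
      assert (H3 := Rle_abs (d * s)); nra. }
  rewrite Rabs_mult in B1.
  assert (Pd := Rabs_pos d); assert (Ps := Rabs_pos s).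
  assert (B2 : Rabs (Y - X) <= Rabs d * m).
  { apply Rle_trans with (1 := B1), Rmax_lub; nra. }
  assert (Es : s ^ 2 = Rabs s * Rabs s).
  { rewrite <- Rabs_mult, Rabs_right; [ring | nra]. }
  assert (Ed : d ^ 2 = Rabs d * Rabs d).
  { rewrite <- Rabs_mult, Rabs_right; [ring | nra]. }
  rewrite Es in *.
  assert (B3 : Rabs s * Rabs (Y - X) <= Rabs d * m).
  { apply Rle_trans with (Rabs s * Rmax (Rabs d * Rabs s * X) (Rabs d * Rabs s * Y)).
    - apply Rmult_le_compat_l; trivial.
    - apply Rmax_case; nra. }
  split; [exact B2 | split].
  - replace (d * (s * X)) with (d * s * X) by ring.
    rewrite Rabs_right by lra.
    apply Rle_trans with (d * s * (Y - X)); [nra |].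
    apply Rle_trans with (1 := Rle_abs _).
    rewrite 2!Rabs_mult, Ed; nra.
  - replace (s * Y - s * X) with (s * (Y - X)) by ring.
    now rewrite Rabs_mult.
Qed.

(** With s = ln t this is the splitting t^x <= t^alpha + t^beta, with room eta on
    either side to absorb powers of the logarithm. *)
Lemma exp_abs_mult_le s eta alpha beta x :
  0 <= eta -> alpha + eta <= x <= beta - eta ->
  exp (eta * Rabs s) * exp (x * s) <= exp (alpha * s) + exp (beta * s).
Proof.
  intros He Hx; rewrite <- exp_plus.
  assert (Pa := exp_pos (alpha * s)); assert (Pb := exp_pos (beta * s)).
  assert (Hm : forall u v, u <= v -> exp u <= exp v).
  { intros u v [H | ->]; [left; now apply exp_increasing | lra]. }
  destruct (Rle_dec 0 s) as [Hs | Hs].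
  - rewrite Rabs_right by lra.
    apply Rle_trans with (exp (beta * s)); [apply Hm; nra | lra].
  - rewrite Rabs_left by lra.
    apply Rle_trans with (exp (alpha * s)); [apply Hm; nra | lra].
Qed.

Lemma log_moments_le s eta alpha beta x (K := 1 + / eta + 4 / eta ^ 2) :
  0 < eta -> alpha + eta <= x <= beta - eta ->
  exp (x * s) <= K * (exp (alpha * s) + exp (beta * s)) /\
  Rabs s * exp (x * s) <= K * (exp (alpha * s) + exp (beta * s)) /\
  s ^ 2 * exp (x * s) <= K * (exp (alpha * s) + exp (beta * s)).
Proof.
  intros He Hx.
  assert (H := exp_abs_mult_le s eta alpha beta x (Rlt_le _ _ He) Hx).
  assert (P := exp_pos (x * s)).
  set (D := exp (alpha * s) + exp (beta * s)) in *; set (X := exp (x * s)) in *.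
  assert (Ps := Rabs_pos s).
  assert (Es : s ^ 2 = Rabs s * Rabs s).
  { rewrite <- Rabs_mult, Rabs_right; [ring | nra]. }
  set (r := Rabs s) in *; rewrite Es.
  assert (Hi : 0 < / eta) by now apply Rinv_0_lt_compat.
  assert (E1 := exp_ineq1_le (eta * r)).
  assert (E2 := exp_ineq1_le (eta * r / 2)).
  assert (E3 : exp (eta * r) = exp (eta * r / 2) * exp (eta * r / 2))
    by (rewrite <- exp_plus; f_equal; field).
  assert (E4 : 0 <= eta * r) by nra.
  assert (F0 : 1 <= exp (eta * r)) by lra.
  assert (F1 : r <= / eta * exp (eta * r)).
  { apply Rmult_le_reg_l with eta; [exact He |].
    rewrite <- Rmult_assoc, Rinv_r; lra. }
  assert (F2 : r * r <= 4 / eta ^ 2 * exp (eta * r)).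
  { apply Rmult_le_reg_l with (eta ^ 2 / 4); [apply Rmult_lt_0_compat; nra |].
    replace (eta ^ 2 / 4 * (4 / eta ^ 2 * exp (eta * r))) with (exp (eta * r))
      by (field; lra).
    rewrite E3; nra. }
  assert (Hi2 : 0 < 4 / eta ^ 2).
  { apply Rmult_lt_0_compat; [lra | apply Rinv_0_lt_compat, pow_lt, He]. }
  assert (HD : 0 < D) by (unfold D; generalize (exp_pos (alpha * s)) (exp_pos (beta * s)); lra).
  assert (HX : X <= D) by nra.
  assert (G : forall y k, 0 < k -> k <= K -> y <= k * exp (eta * r) -> y * X <= K * D).
  { intros y k Hk0 Hk Hy.
    apply Rle_trans with (k * (exp (eta * r) * X)); [nra |].
    apply Rle_trans with (k * D); [apply Rmult_le_compat_l; lra |].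
    apply Rmult_le_compat_r; lra. }
  unfold K in G |- *; split; [| split].
  - replace X with (1 * X) by ring; apply (G 1 1); lra.
  - apply (G r (/ eta)); lra.
  - apply (G (r * r) (4 / eta ^ 2)); lra.
Qed.

(** Differentiation under the integral.  The pointwise second order bounds for
    z -> t^(z-1) are uniform in z with the dominating density
    t^(z1/2 - 1) + t^(z2 + z1/2 - 1), whose integral is a sum of two values of
    Gamma; G1 is the integral of the derivative. *)
Lemma Gamma_taylor_bounds z1 z2 : 0 < z1 ->
  exists G1 K, 0 < K /\ forall z w, z1 <= z <= z2 -> z1 <= w <= z2 ->
    Gamma z <= K /\ Rabs (G1 z) <= K /\
    Rabs (Gamma w - Gamma z) <= K * Rabs (w - z) /\
    Rabs (Gamma w - Gamma z - (w - z) * G1 z) <= K * (w - z) ^ 2 /\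
    Rabs (G1 w - G1 z) <= K * Rabs (w - z).
Proof.
  intros Hz1.
  destruct (Rle_dec z1 z2) as [H12 | H12].
  2:{ exists (fun _ => 0), 1; split; [lra | intros; exfalso; lra]. }
  (* The room eta keeps the lower exponent alpha = z1 - eta positive. *)
  set (eta := z1 / 2); set (alpha := z1 / 2); set (beta := z2 + z1 / 2).
  set (K0 := 1 + / eta + 4 / eta ^ 2).
  set (D := fun t => K0 * (gamma_density alpha t + gamma_density beta t)).
  set (K := K0 * (Gamma alpha + Gamma beta)).
  set (g1 := fun z t => ln t * gamma_density z t).
  assert (Heta : 0 < eta) by (unfold eta; lra).
  assert (HK0 : 0 < K0).
  { assert (0 < / eta) by now apply Rinv_0_lt_compat.
    assert (0 < 4 / eta ^ 2)
      by (apply Rmult_lt_0_compat; [lra | apply Rinv_0_lt_compat, pow_lt, Heta]).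
    unfold K0; lra. }
  assert (HK : 0 < K).
  { assert (0 < Gamma alpha) by (apply Gamma_pos; unfold alpha; lra).
    assert (0 < Gamma beta) by (apply Gamma_pos; unfold beta; lra).
    apply Rmult_lt_0_compat; lra. }
  assert (ID : is_RInt_pos D K).
  { apply is_RInt_pos_scal, is_RInt_pos_plus; apply is_RInt_Gamma;
      unfold alpha, beta; lra. }
  assert (CD : continuous_pos D).
  { intros t Ht; apply (continuous_scal_r K0
      (fun t => gamma_density alpha t + gamma_density beta t)).
    apply (continuous_plus (gamma_density alpha));
      now apply gamma_density_continuous. }
  assert (Cg : forall z, continuous_pos (g1 z)).
  { intros z t Ht; apply (continuous_mult ln).
    - apply (ex_derive_continuous ln); exists (/ t).
      apply is_derive_Reals, derivable_pt_lim_ln, Ht.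
    - now apply gamma_density_continuous. }
  assert (Eg : forall z t, gamma_density z t = exp ((z - 1) * ln t) * exp (- t))
    by reflexivity.
  assert (ED : forall t, D t = K0 * (exp ((alpha - 1) * ln t) +
                 exp ((beta - 1) * ln t)) * exp (- t)).
  { intros t; unfold D; rewrite 2!Eg; ring. }
  assert (Hm : forall z t, z1 <= z <= z2 ->
    exp ((z - 1) * ln t) <= K0 * (exp ((alpha - 1) * ln t) + exp ((beta - 1) * ln t)) /\
    Rabs (ln t) * exp ((z - 1) * ln t) <=
      K0 * (exp ((alpha - 1) * ln t) + exp ((beta - 1) * ln t)) /\
    (ln t) ^ 2 * exp ((z - 1) * ln t) <=
      K0 * (exp ((alpha - 1) * ln t) + exp ((beta - 1) * ln t))).
  { intros z t Hz; apply log_moments_le; unfold alpha, beta, eta; lra. }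
  assert (Ig : forall z, z1 <= z <= z2 -> exists l, is_RInt_pos (g1 z) l /\ Rabs l <= K).
  { intros z Hz; apply (improper_dominated _ D); trivial.
    intros t Ht; rewrite ED; unfold g1; rewrite Eg.
    destruct (Hm z t Hz) as [_ [H _]].
    rewrite 2!Rabs_mult, 2!(Rabs_right (exp _)) by (left; apply exp_pos).
    rewrite <- Rmult_assoc; apply Rmult_le_compat_r; [left; apply exp_pos | exact H]. }
  exists (fun z => RInt_gen (g1 z) (at_right 0) (Rbar_locally p_infty)), K.
  split; [exact HK |]; intros z w Hz Hw; cbv beta.
  destruct (Ig z Hz) as [lz [Iz Bz]]; destruct (Ig w Hw) as [lw [Iw Bw]].
  assert (Uz : RInt_gen (g1 z) (at_right 0) (Rbar_locally p_infty) = lz)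
    by (apply is_RInt_gen_unique, Iz).
  assert (Uw : RInt_gen (g1 w) (at_right 0) (Rbar_locally p_infty) = lw)
    by (apply is_RInt_gen_unique, Iw).
  rewrite Uz, Uw; clear Uz Uw.
  assert (JZ := is_RInt_Gamma z ltac:(lra)); assert (JW := is_RInt_Gamma w ltac:(lra)).
  assert (HT := fun t => exp_taylor_bounds (ln t) (z - 1) (w - 1) _
    (proj1 (proj2 (Hm z t Hz))) (proj1 (proj2 (Hm w t Hw)))
    (proj2 (proj2 (Hm z t Hz))) (proj2 (proj2 (Hm w t Hw)))).
  replace (w - 1 - (z - 1)) with (w - z) in HT by ring.
  assert (Fin : forall f lf k, is_RInt_pos (fun t => f t * exp (- t)) lf ->
    (forall t, 0 < t -> Rabs (f t) <= k * (K0 * (exp ((alpha - 1) * ln t) +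
                 exp ((beta - 1) * ln t)))) -> Rabs lf <= K * k).
  { intros f lf k If Hf; rewrite (Rmult_comm K).
    refine (is_RInt_pos_abs_le _ (fun t => k * D t) _ _ _ If
              (is_RInt_pos_scal k _ _ ID)).
    intros t Ht; rewrite ED, Rabs_mult, (Rabs_right (exp _)) by (left; apply exp_pos).
    rewrite <- Rmult_assoc; apply Rmult_le_compat_r; [left; apply exp_pos | now apply Hf]. }
  repeat split.
  - apply Rle_trans with (1 := Rle_abs _); rewrite <- (Rmult_1_r K).
    apply (Fin (fun t => exp ((z - 1) * ln t))); [exact JZ |].
    intros t Ht; rewrite Rabs_right by (left; apply exp_pos).
    destruct (Hm z t Hz) as [H _]; lra.
  - exact Bz.
  - apply (Fin (fun t => exp ((w - 1) * ln t) - exp ((z - 1) * ln t))).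
    + apply is_RInt_pos_ext with (2 := is_RInt_pos_minus _ _ _ _ JW JZ).
      intros t _; rewrite 2!Eg; ring.
    + intros t _; apply HT.
  - apply (Fin (fun t => exp ((w - 1) * ln t) - exp ((z - 1) * ln t) -
                (w - z) * (ln t * exp ((z - 1) * ln t)))).
    + apply is_RInt_pos_ext with (2 := is_RInt_pos_minus _ _ _ _
        (is_RInt_pos_minus _ _ _ _ JW JZ) (is_RInt_pos_scal (w - z) _ _ Iz)).
      intros t _; unfold g1; rewrite 2!Eg; ring.
    + intros t _; apply HT.
  - apply (Fin (fun t => ln t * exp ((w - 1) * ln t) - ln t * exp ((z - 1) * ln t))).
    + apply is_RInt_pos_ext with (2 := is_RInt_pos_minus _ _ _ _ Iw Iz).
      intros t _; unfold g1; rewrite 2!Eg; ring.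
    + intros t _; apply HT.
Qed.

Lemma Gamma_lower_bound z1 z2 : 0 < z1 ->
  exists k, 0 < k /\ forall z, z1 <= z <= z2 -> k <= Gamma z.
Proof.
  intros Hz1.
  destruct (Rle_dec z1 z2) as [H12 | H12].
  2:{ exists 1; split; [lra | intros; exfalso; lra]. }
  destruct (continuity_ab_min Gamma z1 z2 H12) as [mz [Hmin Hmz]].
  - intros z Hz.
    destruct (Gamma_taylor_bounds (z1 / 2) (z2 + 1) ltac:(lra)) as [G1 [K [HK H]]].
    intros eps Heps; exists (Rmin (z1 / 2) (Rmin 1 (eps / K))).
    assert (He : 0 < eps / K) by (apply Rdiv_lt_0_compat; lra).
    split; [repeat apply Rmin_glb_lt; lra |].
    intros w [_ Hw]; unfold dist in *; simpl in *; unfold R_dist in *.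
    assert (M1 := Rmin_l (z1 / 2) (Rmin 1 (eps / K))).
    assert (M2 := Rmin_r (z1 / 2) (Rmin 1 (eps / K))).
    assert (M3 := Rmin_l 1 (eps / K)); assert (M4 := Rmin_r 1 (eps / K)).
    assert (Hb : Rabs (w - z) < z1 / 2) by lra.
    assert (Hb1 : Rabs (w - z) < 1) by lra.
    assert (Hb2 : Rabs (w - z) < eps / K) by lra.
    apply Rabs_lt_between in Hb; apply Rabs_lt_between in Hb1.
    destruct (H z w) as [_ [_ [HL _]]]; [lra | lra |].
    apply Rle_lt_trans with (1 := HL).
    replace eps with (K * (eps / K)) by (field; lra).
    now apply Rmult_lt_compat_l.
  - exists (Gamma mz); split; [apply Gamma_pos; lra | exact Hmin].
Qed.

(** * Calculus of C^1 functions with Lipschitz derivative *)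

Lemma Series_abs_le (a b : nat -> R) :
  (forall n, Rabs (a n) <= b n) -> ex_series b ->
  ex_series a /\ Rabs (Series a) <= Series b.
Proof.
  intros H Hb.
  assert (Ha : ex_series (fun n => Rabs (a n))).
  { apply (ex_series_le (V := R_CompleteNormedModule) _ b); trivial.
    intros n; change (Rabs (Rabs (a n)) <= b n); now rewrite Rabs_Rabsolu. }
  split; [now apply ex_series_Rabs |].
  apply Rle_trans with (1 := Series_Rabs a Ha), Series_le; trivial.
  intros n; split; [apply Rabs_pos | apply H].
Qed.

Lemma Series_nonneg (a : nat -> R) :
  ex_series a -> (forall n, 0 <= a n) -> 0 <= Series a.
Proof.
  intros Ha H; apply Rle_trans with (Rabs (Series a)); [apply Rabs_pos |].
  apply Series_abs_le; trivial; intros n; rewrite Rabs_right; [lra | apply Rle_ge, H].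
Qed.

Lemma Series_partial_le (a : nat -> R) n : ex_series a -> (forall k, 0 <= a k) ->
  sum_f_R0 a n <= Series a.
Proof.
  intros Ha H; rewrite (Series_incr_n a (S n)) by (trivial; lia); simpl pred.
  assert (0 <= Series (fun k => a (S n + k)%nat)); [| lra].
  apply Series_nonneg; trivial; now apply ex_series_incr_n.
Qed.

(** [L] is a derivative of [F] on [D] for the weighted sup norm.  [m1] bounds both
    the derivative and the Lipschitz constant, since [D] need not be convex; for the
    same reason [m2] bounds the first order remainder as well as the Lipschitz
    constant of the derivative. *)
Record C11_bound (rho : R) (D : params -> Prop) (F : params -> R)
    (L : params -> params -> R) (m0 m1 m2 : R) : Prop := {
  C11_nonneg : 0 <= m0 /\ 0 <= m1 /\ 0 <= m2;
  C11_add : forall p v w r s, D p ->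
    params_norm_le rho v r -> params_norm_le rho w s ->
    L p (params_add v w) = L p v + L p w;
  C11_scal : forall p t v r, D p -> params_norm_le rho v r ->
    L p (params_scal t v) = t * L p v;
  C11_val : forall p, D p -> Rabs (F p) <= m0;
  C11_der : forall p v r, D p -> params_norm_le rho v r -> Rabs (L p v) <= m1 * r;
  C11_lip : forall p q r, D p -> D q -> params_norm_le rho (params_sub q p) r ->
    Rabs (F q - F p) <= m1 * r;
  C11_rem : forall p q r, D p -> D q -> params_norm_le rho (params_sub q p) r ->
    Rabs (F q - F p - L p (params_sub q p)) <= m2 * r ^ 2;
  C11_der_lip : forall p q v r s, D p -> D q ->
    params_norm_le rho (params_sub q p) r -> params_norm_le rho v s ->
    Rabs (L q v - L p v) <= m2 * (r * s)
}.

(** The weights 1, c, c^2/2 are those of the second order Taylor polynomial of a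
    product, which makes the norm submultiplicative with constant 1.  With a larger
    constant the k multiplications in the recursion for u_k would lose a geometric
    factor. *)
Definition C11_le (rho c : R) (D : params -> Prop) (F : params -> R) (nu : R) : Prop :=
  exists L m0 m1 m2, C11_bound rho D F L m0 m1 m2 /\
    m0 + c * m1 + c ^ 2 / 2 * m2 <= nu.

Lemma params_norm_le_nonneg rho v r : params_norm_le rho v r -> 0 <= r.
Proof. intros [H _]; apply Rle_trans with (2 := H), Rabs_pos. Qed.

Section C11_calculus.
Variables (rho c : R) (D : params -> Prop).
Hypotheses (Hc : 0 < c).

Local Notation N := (C11_le rho c D).

Lemma C11_le_weaken F nu nu' : N F nu -> nu <= nu' -> N F nu'.
Proof.
  intros (L & m0 & m1 & m2 & H & Hn) Hle; exists L, m0, m1, m2; split; [exact H | lra].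
Qed.

Lemma C11_le_nonneg F nu : N F nu -> 0 <= nu.
Proof.
  intros (L & m0 & m1 & m2 & H & Hn).
  destruct (C11_nonneg _ _ _ _ _ _ _ H) as (H0 & H1 & H2); nra.
Qed.

Lemma C11_le_val F nu p : N F nu -> D p -> Rabs (F p) <= nu.
Proof.
  intros (L & m0 & m1 & m2 & H & Hn) Hp.
  destruct (C11_nonneg _ _ _ _ _ _ _ H) as (H0 & H1 & H2).
  apply Rle_trans with (1 := C11_val _ _ _ _ _ _ _ H p Hp); nra.
Qed.

Lemma C11_le_lip F nu p q r : N F nu -> D p -> D q ->
  params_norm_le rho (params_sub q p) r -> Rabs (F q - F p) <= nu / c * r.
Proof.
  intros (L & m0 & m1 & m2 & H & Hn) Hp Hq Hr.
  destruct (C11_nonneg _ _ _ _ _ _ _ H) as (H0 & H1 & H2).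
  apply Rle_trans with (1 := C11_lip _ _ _ _ _ _ _ H p q r Hp Hq Hr).
  apply Rmult_le_compat_r; [exact (params_norm_le_nonneg _ _ _ Hr) |].
  apply Rmult_le_reg_r with c; [exact Hc |].
  replace (nu / c * c) with nu by (field; lra); nra.
Qed.

Lemma C11_le_ext F G nu : (forall p, D p -> F p = G p) -> N F nu -> N G nu.
Proof.
  intros E (L & m0 & m1 & m2 & [H0 H1 H2 H3 H4 H5 H6 H7] & Hn).
  exists L, m0, m1, m2; split; [constructor | exact Hn]; trivial.
  - intros p Hp; rewrite <- E; auto.
  - intros p q r Hp Hq; rewrite <- 2!E; auto.
  - intros p q r Hp Hq; rewrite <- 2!E; auto.
Qed.

Lemma C11_le_linear (l : params -> R) m k :
  0 <= m -> 0 <= k ->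
  (forall v w, l (params_add v w) = l v + l w) ->
  (forall t v, l (params_scal t v) = t * l v) ->
  (forall v w, l (params_sub v w) = l v - l w) ->
  (forall v r, params_norm_le rho v r -> Rabs (l v) <= k * r) ->
  (forall p, D p -> Rabs (l p) <= m) ->
  N l (m + c * k).
Proof.
  intros Hm Hk Ha Hs Hd Hb Hv.
  exists (fun _ => l), m, k, 0; split; [constructor |]; trivial.
  - lra.
  - intros; apply Hb; trivial.
  - intros p q r Hp Hq Hr; rewrite <- Hd; auto.
  - intros p q r Hp Hq Hr; rewrite Hd, Rminus_diag, Rabs_R0; lra.
  - intros; rewrite Rminus_diag, Rabs_R0; lra.
  - lra.
Qed.

Lemma C11_le_const x : N (fun _ => x) (Rabs x).
Proof.
  exists (fun _ _ => 0), (Rabs x), 0, 0; split; [constructor |]; intros.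
  - generalize (Rabs_pos x); lra.
  - lra.
  - lra.
  - lra.
  - rewrite Rabs_R0; lra.
  - rewrite Rminus_diag, Rabs_R0; lra.
  - rewrite Rminus_diag, Rminus_0_r, Rabs_R0; lra.
  - rewrite Rminus_diag, Rabs_R0; lra.
  - lra.
Qed.

Lemma C11_le_plus F G nu om : N F nu -> N G om -> N (fun p => F p + G p) (nu + om).
Proof.
  intros (L & m0 & m1 & m2 & [(P0 & P1 & P2) A1 A2 A3 A4 A5 A6 A7] & Hn)
         (M & n0 & n1 & n2 & [(Q0 & Q1 & Q2) B1 B2 B3 B4 B5 B6 B7] & Ho).
  exists (fun p v => L p v + M p v), (m0 + n0), (m1 + n1), (m2 + n2).
  split; [constructor |].
  - lra.
  - intros p v w r s Hp Hv Hw.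
    rewrite (A1 p v w r s), (B1 p v w r s) by trivial; ring.
  - intros p t v r Hp Hv; rewrite (A2 p t v r), (B2 p t v r) by trivial; ring.
  - intros p Hp; apply Rle_trans with (1 := Rabs_triang _ _).
    generalize (A3 p Hp) (B3 p Hp); lra.
  - intros p v r Hp Hv; apply Rle_trans with (1 := Rabs_triang _ _).
    generalize (A4 p v r Hp Hv) (B4 p v r Hp Hv); lra.
  - intros p q r Hp Hq Hr.
    replace (F q + G q - (F p + G p)) with ((F q - F p) + (G q - G p)) by ring.
    apply Rle_trans with (1 := Rabs_triang _ _).
    generalize (A5 p q r Hp Hq Hr) (B5 p q r Hp Hq Hr); lra.
  - intros p q r Hp Hq Hr.
    replace (F q + G q - (F p + G p) - (L p (params_sub q p) + M p (params_sub q p)))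
      with ((F q - F p - L p (params_sub q p)) + (G q - G p - M p (params_sub q p)))
      by ring.
    apply Rle_trans with (1 := Rabs_triang _ _).
    generalize (A6 p q r Hp Hq Hr) (B6 p q r Hp Hq Hr); lra.
  - intros p q v r s Hp Hq Hr Hv.
    replace (L q v + M q v - (L p v + M p v)) with ((L q v - L p v) + (M q v - M p v))
      by ring.
    apply Rle_trans with (1 := Rabs_triang _ _).
    generalize (A7 p q v r s Hp Hq Hr Hv) (B7 p q v r s Hp Hq Hr Hv); lra.
  - lra.
Qed.

Lemma Rabs_mult_le a b x y : Rabs a <= x -> Rabs b <= y -> Rabs (a * b) <= x * y.
Proof.
  intros; rewrite Rabs_mult; apply Rmult_le_compat; trivial; apply Rabs_pos.
Qed.

(** The product of the jets (m0, m1, m2) and (n0, n1, n2) is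
    (m0 n0, m0 n1 + m1 n0, m0 n2 + m2 n0 + 2 m1 n1).  The factor 2 comes from the
    Lipschitz constant of F DG + G DF, where each factor contributes m1 n1. *)
Lemma C11_le_mult F G nu om : N F nu -> N G om -> N (fun p => F p * G p) (nu * om).
Proof.
  intros (L & m0 & m1 & m2 & [(P0 & P1 & P2) A1 A2 A3 A4 A5 A6 A7] & Hn)
         (M & n0 & n1 & n2 & [(Q0 & Q1 & Q2) B1 B2 B3 B4 B5 B6 B7] & Ho).
  exists (fun p v => F p * M p v + L p v * G p),
    (m0 * n0), (m0 * n1 + m1 * n0), (m0 * n2 + m2 * n0 + 2 * (m1 * n1)).
  assert (R1 : 0 <= m0 * n0) by now apply Rmult_le_pos.
  assert (R2 : 0 <= m0 * n1) by now apply Rmult_le_pos.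
  assert (R3 : 0 <= m1 * n0) by now apply Rmult_le_pos.
  assert (R4 : 0 <= m1 * n1) by now apply Rmult_le_pos.
  assert (R5 : 0 <= m0 * n2) by now apply Rmult_le_pos.
  assert (R6 : 0 <= m2 * n0) by now apply Rmult_le_pos.
  split; [constructor |].
  - lra.
  - intros p v w r s Hp Hv Hw.
    rewrite (A1 p v w r s), (B1 p v w r s) by trivial; ring.
  - intros p t v r Hp Hv; rewrite (A2 p t v r), (B2 p t v r) by trivial; ring.
  - intros p Hp; apply Rabs_mult_le; auto.
  - intros p v r Hp Hv; apply Rle_trans with (1 := Rabs_triang _ _).
    generalize (Rabs_mult_le _ _ _ _ (A3 p Hp) (B4 p v r Hp Hv))
      (Rabs_mult_le _ _ _ _ (A4 p v r Hp Hv) (B3 p Hp)); lra.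
  - intros p q r Hp Hq Hr.
    replace (F q * G q - F p * G p) with (F q * (G q - G p) + (F q - F p) * G p) by ring.
    apply Rle_trans with (1 := Rabs_triang _ _).
    generalize (Rabs_mult_le _ _ _ _ (A3 q Hq) (B5 p q r Hp Hq Hr))
      (Rabs_mult_le _ _ _ _ (A5 p q r Hp Hq Hr) (B3 p Hp)); lra.
  - intros p q r Hp Hq Hr.
    replace (F q * G q - F p * G p -
             (F p * M p (params_sub q p) + L p (params_sub q p) * G p))
      with (F p * (G q - G p - M p (params_sub q p)) +
            (F q - F p - L p (params_sub q p)) * G p + (F q - F p) * (G q - G p)) by ring.
    apply Rle_trans with (1 := Rabs_triang _ _).
    assert (T := Rabs_triang (F p * (G q - G p - M p (params_sub q p)))
                   ((F q - F p - L p (params_sub q p)) * G p)).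
    assert (0 <= r ^ 2) by apply pow2_ge_0.
    assert (0 <= m1 * n1 * r ^ 2) by now apply Rmult_le_pos.
    generalize (Rabs_mult_le _ _ _ _ (A3 p Hp) (B6 p q r Hp Hq Hr))
      (Rabs_mult_le _ _ _ _ (A6 p q r Hp Hq Hr) (B3 p Hp))
      (Rabs_mult_le _ _ _ _ (A5 p q r Hp Hq Hr) (B5 p q r Hp Hq Hr)); lra.
  - intros p q v r s Hp Hq Hr Hv.
    replace (F q * M q v + L q v * G q - (F p * M p v + L p v * G p))
      with ((F q * (M q v - M p v) + (F q - F p) * M p v) +
            (L q v * (G q - G p) + (L q v - L p v) * G p)) by ring.
    apply Rle_trans with (1 := Rabs_triang _ _).
    assert (T1 := Rabs_triang (F q * (M q v - M p v)) ((F q - F p) * M p v)).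
    assert (T2 := Rabs_triang (L q v * (G q - G p)) ((L q v - L p v) * G p)).
    generalize (Rabs_mult_le _ _ _ _ (A3 q Hq) (B7 p q v r s Hp Hq Hr Hv))
      (Rabs_mult_le _ _ _ _ (A5 p q r Hp Hq Hr) (B4 p v s Hp Hv))
      (Rabs_mult_le _ _ _ _ (A4 q v s Hq Hv) (B5 p q r Hp Hq Hr))
      (Rabs_mult_le _ _ _ _ (A7 p q v r s Hp Hq Hr Hv) (B3 p Hp)); lra.
  - apply Rle_trans with
      ((m0 + c * m1 + c ^ 2 / 2 * m2) * (n0 + c * n1 + c ^ 2 / 2 * n2)).
    + assert (0 <= m1 * n2) by now apply Rmult_le_pos.
      assert (0 <= m2 * n1) by now apply Rmult_le_pos.
      assert (0 <= m2 * n2) by now apply Rmult_le_pos.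
      assert (0 <= c ^ 3 / 2 * (m1 * n2 + m2 * n1) + c ^ 4 / 4 * (m2 * n2)).
      { assert (0 < c ^ 3) by now apply pow_lt.
        assert (0 < c ^ 4) by now apply pow_lt.
        apply Rplus_le_le_0_compat; apply Rmult_le_pos; lra. }
      lra.
    + assert (0 <= c ^ 2 / 2) by nra.
      apply Rmult_le_compat; trivial; repeat apply Rplus_le_le_0_compat; trivial;
        apply Rmult_le_pos; trivial; lra.
Qed.

Lemma C11_le_scal x F nu : N F nu -> N (fun p => x * F p) (Rabs x * nu).
Proof. intros H; apply (C11_le_mult (fun _ => x)); [apply C11_le_const | exact H]. Qed.

Lemma C11_le_sum (F : nat -> params -> R) nu n :
  (forall k, (k <= n)%nat -> N (F k) (nu k)) ->
  N (fun p => sum_f_R0 (fun k => F k p) n) (sum_f_R0 nu n).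
Proof.
  induction n as [| n IH]; intros H; simpl.
  - apply H; lia.
  - apply C11_le_plus; [apply IH; intros; apply H; lia | apply H; lia].
Qed.

Lemma C11_bound_inv F L m0 m1 m2 x :
  0 < x -> (forall p, D p -> x <= F p) -> C11_bound rho D F L m0 m1 m2 ->
  C11_bound rho D (fun p => / F p) (fun p v => - (/ F p * / F p * L p v))
    (/ x) (/ x * / x * m1) (/ x * / x * m2 + 2 * (/ x * (/ x * / x)) * (m1 * m1)).
Proof.
  intros Hx Hlow [(P0 & P1 & P2) A1 A2 A3 A4 A5 A6 A7].
  assert (Hi : 0 < / x) by now apply Rinv_0_lt_compat.
  set (y := / x) in *.
  assert (Hy : forall p, D p -> 0 < / F p <= y).
  { intros p Hp; specialize (Hlow p Hp); split.
    - apply Rinv_0_lt_compat; lra.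
    - apply Rinv_le_contravar; lra. }
  assert (Hya : forall p, D p -> Rabs (/ F p) <= y).
  { intros p Hp; rewrite Rabs_right; destruct (Hy p Hp); lra. }
  assert (HF0 : forall p, D p -> F p <> 0).
  { intros p Hp; specialize (Hlow p Hp); lra. }
  assert (R1 : 0 <= y * y) by (apply Rmult_le_pos; lra).
  assert (R2 : 0 <= y * y * m1) by now apply Rmult_le_pos.
  assert (R3 : 0 <= y * y * m2) by now apply Rmult_le_pos.
  assert (R4 : 0 <= y * (y * y)) by (apply Rmult_le_pos; lra).
  assert (R5 : 0 <= m1 * m1) by now apply Rmult_le_pos.
  assert (R6 : 0 <= y * (y * y) * (m1 * m1)) by now apply Rmult_le_pos.
  constructor.
  - lra.
  - intros p v w r s Hp Hv Hw; rewrite (A1 p v w r s) by trivial; ring.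
  - intros p t v r Hp Hv; rewrite (A2 p t v r) by trivial; ring.
  - exact Hya.
  - intros p v r Hp Hv; rewrite Rabs_Ropp.
    generalize (Rabs_mult_le _ _ _ _ (Rabs_mult_le _ _ _ _ (Hya p Hp) (Hya p Hp))
      (A4 p v r Hp Hv)); lra.
  - intros p q r Hp Hq Hr.
    replace (/ F q - / F p) with (- (/ F p * / F q * (F q - F p)))
      by (field; split; auto).
    rewrite Rabs_Ropp.
    generalize (Rabs_mult_le _ _ _ _ (Rabs_mult_le _ _ _ _ (Hya p Hp) (Hya q Hq))
      (A5 p q r Hp Hq Hr)); lra.
  - intros p q r Hp Hq Hr.
    replace (/ F q - / F p - - (/ F p * / F p * L p (params_sub q p)))
      with (- (/ F p * / F p * (F q - F p - L p (params_sub q p))) +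
            / F p * (/ F p * / F q) * ((F q - F p) * (F q - F p)))
      by (field; split; auto).
    apply Rle_trans with (1 := Rabs_triang _ _); rewrite Rabs_Ropp.
    assert (0 <= r ^ 2) by apply pow2_ge_0.
    assert (0 <= y * (y * y) * (m1 * m1) * r ^ 2) by now apply Rmult_le_pos.
    generalize (Rabs_mult_le _ _ _ _ (Rabs_mult_le _ _ _ _ (Hya p Hp) (Hya p Hp))
      (A6 p q r Hp Hq Hr))
      (Rabs_mult_le _ _ _ _ (Rabs_mult_le _ _ _ _ (Hya p Hp)
         (Rabs_mult_le _ _ _ _ (Hya p Hp) (Hya q Hq)))
      (Rabs_mult_le _ _ _ _ (A5 p q r Hp Hq Hr) (A5 p q r Hp Hq Hr))); lra.
  - intros p q v r s Hp Hq Hr Hv.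
    replace (- (/ F q * / F q * L q v) - - (/ F p * / F p * L p v))
      with (- (/ F q * / F q * (L q v - L p v)) +
            (/ F p * (/ F p * / F q) * ((F q - F p) * L p v) +
             / F q * (/ F p * / F q) * ((F q - F p) * L p v)))
      by (field; split; auto).
    apply Rle_trans with (1 := Rabs_triang _ _); rewrite Rabs_Ropp.
    assert (T := Rabs_triang (/ F p * (/ F p * / F q) * ((F q - F p) * L p v))
                   (/ F q * (/ F p * / F q) * ((F q - F p) * L p v))).
    assert (B1 := Rabs_mult_le _ _ _ _ (A5 p q r Hp Hq Hr) (A4 p v s Hp Hv)).
    assert (B2 := Rabs_mult_le _ _ _ _ (Hya p Hp) (Hya q Hq)).
    generalize
      (Rabs_mult_le _ _ _ _ (Rabs_mult_le _ _ _ _ (Hya q Hq) (Hya q Hq))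
        (A7 p q v r s Hp Hq Hr Hv))
      (Rabs_mult_le _ _ _ _ (Rabs_mult_le _ _ _ _ (Hya p Hp) B2) B1)
      (Rabs_mult_le _ _ _ _ (Rabs_mult_le _ _ _ _ (Hya q Hq) B2) B1); lra.
Qed.

Lemma C11_bound_comp_lin (g g1 : R -> R) K :
  0 < K ->
  (forall p q, D p -> D q ->
    Rabs (g (lin p)) <= K /\ Rabs (g1 (lin p)) <= K /\
    Rabs (g (lin q) - g (lin p)) <= K * Rabs (lin q - lin p) /\
    Rabs (g (lin q) - g (lin p) - (lin q - lin p) * g1 (lin p))
      <= K * (lin q - lin p) ^ 2 /\
    Rabs (g1 (lin q) - g1 (lin p)) <= K * Rabs (lin q - lin p)) ->
  C11_bound rho D (fun p => g (lin p)) (fun p v => lin v * g1 (lin p)) K K K.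
Proof.
  intros HK H; constructor; simpl.
  - lra.
  - intros; ring.
  - intros; ring.
  - intros p Hp; apply (H p p Hp Hp).
  - intros p v r Hp [Hv _]; rewrite (Rmult_comm K).
    apply Rabs_mult_le; [exact Hv | apply (H p p Hp Hp)].
  - intros p q r Hp Hq [Hr _]; simpl in Hr.
    destruct (H p q Hp Hq) as (_ & _ & E & _).
    apply Rle_trans with (1 := E), Rmult_le_compat_l; lra.
  - intros p q r Hp Hq [Hr _]; simpl in Hr.
    destruct (H p q Hp Hq) as (_ & _ & _ & E & _).
    apply Rle_trans with (1 := E), Rmult_le_compat_l; [lra |].
    rewrite <- (pow2_abs (lin q - lin p)); apply (pow_incr _ _ 2).
    split; [apply Rabs_pos | exact Hr].
  - intros p q v r s Hp Hq [Hr _] [Hv _]; simpl in Hr.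
    destruct (H p q Hp Hq) as (_ & _ & _ & _ & E).
    replace (lin v * g1 (lin q) - lin v * g1 (lin p))
      with (lin v * (g1 (lin q) - g1 (lin p))) by ring.
    replace (K * (r * s)) with (s * (K * r)) by ring.
    apply Rabs_mult_le; [exact Hv |].
    apply Rle_trans with (1 := E), Rmult_le_compat_l; lra.
Qed.

Lemma C11_le_of_bound F L m0 m1 m2 :
  C11_bound rho D F L m0 m1 m2 -> N F (m0 + c * m1 + c ^ 2 / 2 * m2).
Proof. intros H; exists L, m0, m1, m2; split; [exact H | lra]. Qed.

(** The three bounds of the n-th term are each at most a multiple of nu n, so
    values, derivatives and remainders can be summed termwise. *)
Lemma C11_le_series (F : nat -> params -> R) nu :
  (forall n, N (F n) (nu n)) -> ex_series nu ->
  N (fun p => Series (fun n => F n p)) (Series nu).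
Proof.
  intros H Hnu.
  destruct (functional_choice
    (fun n (d : (params -> params -> R) * (R * R * R)) =>
       C11_bound rho D (F n) (fst d) (fst (fst (snd d))) (snd (fst (snd d)))
         (snd (snd d)) /\
       fst (fst (snd d)) + c * snd (fst (snd d)) + c ^ 2 / 2 * snd (snd d) <= nu n))
    as [d Hd].
  { intros n; destruct (H n) as (L & m0 & m1 & m2 & HL).
    exists (L, (m0, m1, m2)); exact HL. }
  set (L n := fst (d n)) in *; set (m0 n := fst (fst (snd (d n)))) in *.
  set (m1 n := snd (fst (snd (d n)))) in *; set (m2 n := snd (snd (d n))) in *.
  assert (HB : forall n, C11_bound rho D (F n) (L n) (m0 n) (m1 n) (m2 n))
    by (intros n; apply Hd).
  assert (Hm : forall n, m0 n + c * m1 n + c ^ 2 / 2 * m2 n <= nu n)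
    by (intros n; apply Hd).
  clearbody L m0 m1 m2; clear Hd d.
  assert (Hpos := fun n => C11_nonneg _ _ _ _ _ _ _ (HB n)).
  assert (Hc2 : 0 < c ^ 2 / 2) by (apply Rdiv_lt_0_compat; [now apply pow_lt | lra]).
  assert (Hs : forall (m : nat -> R) k, 0 < k ->
            (forall n, 0 <= m n /\ k * m n <= nu n) -> ex_series m).
  { intros m k Hk Hmk.
    apply (ex_series_le (V := R_CompleteNormedModule) _ (fun n => / k * nu n)).
    - intros n; destruct (Hmk n) as [Hm0 Hm1]; change (Rabs (m n) <= / k * nu n).
      rewrite Rabs_right by lra; apply Rmult_le_reg_l with k; [exact Hk |].
      rewrite <- Rmult_assoc, Rinv_r; lra.
    - apply (ex_series_scal_l (/ k) nu Hnu). }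
  assert (S0 : ex_series m0).
  { apply (Hs m0 1); [lra |]; intros n; destruct (Hpos n) as (U & V & W).
    specialize (Hm n); nra. }
  assert (S1 : ex_series m1).
  { apply (Hs m1 c); [lra |]; intros n; destruct (Hpos n) as (U & V & W).
    specialize (Hm n); nra. }
  assert (S2 : ex_series m2).
  { apply (Hs m2 (c ^ 2 / 2)); [lra |]; intros n; destruct (Hpos n) as (U & V & W).
    specialize (Hm n); nra. }
  assert (HS : forall (a m : nat -> R) k, ex_series m ->
            (forall n, Rabs (a n) <= m n * k) ->
            ex_series a /\ Rabs (Series a) <= Series m * k).
  { intros a m k Sm Ha; rewrite <- Series_scal_r; apply Series_abs_le; trivial.
    apply (ex_series_ext (fun n => k * m n)); [intros; apply Rmult_comm |].
    apply (ex_series_scal_l k m Sm). }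
  assert (EF : forall p, D p -> ex_series (fun n => F n p)).
  { intros p Hp; apply (Series_abs_le _ m0); trivial.
    intros n; apply (C11_val _ _ _ _ _ _ _ (HB n) p Hp). }
  assert (EL : forall p v r, D p -> params_norm_le rho v r ->
            ex_series (fun n => L n p v)).
  { intros p v r Hp Hv; apply (HS _ m1 r S1).
    intros n; apply (C11_der _ _ _ _ _ _ _ (HB n) p v r Hp Hv). }
  exists (fun p v => Series (fun n => L n p v)), (Series m0), (Series m1), (Series m2).
  split; [constructor |].
  - repeat split; apply Series_nonneg; trivial; intros n; apply (Hpos n).
  - intros p v w r s Hp Hv Hw.
    rewrite <- Series_plus by (eapply EL; eassumption).
    apply Series_ext; intros n.
    apply (C11_add _ _ _ _ _ _ _ (HB n) p v w r s Hp Hv Hw).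
  - intros p t v r Hp Hv; rewrite <- Series_scal_l; apply Series_ext; intros n.
    apply (C11_scal _ _ _ _ _ _ _ (HB n) p t v r Hp Hv).
  - intros p Hp; apply (Series_abs_le _ m0); trivial.
    intros n; apply (C11_val _ _ _ _ _ _ _ (HB n) p Hp).
  - intros p v r Hp Hv; apply HS; trivial.
    intros n; apply (C11_der _ _ _ _ _ _ _ (HB n) p v r Hp Hv).
  - intros p q r Hp Hq Hr; rewrite <- Series_minus by auto.
    apply HS; trivial; intros n; apply (C11_lip _ _ _ _ _ _ _ (HB n) p q r Hp Hq Hr).
  - intros p q r Hp Hq Hr; rewrite <- Series_minus by auto.
    rewrite <- Series_minus.
    + apply HS; trivial; intros n; apply (C11_rem _ _ _ _ _ _ _ (HB n) p q r Hp Hq Hr).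
    + apply (ex_series_minus (fun n => F n q) (fun n => F n p)); auto.
    + apply (EL p _ r Hp Hr).
  - intros p q v r s Hp Hq Hr Hv.
    rewrite <- Series_minus by (eapply EL; eassumption).
    apply HS; trivial; intros n.
    apply (C11_der_lip _ _ _ _ _ _ _ (HB n) p q v r s Hp Hq Hr Hv).
  - rewrite <- 2!Series_scal_l.
    assert (T1 : ex_series (fun n => c * m1 n)) by apply (ex_series_scal_l c m1 S1).
    assert (T2 : ex_series (fun n => c ^ 2 / 2 * m2 n))
      by apply (ex_series_scal_l (c ^ 2 / 2) m2 S2).
    assert (T3 : ex_series (fun n => m0 n + c * m1 n))
      by apply (ex_series_plus m0 (fun n => c * m1 n) S0 T1).
    rewrite <- Series_plus, <- Series_plus by trivial.
    apply Series_le; trivial; intros n; destruct (Hpos n) as (U & V & W).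
    split; [| apply Hm].
    repeat apply Rplus_le_le_0_compat; trivial; apply Rmult_le_pos; trivial; lra.
Qed.

End C11_calculus.

Lemma C11_bound_C1_on rho D F L m0 m1 m2 :
  C11_bound rho D F L m0 m1 m2 -> C1_on rho D F.
Proof.
  intros [(P0 & P1 & P2) A1 A2 A3 A4 A5 A6 A7]; exists L.
  assert (P3 : 0 < m2 + 1) by lra.
  split; [| split].
  - intros p Hp; split; [| split].
    + intros v w r s Hv Hw; apply (A1 p v w r s); trivial.
    + intros t v r Hv; apply (A2 p t v r); trivial.
    + exists m1; intros v r Hv; now apply A4.
  - intros p Hp eps Heps; exists (eps / (m2 + 1)).
    split; [now apply Rdiv_lt_0_compat |].
    intros q r Hq Hr Hn; apply Rle_trans with (1 := A6 p q r Hp Hq Hn).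
    assert (Hr0 := params_norm_le_nonneg _ _ _ Hn).
    assert (E : (m2 + 1) * (eps / (m2 + 1)) = eps) by (field; lra).
    assert (m2 * r <= eps).
    { apply Rle_trans with ((m2 + 1) * r); [nra |].
      rewrite <- E; apply Rmult_le_compat_l; lra. }
    replace (m2 * r ^ 2) with (m2 * r * r) by ring.
    now apply Rmult_le_compat_r.
  - intros p Hp eps Heps; exists (eps / (m2 + 1)).
    assert (Hd : 0 < eps / (m2 + 1)) by now apply Rdiv_lt_0_compat.
    split; [exact Hd |].
    intros q Hq Hn v r Hv.
    apply Rle_trans with (1 := A7 p q v _ r Hp Hq Hn Hv).
    assert (Hr0 := params_norm_le_nonneg _ _ _ Hv).
    assert (E : (m2 + 1) * (eps / (m2 + 1)) = eps) by (field; lra).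
    rewrite <- Rmult_assoc; apply Rmult_le_compat_r; nra.
Qed.

(** * Shifted factorials and majorant estimates *)

(** [poch a n] is Gamma (n + 2 + a) / Gamma (2 + a), a polynomial in a. *)
Fixpoint poch (a : R) (n : nat) : R :=
  match n with
  | O => 1
  | S m => (2 + INR m + a) * poch a m
  end.

(** The same weights attached to the exponent k = n + 2, with value 0 where the
    formal solution has no terms. *)
Definition poch2 (a : R) (k : nat) : R :=
  match k with S (S n) => poch a n | _ => 0 end.

Lemma poch_pos a n : -2 < a -> 0 < poch a n.
Proof.
  intros Ha; induction n as [| n IH]; simpl; [lra |].
  generalize (pos_INR n); intros; apply Rmult_lt_0_compat; lra.
Qed.

Lemma poch2_nonneg a k : -2 < a -> 0 <= poch2 a k.
Proof.
  intros Ha; destruct k as [| [| n]]; simpl; try lra.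
  left; now apply poch_pos.
Qed.

Lemma Gamma_poch a n : -2 < a ->
  Gamma (INR (S (S n)) + a) = poch a n * Gamma (2 + a).
Proof.
  intros Ha; induction n as [| n IH].
  - simpl; rewrite Rmult_1_l; f_equal; ring.
  - replace (INR (S (S (S n))) + a) with (1 + (INR (S (S n)) + a))
      by (rewrite (S_INR (S (S n))); ring).
    assert (H := pos_INR n).
    rewrite Gamma_succ by (rewrite 2!S_INR; lra).
    rewrite IH; cbn [poch]; rewrite 2!S_INR; ring.
Qed.

(** Raising the parameter by 1 costs one power of n.  This is how the different
    weights for k + a and 1 / (k + a) are compared. *)
Lemma poch_shift a n : poch a (S n) = (2 + a) * poch (a + 1) n.
Proof.
  induction n as [| n IH]; [simpl; ring |].
  change (poch a (S (S n))) with ((2 + INR (S n) + a) * poch a (S n)).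
  rewrite IH, S_INR; simpl; ring.
Qed.

Lemma poch_mult_le b i j : -2 < b -> poch b i * poch b j <= poch b (i + j).
Proof.
  intros Hb; induction i as [| i IH]; simpl; [lra |].
  assert (P1 := pos_INR i); assert (P2 := pos_INR j).
  assert (P3 := poch_pos b (i + j) Hb).
  rewrite plus_INR, Rmult_assoc.
  apply Rle_trans with ((2 + INR i + b) * poch b (i + j)).
  - apply Rmult_le_compat_l; lra.
  - apply Rmult_le_compat_r; lra.
Qed.

Lemma poch_mult_inner_le b i j : -2 < b ->
  poch b (S i) * poch b (S j) <= (2 + b) * poch b (S (i + j)).
Proof.
  intros Hb; induction i as [| i IH].
  - simpl; right; ring.
  - assert (P1 := pos_INR i); assert (P2 := pos_INR j).
    assert (P3 := poch_pos b (S (i + j)) Hb).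
    change (poch b (S (S i))) with ((2 + INR (S i) + b) * poch b (S i)).
    change (poch b (S (S i + j))) with ((2 + INR (S (i + j)) + b) * poch b (S (i + j))).
    rewrite 2!S_INR, plus_INR, Rmult_assoc.
    apply Rle_trans with ((2 + (INR i + 1) + b) * ((2 + b) * poch b (S (i + j)))).
    + apply Rmult_le_compat_l; lra.
    + rewrite <- 2!Rmult_assoc; apply Rmult_le_compat_r; [lra | nra].
Qed.

Lemma sum_f_R0_const_le (f : nat -> R) x n :
  (forall i, (i <= n)%nat -> f i <= x) -> sum_f_R0 f n <= INR (S n) * x.
Proof.
  intros H; apply Rle_trans with (sum_f_R0 (fun _ => x) n).
  - now apply sum_Rle.
  - rewrite sum_cte; lra.
Qed.

(** The two end terms are poch b n; by [poch_mult_inner_le] each of the n - 1 others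
    is at most (2 + b) poch b (n - 1), and poch b n / poch b (n - 1) exceeds n - 1. *)
Lemma poch_conv_le b n : -2 < b ->
  sum_f_R0 (fun i => poch b i * poch b (n - i)) n <= (4 + b) * poch b n.
Proof.
  intros Hb; destruct n as [| [| n]].
  - simpl; lra.
  - simpl; nra.
  - rewrite tech5, decomp_sum by lia.
    simpl pred; rewrite Nat.sub_0_r, Nat.sub_diag.
    assert (H : sum_f_R0 (fun i => poch b (S i) * poch b (S (S n) - S i)) n
                <= INR (S n) * ((2 + b) * poch b (S n))).
    { apply sum_f_R0_const_le; intros i Hi.
      replace (S (S n) - S i)%nat with (S (n - i)) by lia.
      replace n with (i + (n - i))%nat at 2 by lia.
      now apply poch_mult_inner_le. }
    assert (P := poch_pos b (S n) Hb); assert (Pn := pos_INR n).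
    change (poch b 0) with 1.
    set (s := sum_f_R0 _ n) in *; clearbody s.
    change (poch b (S (S n))) with ((2 + INR (S n) + b) * poch b (S n)) in *.
    rewrite S_INR in *.
    assert (0 <= (2 + b) * (2 + b) * poch b (S n))
      by (apply Rmult_le_pos; [apply Rmult_le_pos |]; lra).
    nra.
Qed.

Lemma sum_f_R0_trunc (f : nat -> R) m n : (m <= n)%nat ->
  (forall i, (m < i <= n)%nat -> f i = 0) -> sum_f_R0 f n = sum_f_R0 f m.
Proof.
  intros Hmn; induction Hmn as [| n Hmn IH]; intros H; [reflexivity |].
  rewrite tech5, IH, H by (intros; lia || (apply H; lia)); ring.
Qed.

(** The exponents start at 2, so the end terms of the convolution pair 2 with
    n - 2. *)
Lemma poch2_conv_le b n : -2 < b ->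
  sum_f_R0 (fun j => poch2 b j * poch2 b (n - j)) n <= (4 + b) * poch2 b (n - 2).
Proof.
  intros Hb; destruct n as [| [| [| [| m]]]]; try (simpl; lra).
  rewrite (sum_f_R0_trunc _ (S (S m))).
  2: lia.
  2:{ intros i Hi.
      destruct (S (S (S (S m))) - i)%nat as [| [| q]] eqn:E; simpl; try ring; lia. }
  rewrite decomp_sum, decomp_sum by lia; simpl pred.
  replace (poch2 b 0 * poch2 b (S (S (S (S m))) - 0)) with 0 by (simpl; ring).
  replace (poch2 b 1 * poch2 b (S (S (S (S m))) - 1)) with 0 by (simpl; ring).
  rewrite 2!Rplus_0_l.
  apply Rle_trans with (2 := poch_conv_le b m Hb); right.
  apply sum_eq; intros i Hi.
  replace (S (S (S (S m))) - S (S i))%nat with (S (S (m - i))) by lia.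
  reflexivity.
Qed.

Lemma PS_pow_1 u n : PS_pow u 1 n = u n.
Proof.
  unfold PS_pow, PS_mult; destruct n as [| n]; [simpl; ring |].
  rewrite tech5, Nat.sub_diag.
  rewrite (sum_eq _ (fun _ => 0) n), sum_cte; [ring |].
  intros i Hi; destruct (S n - i)%nat eqn:E; [lia | ring].
Qed.

(** Each further factor of a power costs one application of [poch2_conv_le], that
    is, two orders. *)
Lemma PS_pow_poch2_le b M l n : -2 < b -> 0 <= M ->
  0 <= PS_pow (fun k => M * poch2 b k) (S l) n
    <= M ^ S l * (4 + b) ^ l * poch2 b (n - 2 * l).
Proof.
  intros Hb HM; revert n; induction l as [| l IH]; intros n.
  - rewrite PS_pow_1.
    replace (n - 2 * 0)%nat with n by lia.
    assert (H := poch2_nonneg b n Hb); simpl; split; nra.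
  - change (PS_pow (fun k => M * poch2 b k) (S (S l)) n)
      with (PS_mult (fun k => M * poch2 b k) (PS_pow (fun k => M * poch2 b k) (S l)) n).
    unfold PS_mult; split.
    + apply cond_pos_sum; intros j; apply Rmult_le_pos; [| apply IH].
      apply Rmult_le_pos; [exact HM | now apply poch2_nonneg].
    + apply Rle_trans with (sum_f_R0 (fun j => (poch2 b j * poch2 b (n - 2 * l - j)) *
        (M ^ S (S l) * (4 + b) ^ l)) n).
      * apply sum_Rle; intros j Hj.
        replace (n - 2 * l - j)%nat with (n - j - 2 * l)%nat by lia.
        apply Rle_trans with
          (M * poch2 b j * (M ^ S l * (4 + b) ^ l * poch2 b (n - j - 2 * l))).
        -- apply Rmult_le_compat_l; [| apply IH].
           apply Rmult_le_pos; [exact HM | now apply poch2_nonneg].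
        -- right; change (M ^ S (S l)) with (M * M ^ S l); ring.
      * rewrite <- scal_sum.
        assert (E : sum_f_R0 (fun j => poch2 b j * poch2 b (n - 2 * l - j)) n =
                    sum_f_R0 (fun j => poch2 b j * poch2 b (n - 2 * l - j)) (n - 2 * l)).
        { apply sum_f_R0_trunc; [lia |]; intros j Hj.
          replace (n - 2 * l - j)%nat with 0%nat by lia; simpl; ring. }
        rewrite E.
        replace (n - 2 * S l)%nat with (n - 2 * l - 2)%nat by lia.
        replace (M ^ S (S l) * (4 + b) ^ S l * poch2 b (n - 2 * l - 2))
          with (M ^ S (S l) * (4 + b) ^ l * ((4 + b) * poch2 b (n - 2 * l - 2)))
          by (change ((4 + b) ^ S l) with ((4 + b) * (4 + b) ^ l); ring).
        apply Rmult_le_compat_l; [| now apply poch2_conv_le].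
        apply Rmult_le_pos; apply pow_le; lra.
Qed.

Lemma fact_le_poch b n : -1 <= b -> INR (fact n) <= poch b n.
Proof.
  intros Hb; induction n as [| n IH]; [simpl; lra |].
  change (poch b (S n)) with ((2 + INR n + b) * poch b n).
  rewrite fact_simpl, mult_INR, S_INR.
  assert (H := pos_INR n); assert (P := INR_fact_lt_0 n).
  apply Rmult_le_compat; lra.
Qed.

Lemma pow_le_exp_poch b E n : -1 <= b -> 0 <= E -> E ^ n <= exp E * poch b n.
Proof.
  intros Hb HE.
  assert (P := INR_fact_lt_0 n).
  assert (H := pow_div_fact_le_exp E n HE).
  apply Rle_trans with (exp E * INR (fact n)).
  - replace (E ^ n) with (E ^ n / INR (fact n) * INR (fact n)) by (field; lra).
    apply Rmult_le_compat_r; lra.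
  - apply Rmult_le_compat_l; [left; apply exp_pos | now apply fact_le_poch].
Qed.

(** Summable weights for the exponents of x and y in h.  They vanish where h has no
    monomials. *)
Definition geo1 (i : nat) : R := match i with S i' => (/ 2) ^ i' | O => 0 end.
Definition geo2 (l : nat) : R := match l with S (S l') => (/ 2) ^ l' | _ => 0 end.

Lemma geo_half_le n : sum_f_R0 (fun i => (/ 2) ^ i) n <= 2.
Proof.
  rewrite tech3 by lra.
  assert (0 < (/ 2) ^ S n) by (apply pow_lt; lra).
  apply Rle_trans with ((1 - (/ 2) ^ S n) * 2); [right; field | lra].
Qed.

Lemma geo1_sum_le n : sum_f_R0 geo1 n <= 2.
Proof.
  destruct n as [| n]; [simpl; lra |].
  rewrite decomp_sum by lia; simpl; rewrite Rplus_0_l; apply geo_half_le.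
Qed.

Lemma geo2_sum_le n : sum_f_R0 geo2 n <= 2.
Proof.
  destruct n as [| n]; [simpl; lra |].
  rewrite decomp_sum by lia; simpl; rewrite Rplus_0_l; apply geo1_sum_le.
Qed.

(** The factor of the monomial x y^2 times two constants that convert geometric
    growth in the two exponents into factorial growth ([pow_le_exp_poch]). *)
Definition nonlinear_const (rho b M : R) : R :=
  / rho ^ 3 * M ^ 2 * (4 + b) * exp (2 / rho) * exp (2 * M * (4 + b) / rho).

Lemma nonlinear_const_nonneg rho b M :
  0 < rho -> -1 <= b -> 0 <= M -> 0 <= nonlinear_const rho b M.
Proof.
  intros Hrho Hb HM; unfold nonlinear_const.
  assert (0 < / rho ^ 3) by now apply Rinv_0_lt_compat, pow_lt.
  assert (0 <= M ^ 2) by apply pow2_ge_0.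
  assert (P1 := exp_pos (2 / rho)); assert (P2 := exp_pos (2 * M * (4 + b) / rho)).
  repeat (apply Rmult_le_pos; [| lra]); lra.
Qed.

(** The lowest monomial x y^2 has order k - 3.  A monomial with i more factors x and l
    more factors y has order lower by i + 2 l, and by [poch_mult_le] the weight drops
    by the factor poch b i * poch b l * poch b l, which beats the geometric growth of
    the coefficients of h and of the powers of M. *)
Lemma nonlinear_term_le rho b M k i l :
  0 < rho -> -1 <= b -> 0 <= M ->
  / rho ^ (S i + S (S l)) *
    PS_pow (fun j => M * poch2 b j) (S (S l)) (k - S i)
  <= nonlinear_const rho b M * (geo1 (S i) * geo2 (S (S l)) * poch2 b (k - 3)).
Proof.
  intros Hrho Hb HM.
  assert (Hb2 : -2 < b) by lra.
  assert (Hri : 0 < / rho) by now apply Rinv_0_lt_compat.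
  apply Rle_trans with (/ rho ^ (S i + S (S l)) *
    (M ^ S (S l) * (4 + b) ^ S l * poch2 b (k - S i - 2 * S l))).
  { apply Rmult_le_compat_l; [left; apply Rinv_0_lt_compat, pow_lt, Hrho |].
    now apply PS_pow_poch2_le. }
  assert (HK : 0 <= / rho ^ 3 * M ^ 2 * (4 + b)).
  { repeat apply Rmult_le_pos; try (simpl; nra).
    left; now apply Rinv_0_lt_compat, pow_lt. }
  assert (Hg1 : 0 < (/ 2) ^ i) by (apply pow_lt; lra).
  assert (Hg2 : 0 < (/ 2) ^ l) by (apply pow_lt; lra).
  assert (PE1 := exp_pos (2 / rho)); assert (PE2 := exp_pos (2 * M * (4 + b) / rho)).
  destruct (k - S i - 2 * S l)%nat as [| [| n]] eqn:E.
  1, 2: simpl poch2; rewrite !Rmult_0_r; unfold nonlinear_const, geo1, geo2;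
    repeat (apply Rmult_le_pos || apply poch2_nonneg); trivial; try lra;
    try (left; assumption); try (left; now apply Rinv_0_lt_compat, pow_lt);
    now apply pow_le.
  replace (k - 3)%nat with (S (S (n + (i + (l + l))))) by lia.
  unfold geo1, geo2, poch2.
  assert (P0 := poch_pos b n Hb2); assert (P1 := poch_pos b i Hb2).
  assert (P2 := poch_pos b l Hb2).
  assert (P3 : 1 <= poch b l).
  { apply Rle_trans with (2 := fact_le_poch b l Hb).
    apply (le_INR 1), lt_O_fact. }
  assert (X : poch b n * (poch b i * poch b l) <= poch b (n + (i + (l + l)))).
  { apply Rle_trans with (2 := poch_mult_le b n _ Hb2).
    apply Rmult_le_compat_l; [lra |].
    apply Rle_trans with (2 := poch_mult_le b i _ Hb2).
    apply Rmult_le_compat_l; [lra |].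
    apply Rle_trans with (2 := poch_mult_le b l l Hb2); nra. }
  assert (Y1 : (/ rho) ^ i <= (/ 2) ^ i * (exp (2 / rho) * poch b i)).
  { replace (/ rho) with (/ 2 * (2 / rho)) by (field; lra).
    rewrite Rpow_mult_distr; apply Rmult_le_compat_l; [lra |].
    apply pow_le_exp_poch; [lra |].
    apply Rmult_le_pos; lra. }
  assert (Y2 : (M * (4 + b) / rho) ^ l <=
               (/ 2) ^ l * (exp (2 * M * (4 + b) / rho) * poch b l)).
  { replace (M * (4 + b) / rho) with (/ 2 * (2 * M * (4 + b) / rho)) by (field; lra).
    rewrite Rpow_mult_distr; apply Rmult_le_compat_l; [lra |].
    apply pow_le_exp_poch; [lra |].
    repeat apply Rmult_le_pos; lra. }
  replace (/ rho ^ (S i + S (S l)) * (M ^ S (S l) * (4 + b) ^ S l * poch b n))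
    with (/ rho ^ 3 * M ^ 2 * (4 + b) *
          (((/ rho) ^ i * (M * (4 + b) / rho) ^ l) * poch b n)).
  2:{ replace (S i + S (S l))%nat with (3 + (i + l))%nat by lia.
      unfold Rdiv; rewrite (Rpow_mult_distr (M * (4 + b))), (Rpow_mult_distr M).
      rewrite 2!pow_inv, 2!pow_add.
      change (M ^ S (S l)) with (M * (M * M ^ l)).
      change ((4 + b) ^ S l) with ((4 + b) * (4 + b) ^ l).
      field; repeat split; try lra; apply pow_nonzero; lra. }
  assert (P4 : 0 <= poch b (n + (i + (l + l)))) by (left; now apply poch_pos).
  apply Rle_trans with (/ rho ^ 3 * M ^ 2 * (4 + b) *
    (((/ 2) ^ i * (exp (2 / rho) * poch b i)) *
     ((/ 2) ^ l * (exp (2 * M * (4 + b) / rho) * poch b l)) * poch b n)).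
  - apply Rmult_le_compat_l; [exact HK |].
    apply Rmult_le_compat_r; [lra |].
    apply Rmult_le_compat; trivial.
    + apply pow_le; lra.
    + apply pow_le; repeat apply Rmult_le_pos; lra.
  - unfold nonlinear_const.
    set (E1 := exp (2 / rho)) in *; set (E2 := exp (2 * M * (4 + b) / rho)) in *.
    set (w := / rho ^ 3 * M ^ 2 * (4 + b)) in *.
    replace (w * ((/ 2) ^ i * (E1 * poch b i) * ((/ 2) ^ l * (E2 * poch b l)) * poch b n))
      with (w * E1 * E2 * ((/ 2) ^ i * (/ 2) ^ l) * (poch b n * (poch b i * poch b l)))
      by ring.
    rewrite <- (Rmult_assoc (w * E1 * E2) ((/ 2) ^ i * (/ 2) ^ l)).
    apply Rmult_le_compat_l; [| exact X].
    clearbody w E1 E2; repeat apply Rmult_le_pos; lra.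
Qed.

Lemma ex_series_inv_pow_fact x : ex_series (fun n => x ^ n / INR (fact n)).
Proof.
  exists (exp x).
  apply (is_series_ext (fun n => scal (pow_n x n) (/ INR (fact n)))).
  - intros n; rewrite pow_n_pow; reflexivity.
  - apply is_exp_Reals.
Qed.

Lemma ex_series_inv_quadratic : ex_series (fun n => / (INR (S n) * INR (S (S n)))).
Proof.
  exists 1; change (is_lim_seq (sum_n (fun n => / (INR (S n) * INR (S (S n))))) 1).
  apply (is_lim_seq_ext (fun n => 1 - / INR (S (S n)))).
  - intros n; induction n as [| n IH].
    + rewrite sum_O; simpl; field.
    + rewrite sum_Sn, <- IH; unfold plus; cbn -[INR].
      assert (H := pos_INR n).
      rewrite !S_INR; field; repeat split; lra.
  - replace (Finite 1) with (Finite (1 - 0)) by (f_equal; ring).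
    apply is_lim_seq_minus'; [apply is_lim_seq_const |].
    apply (is_lim_seq_inv (fun n => INR (S (S n))) p_infty).
    + apply (is_lim_seq_ext (fun n => INR (n + 2))); [intros; f_equal; lia |].
      apply (is_lim_seq_incr_n INR 2 p_infty), is_lim_seq_INR.
    + discriminate.
Qed.

(** [forcing_term] and [nonlinear_weight] majorize the contributions of f and of h
    to the n-th term of the series for the limit. *)
Definition forcing_term (rho K A : R) (n : nat) : R := K / rho ^ (n + 2) / poch A n.

Definition nonlinear_weight (A : R) (n : nat) : R := poch2 (A + 1) (n - 1) / poch A n.

Lemma forcing_term_pos rho K A n : 0 < rho -> 0 < K -> -2 < A ->
  0 < forcing_term rho K A n.
Proof.
  intros Hrho HK HA; unfold forcing_term; repeat apply Rmult_lt_0_compat; trivial;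
    apply Rinv_0_lt_compat; [now apply pow_lt | now apply poch_pos].
Qed.

Lemma nonlinear_weight_nonneg A n : -2 < A -> 0 <= nonlinear_weight A n.
Proof.
  intros HA; apply Rmult_le_pos; [apply poch2_nonneg; lra |].
  left; now apply Rinv_0_lt_compat, poch_pos.
Qed.

Lemma ex_series_forcing rho K A : 0 < rho -> -2 < A -> ex_series (forcing_term rho K A).
Proof.
  intros Hrho HA; apply ex_series_incr_1.
  apply (ex_series_le (V := R_CompleteNormedModule) _
    (fun n => Rabs K / rho ^ 3 / (2 + A) * ((/ rho) ^ n / INR (fact n)))).
  - intros n; change (Rabs (K / rho ^ (S n + 2) / poch A (S n)) <=
      Rabs K / rho ^ 3 / (2 + A) * ((/ rho) ^ n / INR (fact n))).
    assert (P1 := fact_le_poch (A + 1) n ltac:(lra)).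
    assert (P2 := INR_fact_lt_0 n).
    assert (P3 := pow_lt rho n Hrho); assert (P4 := pow_lt rho 3 Hrho).
    rewrite poch_shift; unfold Rdiv; rewrite 2!Rabs_mult.
    replace (S n + 2)%nat with (3 + n)%nat by lia.
    rewrite (Rabs_right (/ rho ^ _)) by (left; apply Rinv_0_lt_compat, pow_lt, Hrho).
    rewrite (Rabs_right (/ (_ * _)))
      by (left; apply Rinv_0_lt_compat, Rmult_lt_0_compat; lra).
    rewrite pow_add, 2!Rinv_mult, pow_inv.
    replace (Rabs K * / rho ^ 3 * / (2 + A) * (/ rho ^ n * / INR (fact n)))
      with (Rabs K * (/ rho ^ 3 * / rho ^ n) * (/ (2 + A) * / INR (fact n))) by ring.
    assert (Q1 : 0 < / rho ^ n) by now apply Rinv_0_lt_compat.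
    assert (Q2 : 0 < / rho ^ 3) by now apply Rinv_0_lt_compat.
    assert (Q3 : 0 < / (2 + A)) by (apply Rinv_0_lt_compat; lra).
    apply Rmult_le_compat_l.
    + apply Rmult_le_pos; [apply Rabs_pos | nra].
    + apply Rmult_le_compat_l; [lra |]; apply Rinv_le_contravar; lra.
  - apply (ex_series_scal_l (Rabs K / rho ^ 3 / (2 + A))
      (fun n => (/ rho) ^ n / INR (fact n))), ex_series_inv_pow_fact.
Qed.

(** By [poch_shift] the weight with parameter A + 1 and exponent k - 3 equals, up to a
    constant, the one with parameter A and exponent k - 2; the quotient by the weight
    of exponent k is then of order k^(-2). *)
Lemma ex_series_nonlinear A : -2 < A ->
  ex_series (nonlinear_weight A).
Proof.
  intros HA; apply (ex_series_incr_n _ 3).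
  apply (ex_series_le (V := R_CompleteNormedModule) _
    (fun n => / (2 + A) * / (INR (S n) * INR (S (S n))))).
  - intros n.
    change (Rabs (poch2 (A + 1) (3 + n - 1) / poch A (3 + n)) <=
            / (2 + A) * / (INR (S n) * INR (S (S n)))).
    replace (3 + n - 1)%nat with (S (S n)) by lia.
    assert (P := poch_pos (A + 1) n ltac:(lra)); assert (Pn := pos_INR n).
    change (poch A (3 + n)) with
      ((2 + INR (S (S n)) + A) * ((2 + INR (S n) + A) * poch A (S n))).
    rewrite poch_shift; change (poch2 (A + 1) (S (S n))) with (poch (A + 1) n).
    rewrite 2!S_INR.
    replace (poch (A + 1) n / ((2 + (INR n + 1 + 1) + A) * ((2 + (INR n + 1) + A) *
               ((2 + A) * poch (A + 1) n))))
      with (/ (2 + A) * / ((2 + (INR n + 1) + A) * (2 + (INR n + 1 + 1) + A)))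
      by (field; repeat split; lra).
    assert (Q3 : 0 < / (2 + A)) by (apply Rinv_0_lt_compat; lra).
    rewrite Rabs_right.
    + apply Rmult_le_compat_l; [lra |]; apply Rinv_le_contravar.
      * apply Rmult_lt_0_compat; lra.
      * apply Rmult_le_compat; lra.
    + left; apply Rmult_lt_0_compat; [lra |].
      apply Rinv_0_lt_compat, Rmult_lt_0_compat; lra.
  - apply (ex_series_scal_l (/ (2 + A)) (fun n => / (INR (S n) * INR (S (S n))))),
      ex_series_inv_quadratic.
Qed.

(** * The formal solution and its growth *)

Definition nonlin (p : params) (u : nat -> R) (k : nat) : R :=
  sum_f_R0 (fun i => sum_f_R0 (fun l => hc p i l * PS_pow u l (k - i)%nat) k) k.

(** The formal equation solved for its k-th coefficient. *)
Definition rec_step (p : params) (u : nat -> R) (k : nat) : R :=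
  match k with
  | S (S n) => - ((INR (S n) + lin p) * u (S n)) + g_coef p u k
  | _ => 0
  end.

(** The right hand side of the recursion depends on all earlier coefficients, so the
    solution is built by iterating [rec_step] from 0: the n-th iterate is correct
    below exponent n. *)
Fixpoint approx_sol (p : params) (n : nat) : nat -> R :=
  match n with
  | O => fun _ => 0
  | S n' => rec_step p (approx_sol p n')
  end.

Definition fsol (p : params) (k : nat) : R := approx_sol p (S k) k.

Lemma PS_pow_causal u v l n :
  (forall j, (j <= n)%nat -> u j = v j) -> PS_pow u l n = PS_pow v l n.
Proof.
  revert n; induction l as [| l IH]; intros n H; [reflexivity |].
  apply sum_eq; intros j Hj.
  rewrite H, IH by (intros; lia || (apply H; lia)); reflexivity.
Qed.

(** Each monomial of h contains x, so the coefficient of x^k in h(x, u(x)) only sees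
    u_j with j < k. *)
Lemma nonlin_causal p u v k :
  (forall l, hc p 0 l = 0) -> (forall j, (j < k)%nat -> u j = v j) ->
  nonlin p u k = nonlin p v k.
Proof.
  intros H0 H; apply sum_eq; intros i Hi; apply sum_eq; intros l Hl.
  destruct i as [| i]; [rewrite H0; ring |].
  f_equal; apply PS_pow_causal; intros j Hj; apply H; lia.
Qed.

Lemma rec_step_causal p u v k :
  (forall l, hc p 0 l = 0) -> (forall j, (j < k)%nat -> u j = v j) ->
  rec_step p u k = rec_step p v k.
Proof.
  intros H0 H; destruct k as [| [| n]]; try reflexivity.
  unfold rec_step; rewrite H by lia.
  change (- ((INR (S n) + lin p) * v (S n)) + (fc p (S (S n)) + mu p * nonlin p u (S (S n)))
        = - ((INR (S n) + lin p) * v (S n)) + (fc p (S (S n)) + mu p * nonlin p v (S (S n)))).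
  now rewrite (nonlin_causal p u v).
Qed.

Lemma rec_step_unique p u v :
  (forall l, hc p 0 l = 0) -> (forall k, u k = rec_step p u k) ->
  (forall k, v k = rec_step p v k) -> forall k, u k = v k.
Proof.
  intros H0 Hu Hv k; induction k as [k IH] using lt_wf_ind.
  rewrite Hu, Hv; now apply rec_step_causal.
Qed.

Lemma approx_sol_stable p : (forall l, hc p 0 l = 0) ->
  forall n m k, (k < n)%nat -> (k < m)%nat -> approx_sol p n k = approx_sol p m k.
Proof.
  intros H0 n; induction n as [| n IH]; intros m k Hn Hm; [lia |].
  destruct m as [| m]; [lia |].
  apply rec_step_causal; trivial; intros j Hj; apply IH; lia.
Qed.

Lemma fsol_rec p : (forall l, hc p 0 l = 0) -> forall k, fsol p k = rec_step p (fsol p) k.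
Proof.
  intros H0 k; apply rec_step_causal; trivial.
  intros j Hj; apply approx_sol_stable; trivial; lia.
Qed.

Lemma formal_solution_rec rho B cl dl p u : admissible rho B cl dl p ->
  (formal_solution p u <-> forall k, u k = rec_step p u k).
Proof.
  intros (F0 & F1 & _ & _ & Hh & _).
  assert (G0 : g_coef p u 0 = 0).
  { unfold g_coef; rewrite F0; simpl; rewrite Hh by lia; ring. }
  assert (G1 : g_coef p u 1 = 0).
  { unfold g_coef; rewrite F1; simpl; rewrite !Hh by lia; ring. }
  assert (Hstep : forall n, PS_incr_n (PS_derive u) 2 (S (S n)) +
             (u (S (S n)) + lin p * PS_incr_1 u (S (S n))) =
             u (S (S n)) + (INR (S n) + lin p) * u (S n)).
  { intros n; unfold PS_incr_n, PS_incr_1, PS_derive; rewrite !S_INR; ring. }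
  split.
  - intros (U0 & U1 & H) [| [| n]]; [exact U0 | exact U1 |].
    specialize (H (S (S n))); rewrite Hstep in H; unfold rec_step; lra.
  - intros H; assert (U0 := H O); assert (U1 := H 1%nat); simpl in U0, U1.
    split; [exact U0 | split; [exact U1 |]].
    intros [| [| n]].
    + rewrite G0, U0; simpl; unfold PS_incr_1, zero; simpl; ring.
    + rewrite G1, U1; simpl; unfold PS_incr_1, zero; simpl; rewrite U0; ring.
    + rewrite Hstep; generalize (H (S (S n))); unfold rec_step; lra.
Qed.

(** After division by (-1)^n poch a n the homogeneous part of the recursion says that
    two consecutive terms are equal; what remains are the inhomogeneous terms. *)
Lemma fsol_telescope p u n : -2 < lin p ->
  (forall k, u k = rec_step p u k) ->
  (-1) ^ n * (u (S (S n)) * / poch (lin p) n) =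
  sum_f_R0 (fun j => (-1) ^ j * (fc p (S (S j)) * / poch (lin p) j)) n +
  mu p * sum_f_R0 (fun j => (-1) ^ j * (nonlin p u (S (S j)) * / poch (lin p) j)) n.
Proof.
  intros Ha Hu.
  assert (G : forall k, u (S (S k)) = - ((INR (S k) + lin p) * u (S k)) +
                (fc p (S (S k)) + mu p * nonlin p u (S (S k))))
    by (intros k; apply (Hu (S (S k)))).
  assert (U1 : u 1%nat = 0) by apply (Hu 1%nat).
  induction n as [| n IH].
  - rewrite G, U1; simpl; ring.
  - rewrite 2!tech5.
    replace (sum_f_R0 (fun j => (-1) ^ j * (fc p (S (S j)) * / poch (lin p) j)) n)
      with ((-1) ^ n * (u (S (S n)) * / poch (lin p) n) -
        mu p * sum_f_R0 (fun j => (-1) ^ j * (nonlin p u (S (S j)) * / poch (lin p) j)) n)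
      by (rewrite IH; ring).
    rewrite G.
    assert (P := poch_pos (lin p) n Ha); assert (Pn := pos_INR n).
    change (poch (lin p) (S n)) with ((2 + INR n + lin p) * poch (lin p) n).
    change ((-1) ^ S n) with (-1 * (-1) ^ n).
    rewrite 2!S_INR; field; split; lra.
Qed.

(** Twice the contribution of f alone, which leaves the same amount for the nonlinear
    terms. *)
Definition growth_bound (rho B A : R) : R := 2 * Series (forcing_term rho (B + 1) A).

Definition nonlinear_bound (rho B A : R) : R :=
  8 * nonlinear_const rho (A + 1) (growth_bound rho B A).

Section Growth.
Variables (rho B cl dl A c nu : R) (D : params -> Prop).
Hypotheses (Hrho : 0 < rho) (HB : 0 < B) (HA : -2 < A) (Hc : 0 < c <= 1)
  (Hadm : forall p, D p -> admissible rho B cl dl p).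
Hypotheses
  (Hlin : forall n, C11_le rho c D (fun p => 2 + INR n + lin p) (2 + INR n + (A + 1)))
  (Hinv : forall n, C11_le rho c D (fun p => / (2 + INR n + lin p)) (/ (2 + INR n + A)))
  (Hmu : C11_le rho c D mu nu).

Local Notation N := (C11_le rho c D).
Local Notation b := (A + 1).

Let Hc0 : 0 < c := proj1 Hc.

Lemma C11_le_inv_poch n : N (fun p => / poch (lin p) n) (/ poch A n).
Proof.
  induction n as [| n IH].
  - apply (C11_le_weaken _ _ _ _ (Rabs 1)); [| rewrite Rabs_R1; simpl; lra].
    apply (C11_le_ext _ _ _ (fun _ => 1)); [intros; simpl; field |].
    apply C11_le_const.
  - simpl; rewrite Rinv_mult.
    apply (C11_le_ext _ _ _ (fun p => / (2 + INR n + lin p) * / poch (lin p) n)).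
    + intros p _; now rewrite Rinv_mult.
    + apply C11_le_mult; trivial.
Qed.

Lemma C11_le_fc k : N (fun p => fc p k) ((B + 1) / rho ^ k).
Proof.
  assert (P : 0 < / rho ^ k) by now apply Rinv_0_lt_compat, pow_lt.
  apply (C11_le_weaken _ _ _ _ (B / rho ^ k + c * (/ rho ^ k))).
  - apply C11_le_linear; try reflexivity.
    + left; apply Rmult_lt_0_compat; lra.
    + lra.
    + intros v r (_ & _ & H & _); rewrite Rmult_comm; apply H.
    + intros p Hp; apply (Hadm p Hp).
  - unfold Rdiv; rewrite Rmult_plus_distr_r; nra.
Qed.

Lemma C11_le_hc k l : N (fun p => hc p k l) (2 / rho ^ (k + l)).
Proof.
  assert (P : 0 < / rho ^ (k + l)) by now apply Rinv_0_lt_compat, pow_lt.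
  apply (C11_le_weaken _ _ _ _ (/ rho ^ (k + l) + c * (/ rho ^ (k + l)))).
  - apply C11_le_linear; try reflexivity.
    + lra.
    + lra.
    + intros v r (_ & _ & _ & H); rewrite Rmult_comm; apply H.
    + intros p Hp; apply (Hadm p Hp).
  - unfold Rdiv; nra.
Qed.

Lemma C11_le_zero F : (forall p, D p -> F p = 0) -> N F 0.
Proof.
  intros H; apply (C11_le_ext _ _ _ (fun _ => 0)); [intros; symmetry; auto |].
  apply (C11_le_weaken _ _ _ _ (Rabs 0)); [apply C11_le_const | rewrite Rabs_R0; lra].
Qed.

Lemma C11_le_PS_pow (u : params -> nat -> R) U l n :
  (forall j, (j <= n)%nat -> N (fun p => u p j) (U j)) ->
  N (fun p => PS_pow (u p) l n) (PS_pow U l n).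
Proof.
  revert n; induction l as [| l IH]; intros n H.
  - apply (C11_le_weaken _ _ _ _ (Rabs (PS_pow U 0 n))).
    + apply (C11_le_const _ _ _ (PS_pow U 0 n)).
    + destruct n; simpl; [rewrite Rabs_R1 | rewrite Rabs_R0]; lra.
  - apply (C11_le_sum rho c D (fun j p => u p j * PS_pow (u p) l (n - j))
      (fun j => U j * PS_pow U l (n - j))).
    intros j Hj; apply C11_le_mult; trivial; [now apply H |].
    apply IH; intros i Hi; apply H; lia.
Qed.

(** [nonlinear_term_le] summed over the monomials of h.  The factor 8 is 2 for the
    norm of a coefficient of h times 2 for each of the two geometric sums. *)
Lemma C11_le_nonlin (u : params -> nat -> R) M k : 0 <= M ->
  (forall j, (j < k)%nat -> N (fun p => u p j) (M * poch2 b j)) ->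
  N (fun p => nonlin p (u p) k) (8 * nonlinear_const rho b M * poch2 b (k - 3)).
Proof.
  intros HM Hu.
  set (K := nonlinear_const rho b M).
  assert (HK : 0 <= K).
  { apply nonlinear_const_nonneg; lra. }
  assert (HQ : 0 <= poch2 b (k - 3)) by (apply poch2_nonneg; lra).
  set (X := 2 * K * poch2 b (k - 3)).
  assert (HX : 0 <= X) by (apply Rmult_le_pos; lra).
  assert (Hg1 : forall i, 0 <= geo1 i) by (intros [| i]; simpl; [lra | apply pow_le; lra]).
  assert (Hg2 : forall i, 0 <= geo2 i)
    by (intros [| [| i]]; simpl; try lra; apply pow_le; lra).
  apply (C11_le_weaken _ _ _ _
    (sum_f_R0 (fun i => sum_f_R0 (fun l => geo2 l * (geo1 i * X)) k) k)).
  - apply (C11_le_sum rho c D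
      (fun i p => sum_f_R0 (fun l => hc p i l * PS_pow (u p) l (k - i)) k)).
    intros i Hi.
    apply (C11_le_sum rho c D (fun l p => hc p i l * PS_pow (u p) l (k - i))).
    intros l Hl.
    destruct i as [| i].
    { apply (C11_le_weaken _ _ _ _ 0); [| simpl; lra].
      apply C11_le_zero; intros p Hp; destruct (Hadm p Hp) as (_ & _ & _ & _ & Hh & _).
      rewrite Hh by lia; ring. }
    destruct l as [| [| l]].
    1, 2: apply (C11_le_weaken _ _ _ _ 0); [| simpl; lra];
      apply C11_le_zero; intros p Hp; destruct (Hadm p Hp) as (_ & _ & _ & _ & Hh & _);
      rewrite Hh by lia; ring.
    apply (C11_le_weaken _ _ _ _ (2 / rho ^ (S i + S (S l)) *
      PS_pow (fun j => M * poch2 b j) (S (S l)) (k - S i))).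
    + apply (C11_le_mult _ _ _ Hc0 (fun p => hc p (S i) (S (S l)))); [apply C11_le_hc |].
      apply C11_le_PS_pow; intros j Hj; apply Hu; lia.
    + assert (H := nonlinear_term_le rho b M k i l Hrho ltac:(lra) HM); fold K in H.
      unfold X, Rdiv; nra.
  - apply Rle_trans with (sum_f_R0 (fun i => geo1 i * (2 * X)) k).
    + apply sum_Rle; intros i Hi; rewrite <- scal_sum, (Rmult_comm (geo1 i * X)).
      generalize (geo2_sum_le k) (Hg1 i); intros S2 G1.
      assert (0 <= geo1 i * X) by now apply Rmult_le_pos.
      nra.
    + rewrite <- scal_sum; generalize (geo1_sum_le k); intros S1; unfold X in *; nra.
Qed.

Local Notation phi := (forcing_term rho (B + 1) A).
Local Notation psi := (nonlinear_weight A).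
Local Notation M := (growth_bound rho B A).
Local Notation K := (nonlinear_bound rho B A).

Lemma growth_series_nonneg : 0 <= Series phi /\ 0 <= Series psi.
Proof.
  split; apply Series_nonneg.
  - now apply ex_series_forcing.
  - intros n; left; apply forcing_term_pos; lra.
  - now apply ex_series_nonlinear.
  - intros n; now apply nonlinear_weight_nonneg.
Qed.

Lemma growth_const_nonneg : 0 <= M /\ 0 <= K.
Proof.
  assert (HM : 0 <= M) by (unfold growth_bound; generalize growth_series_nonneg; lra).
  split; [exact HM |].
  apply Rmult_le_pos; [lra |]; apply nonlinear_const_nonneg; lra.
Qed.

Hypothesis Hsmall : nu * K * Series psi <= Series phi.

(** Bootstrap.  As long as the bound M holds below exponent k, the nonlinear terms
    are controlled by [C11_le_nonlin], and the recursion bounds the k-th coefficient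
    by the partial sums of phi + nu K psi; smallness of nu keeps these below M. *)
Lemma fsol_growth k : N (fun p => fsol p k) (M * poch2 b k).
Proof.
  destruct growth_const_nonneg as [HM HK].
  destruct growth_series_nonneg as [Sphi Spsi].
  assert (Hnu : 0 <= nu) by exact (C11_le_nonneg _ _ _ Hc0 _ _ Hmu).
  assert (Hphi : forall n, 0 <= phi n) by (intros n; left; apply forcing_term_pos; lra).
  assert (Hpsi : forall n, 0 <= psi n) by (intros n; now apply nonlinear_weight_nonneg).
  assert (Ephi : ex_series phi) by now apply ex_series_forcing.
  assert (Epsi : ex_series psi) by now apply ex_series_nonlinear.
  (* W n is the bound that the recursion gives for u_(n+2), divided by poch b n. *)
  set (W n := sum_f_R0 phi n + nu * K * sum_f_R0 psi n).
  assert (HnuK : 0 <= nu * K) by now apply Rmult_le_pos.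
  assert (HW : forall n, W n <= M).
  { intros n; unfold W, growth_bound.
    assert (H1 := Series_partial_le phi n Ephi Hphi).
    assert (H2 := Series_partial_le psi n Epsi Hpsi).
    assert (nu * K * sum_f_R0 psi n <= nu * K * Series psi)
      by now apply Rmult_le_compat_l.
    lra. }
  assert (Hb : -2 < b) by lra.
  assert (Hfrec : forall p, D p -> forall j, fsol p j = rec_step p (fsol p) j).
  { intros p Hp; apply fsol_rec; intros l.
    destruct (Hadm p Hp) as (_ & _ & _ & _ & Hh & _); apply Hh; lia. }
  assert (Hpoch : forall n, poch A n <= poch b n).
  { induction n as [| n IHn]; simpl; [lra |].
    generalize (pos_INR n) (poch_pos A n HA); intros; apply Rmult_le_compat; lra. }
  assert (Hweak : forall n, N (fun p => fsol p (S (S n))) (W n * poch b n) ->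
            N (fun p => fsol p (S (S n))) (M * poch2 b (S (S n)))).
  { intros n H; apply C11_le_weaken with (1 := H); simpl.
    apply Rmult_le_compat_r; [left; now apply poch_pos | apply HW]. }
  assert (Hmain : forall n, N (fun p => fsol p (S (S n))) (W n * poch b n)).
  { intros n; induction n as [n IH] using lt_wf_ind.
    assert (Hprev : forall j, (j < S (S n))%nat -> N (fun p => fsol p j) (M * poch2 b j)).
    { intros [| [| j]] Hj.
      1, 2: apply (C11_le_weaken _ _ _ _ 0); [apply C11_le_zero | simpl; lra];
        intros p Hp; now rewrite Hfrec.
      apply Hweak, IH; lia. }
    assert (Hg : N (fun p => fc p (S (S n)) + mu p * nonlin p (fsol p) (S (S n)))
              ((phi n + nu * K * psi n) * poch b n)).
    { apply C11_le_weaken with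
        ((B + 1) / rho ^ S (S n) + nu * (K * poch2 b (S (S n) - 3))).
      - apply C11_le_plus; trivial; [apply C11_le_fc |].
        apply C11_le_mult; trivial.
        apply C11_le_nonlin; trivial.
      - assert (P := poch_pos A n HA).
        replace (S (S n)) with (n + 2)%nat by lia.
        replace (n + 2 - 3)%nat with (n - 1)%nat by lia.
        replace ((B + 1) / rho ^ (n + 2) + nu * (K * poch2 b (n - 1)))
          with ((phi n + nu * K * psi n) * poch A n)
          by (unfold forcing_term, nonlinear_weight; field; split; [apply pow_nonzero; lra | lra]).
        apply Rmult_le_compat_l; [| apply Hpoch].
        apply Rplus_le_le_0_compat; [apply Hphi |].
        now apply Rmult_le_pos. }
    destruct n as [| n].
    - apply (C11_le_ext _ _ _
        (fun p => fc p 2 + mu p * nonlin p (fsol p) 2)).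
      + intros p Hp; rewrite (Hfrec p Hp 2%nat); unfold rec_step.
        rewrite (Hfrec p Hp 1%nat).
        change (g_coef p (fsol p) 2) with (fc p 2 + mu p * nonlin p (fsol p) 2).
        simpl rec_step; ring.
      - apply C11_le_weaken with (1 := Hg); unfold W; simpl; lra.
    - apply (C11_le_ext _ _ _ (fun p => (-1) * ((2 + INR n + lin p) * fsol p (S (S n))) +
        (fc p (S (S (S n))) + mu p * nonlin p (fsol p) (S (S (S n)))))).
      + intros p Hp; rewrite (Hfrec p Hp (S (S (S n)))); unfold rec_step.
        change (g_coef p (fsol p) (S (S (S n)))) with
          (fc p (S (S (S n))) + mu p * nonlin p (fsol p) (S (S (S n)))).
        rewrite 2!S_INR; ring.
      + apply C11_le_weaken with
          (Rabs (-1) * ((2 + INR n + b) * (W n * poch b n)) +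
           (phi (S n) + nu * K * psi (S n)) * poch b (S n)).
        * apply C11_le_plus; trivial.
          apply C11_le_scal; trivial; apply C11_le_mult; trivial.
          apply IH; lia.
        * replace (Rabs (-1)) with 1 by (rewrite Rabs_left; lra).
          unfold W; rewrite 2!tech5; simpl poch.
          right; ring. }
  destruct k as [| [| k]].
  1, 2: apply (C11_le_weaken _ _ _ _ 0); [apply C11_le_zero | simpl; lra];
    intros p Hp; now rewrite Hfrec.
  apply Hweak, Hmain.
Qed.

Definition lin_sum (p : params) : R :=
  Series (fun n => (-1) ^ n * (fc p (S (S n)) * / poch (lin p) n)).

Definition nonlin_sum (p : params) : R :=
  Series (fun n => (-1) ^ n * (nonlin p (fsol p) (S (S n)) * / poch (lin p) n)).

Lemma Rabs_sign n : Rabs ((-1) ^ n) = 1.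
Proof. apply pow_1_abs. Qed.

Lemma C11_le_lin_term n :
  N (fun p => (-1) ^ n * (fc p (S (S n)) * / poch (lin p) n)) (phi n).
Proof.
  apply C11_le_weaken with (Rabs ((-1) ^ n) * ((B + 1) / rho ^ S (S n) * / poch A n)).
  - apply C11_le_scal, C11_le_mult; trivial; [apply C11_le_fc | apply C11_le_inv_poch].
  - rewrite Rabs_sign; unfold forcing_term; replace (n + 2)%nat with (S (S n)) by lia.
    right; unfold Rdiv; ring.
Qed.

Lemma C11_le_nonlin_term n :
  N (fun p => (-1) ^ n * (nonlin p (fsol p) (S (S n)) * / poch (lin p) n)) (K * psi n).
Proof.
  apply C11_le_weaken with (Rabs ((-1) ^ n) * (K * poch2 b (S (S n) - 3) * / poch A n)).
  - apply C11_le_scal, C11_le_mult; trivial; [| apply C11_le_inv_poch].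
    apply C11_le_nonlin; [apply growth_const_nonneg |].
    intros; apply fsol_growth.
  - rewrite Rabs_sign; unfold nonlinear_weight; replace (n - 1)%nat with (S (S n) - 3)%nat by lia.
    right; unfold Rdiv; ring.
Qed.

Lemma C11_le_lin_sum : N lin_sum (Series phi).
Proof.
  apply (C11_le_series rho c D Hc0
    (fun n p => (-1) ^ n * (fc p (S (S n)) * / poch (lin p) n))).
  - apply C11_le_lin_term.
  - now apply ex_series_forcing.
Qed.

Lemma C11_le_nonlin_sum : N nonlin_sum (K * Series psi).
Proof.
  rewrite <- Series_scal_l.
  apply (C11_le_series rho c D Hc0
    (fun n p => (-1) ^ n * (nonlin p (fsol p) (S (S n)) * / poch (lin p) n))).
  - apply C11_le_nonlin_term.
  - apply (ex_series_scal_l K psi); now apply ex_series_nonlinear.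
Qed.

Lemma ex_series_lin_sum p : D p ->
  ex_series (fun n => (-1) ^ n * (fc p (S (S n)) * / poch (lin p) n)).
Proof.
  intros Hp; apply (Series_abs_le _ phi); [| now apply ex_series_forcing].
  intros n; apply (C11_le_val rho c D Hc0 _ _ p (C11_le_lin_term n) Hp).
Qed.

Lemma fsol_limit p : D p -> -2 < lin p ->
  is_lim_seq (fun k => (-1) ^ k / Gamma (INR k + lin p) * fsol p k)
    (/ Gamma (2 + lin p) * (lin_sum p + mu p * nonlin_sum p)).
Proof.
  intros Hp Ha; apply (is_lim_seq_incr_n _ 2).
  assert (Hg := Gamma_pos (2 + lin p) ltac:(lra)).
  apply (is_lim_seq_ext (fun n => / Gamma (2 + lin p) *
    (sum_n (fun j => (-1) ^ j * (fc p (S (S j)) * / poch (lin p) j)) n +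
     mu p * sum_n (fun j => (-1) ^ j * (nonlin p (fsol p) (S (S j)) * / poch (lin p) j)) n))).
  - intros n; rewrite 2!sum_n_Reals, <- fsol_telescope; trivial.
    + replace (n + 2)%nat with (S (S n)) by lia.
      rewrite Gamma_poch by lra.
      assert (P := poch_pos (lin p) n Ha).
      change ((-1) ^ S (S n)) with (-1 * (-1 * (-1) ^ n)); field; lra.
    + apply fsol_rec; intros l.
      destruct (Hadm p Hp) as (_ & _ & _ & _ & Hh & _); apply Hh; lia.
  - assert (E1 := ex_series_lin_sum p Hp).
    assert (E2 : ex_series (fun n => (-1) ^ n *
               (nonlin p (fsol p) (S (S n)) * / poch (lin p) n))).
    { apply (Series_abs_le _ (fun n => K * psi n)).
      - intros n; apply (C11_le_val rho c D Hc0 _ _ p (C11_le_nonlin_term n) Hp).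
      - apply (ex_series_scal_l K psi); now apply ex_series_nonlinear. }
    apply (is_lim_seq_scal_l _ (/ Gamma (2 + lin p)) (lin_sum p + mu p * nonlin_sum p)).
    apply is_lim_seq_plus'; [apply (Series_correct _ E1) |].
    apply (is_lim_seq_scal_l _ (mu p) (nonlin_sum p)), (Series_correct _ E2).
Qed.

End Growth.

(** * Asymptotic expansions at the origin *)

(** f has the Taylor expansion s up to an error O(x^K).  The recursive form, which
    splits off one coefficient and divides by x, reduces products and uniqueness to
    one line of algebra per step.  The point 0 is excluded because the quotient is
    undetermined there. *)
Fixpoint expands (K : nat) (f : R -> R) (s : nat -> R) : Prop :=
  match K with
  | O => exists C, locally' 0 (fun x => Rabs (f x) <= C)
  | S K' => exists g, locally' 0 (fun x => f x = s O + x * g x) /\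
              expands K' g (fun k => s (S k))
  end.

Lemma locally'_intro (P : R -> Prop) (d : R) : 0 < d ->
  (forall x, x <> 0 -> Rabs x < d -> P x) -> locally' 0 P.
Proof.
  intros Hd H; exists (mkposreal d Hd); intros x Hx Hx0; apply H; trivial.
  unfold ball in Hx; simpl in Hx; unfold AbsRing_ball, abs, minus, plus, opp in Hx;
    simpl in Hx; now rewrite Ropp_0, Rplus_0_r in Hx.
Qed.

Lemma locally'_elim (P : R -> Prop) : locally' 0 P ->
  exists d, 0 < d /\ forall x, x <> 0 -> Rabs x < d -> P x.
Proof.
  intros [d H]; exists d; split; [apply d |]; intros x Hx0 Hx; apply H; trivial.
  unfold ball; simpl; unfold AbsRing_ball, abs, minus, plus, opp; simpl.
  now rewrite Ropp_0, Rplus_0_r.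
Qed.

Lemma expands_ext K f f' s s' :
  locally' 0 (fun x => f x = f' x) -> (forall k, (k < K)%nat -> s k = s' k) ->
  expands K f s -> expands K f' s'.
Proof.
  revert f f' s s'; induction K as [| K IH]; intros f f' s s' Hf Hs.
  - intros [C H]; exists C; generalize (filter_and _ _ Hf H); apply filter_imp.
    intros x [<- Hx]; exact Hx.
  - intros [g [Hg H]]; exists g; split.
    + generalize (filter_and _ _ Hf Hg); apply filter_imp.
      intros x [<- Hx]; rewrite Hx, Hs by lia; reflexivity.
    + apply (IH g g _ _ ltac:(now apply filter_forall)) with (2 := H).
      intros k Hk; apply Hs; lia.
Qed.

Lemma expands_bounded K f s : expands K f s ->
  exists C, 0 < C /\ locally' 0 (fun x => Rabs (f x) <= C).
Proof.
  revert f s; induction K as [| K IH]; intros f s.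
  - intros [C H]; exists (Rmax C 1); split; [generalize (Rmax_r C 1); lra |].
    generalize H; apply filter_imp; intros x Hx.
    apply Rle_trans with (1 := Hx), Rmax_l.
  - intros [g [Hg H]]; destruct (IH _ _ H) as [C [HC HCb]].
    exists (Rabs (s O) + C); split; [generalize (Rabs_pos (s O)); lra |].
    assert (H1 : locally' 0 (fun x => Rabs x < 1))
      by (apply (locally'_intro _ 1); trivial; lra).
    generalize (filter_and _ _ Hg (filter_and _ _ HCb H1)); apply filter_imp.
    intros x [-> [Hx Hx1]]; apply Rle_trans with (1 := Rabs_triang _ _).
    rewrite Rabs_mult; generalize (Rabs_pos x) (Rabs_pos (g x)); nra.
Qed.

Lemma expands_weaken K f s : expands (S K) f s -> expands K f s.
Proof.
  revert f s; induction K as [| K IH]; intros f s H.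
  - destruct (expands_bounded _ _ _ H) as [C [_ HC]]; now exists C.
  - destruct H as [g [Hg H]]; exists g; split; trivial; now apply IH.
Qed.

Lemma expands_plus K f g s t : expands K f s -> expands K g t ->
  expands K (fun x => f x + g x) (fun k => s k + t k).
Proof.
  revert f g s t; induction K as [| K IH]; intros f g s t.
  - intros [C HC] [C' HC']; exists (C + C').
    generalize (filter_and _ _ HC HC'); apply filter_imp; intros x [H1 H2].
    apply Rle_trans with (1 := Rabs_triang _ _); lra.
  - intros [f1 [Hf H]] [g1 [Hg H']]; exists (fun x => f1 x + g1 x); split.
    + generalize (filter_and _ _ Hf Hg); apply filter_imp; intros x [-> ->]; ring.
    + now apply (IH f1 g1 (fun k => s (S k)) (fun k => t (S k))).
Qed.

Lemma expands_scal K c f s : expands K f s ->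
  expands K (fun x => c * f x) (fun k => c * s k).
Proof.
  revert f s; induction K as [| K IH]; intros f s.
  - intros [C HC]; exists (Rabs c * C).
    generalize HC; apply filter_imp; intros x H1.
    rewrite Rabs_mult; apply Rmult_le_compat_l; trivial; apply Rabs_pos.
  - intros [f1 [Hf H]]; exists (fun x => c * f1 x); split.
    + generalize Hf; apply filter_imp; intros x ->; ring.
    + now apply (IH f1 (fun k => s (S k))).
Qed.

(** With f = s0 + x f1 and g = t0 + x g1, write f g - s0 t0 = x (s0 g1 + f1 g). *)
Lemma expands_mult K f g s t : expands K f s -> expands K g t ->
  expands K (fun x => f x * g x) (PS_mult s t).
Proof.
  revert f g s t; induction K as [| K IH]; intros f g s t.
  - intros [C HC] [C' HC']; exists (C * C').
    generalize (filter_and _ _ HC HC'); apply filter_imp; intros x [H1 H2].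
    now apply Rabs_mult_le.
  - intros [f1 [Hf H]] Hgt; assert (Hg0 := expands_weaken _ _ _ Hgt).
    destruct Hgt as [g1 [Hg H']].
    exists (fun x => s O * g1 x + f1 x * g x); split.
    + generalize (filter_and _ _ Hf Hg); apply filter_imp; intros x [-> Hx].
      unfold PS_mult; simpl; rewrite Hx; ring.
    + apply (expands_ext K (fun x => s O * g1 x + f1 x * g x) _
        (fun k => s O * t (S k) + PS_mult (fun k => s (S k)) t k)).
      * now apply filter_forall.
      * intros k _; unfold PS_mult; rewrite (decomp_sum _ (S k)) by lia.
        simpl pred; rewrite Nat.sub_0_r; reflexivity.
      * apply expands_plus; [now apply (expands_scal K (s O) g1 (fun k => t (S k))) |].
        now apply IH.
Qed.

Lemma expands_shift K f s : expands K f s -> expands K (fun x => x * f x) (PS_incr_1 s).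
Proof.
  intros H; apply expands_weaken; exists f; split.
  - apply filter_forall; intros x; unfold PS_incr_1, zero; simpl; ring.
  - exact H.
Qed.

Lemma expands_shift_n K f s i : expands K f s ->
  expands K (fun x => x ^ i * f x) (PS_incr_n s i).
Proof.
  intros H; induction i as [| i IH].
  - apply expands_ext with (3 := H); [apply filter_forall; intros; simpl; ring | trivial].
  - apply expands_ext with (3 := expands_shift _ _ _ IH); [| trivial].
    apply filter_forall; intros; simpl; ring.
Qed.

(** Two expansions with different constant terms would differ by a nonzero constant
    that is O(x); comparing the quotients gives the remaining coefficients. *)
Lemma expands_unique K f s t : expands K f s -> expands K f t ->
  forall k, (k < K)%nat -> s k = t k.
Proof.
  revert f s t; induction K as [| K IH]; intros f s t Hs Ht k Hk; [lia |].
  destruct Hs as [g [Hg Hs]]; destruct Ht as [h [Hh Ht]].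
  assert (E0 : s O = t O).
  { destruct (expands_bounded _ _ _ Hs) as [C [HC HCb]].
    destruct (expands_bounded _ _ _ Ht) as [C' [HC' HCb']].
    destruct (locally'_elim _ (filter_and _ _ (filter_and _ _ Hg Hh)
      (filter_and _ _ HCb HCb'))) as [d [Hd H]].
    destruct (Req_dec (s O) (t O)) as [| Hne]; trivial; exfalso.
    assert (Hp : 0 < Rabs (s O - t O)) by (apply Rabs_pos_lt; lra).
    set (x := Rmin (d / 2) (Rabs (s O - t O) / (2 * (C + C')))).
    assert (Hx0 : 0 < x).
    { apply Rmin_glb_lt; [lra | apply Rdiv_lt_0_compat; lra]. }
    assert (Hxd : x <= d / 2) by apply Rmin_l.
    assert (Hx2 : x <= Rabs (s O - t O) / (2 * (C + C'))) by apply Rmin_r.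
    destruct (H x ltac:(lra)) as [[E1 E2] [B1 B2]]; [rewrite Rabs_right; lra |].
    assert (E : s O - t O = x * (h x - g x)) by lra.
    assert (B : Rabs (s O - t O) <= x * (C + C')).
    { rewrite E, Rabs_mult, (Rabs_right x) by lra.
      apply Rmult_le_compat_l; [lra |].
      apply Rle_trans with (1 := Rabs_triang _ _); rewrite Rabs_Ropp; lra. }
    assert (x * (C + C') <= Rabs (s O - t O) / 2).
    { replace (Rabs (s O - t O) / 2)
        with (Rabs (s O - t O) / (2 * (C + C')) * (C + C')) by (field; lra).
      apply Rmult_le_compat_r; lra. }
    lra. }
  destruct k as [| k]; [exact E0 |].
  apply (IH g (fun k => s (S k)) (fun k => t (S k))); trivial; [| lia].
  apply (expands_ext K h g (fun k => t (S k)) (fun k => t (S k))); trivial.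
  assert (Hnz : locally' 0 (fun x => x <> 0)) by (apply (locally'_intro _ 1); trivial; lra).
  generalize (filter_and _ _ Hnz (filter_and _ _ Hg Hh)); apply filter_imp.
  intros x [Hx [E1 E2]]; apply (Rmult_eq_reg_l x); trivial; lra.
Qed.

Fixpoint trunc (s : nat -> R) (x : R) (K : nat) : R :=
  match K with O => 0 | S K' => trunc s x K' + s K' * x ^ K' end.

Lemma trunc_S s x K : trunc s x (S K) = s O + x * trunc (fun k => s (S k)) x K.
Proof.
  induction K as [| K IH]; [simpl; ring |].
  change (trunc s x (S (S K))) with (trunc s x (S K) + s (S K) * x ^ S K).
  rewrite IH; simpl; ring.
Qed.

Lemma trunc_0 x K : trunc (fun _ => 0) x K = 0.
Proof. induction K as [| K IH]; simpl; [| rewrite IH]; ring. Qed.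

Lemma expands_of_bound K f s C :
  locally' 0 (fun x => Rabs (f x - trunc s x K) <= C * Rabs x ^ K) -> expands K f s.
Proof.
  revert f s; induction K as [| K IH]; intros f s H.
  - exists C; generalize H; apply filter_imp; intros x; simpl.
    rewrite Rminus_0_r, Rmult_1_r; trivial.
  - assert (Hnz : locally' 0 (fun x => x <> 0))
      by (apply (locally'_intro _ 1); trivial; lra).
    exists (fun x => (f x - s O) / x); split.
    + generalize Hnz; apply filter_imp; intros x Hx; field; trivial.
    + apply IH; generalize (filter_and _ _ Hnz H); apply filter_imp.
      intros x [Hx HC]; rewrite trunc_S in HC.
      assert (Hp : 0 < Rabs x) by now apply Rabs_pos_lt.
      apply (Rmult_le_reg_l (Rabs x)); trivial.
      rewrite <- Rabs_mult.
      replace (x * ((f x - s O) / x - trunc (fun k => s (S k)) x K))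
        with (f x - (s O + x * trunc (fun k => s (S k)) x K)) by (field; trivial).
      simpl in HC; lra.
Qed.

Lemma expands_const K c : expands K (fun _ => c) (fun k => match k with O => c | _ => 0 end).
Proof.
  destruct K as [| K].
  - exists (Rabs c); apply filter_forall; intros; lra.
  - exists (fun _ => 0); split.
    + apply filter_forall; intros; ring.
    + apply (expands_of_bound K _ _ 0), filter_forall; intros x.
      rewrite trunc_0, Rminus_diag, Rabs_R0; lra.
Qed.

Lemma expands_sum K (th : nat -> R -> R) (s : nat -> nat -> R) n :
  (forall i, expands K (th i) (s i)) ->
  expands K (fun x => sum_f_R0 (fun i => th i x) n) (fun k => sum_f_R0 (fun i => s i k) n).
Proof.
  intros H; induction n as [| n IH]; [apply H |].
  now apply (expands_plus K _ (th (S n)) _ (s (S n))).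
Qed.

(** The terms of index above K are O(x^K) together, by comparison with a geometric
    series; the others are finitely many. *)
Lemma expands_series K (th : nat -> R -> R) (s : nat -> nat -> R) C q :
  0 <= C -> 0 < q ->
  locally' 0 (fun x => forall i, Rabs (th i x) <= C * (q * Rabs x) ^ i) ->
  (forall i, expands K (th i) (s i)) ->
  (forall i k, (k < i)%nat -> s i k = 0) ->
  expands K (fun x => Series (fun i => th i x)) (fun k => sum_f_R0 (fun i => s i k) k).
Proof.
  intros HC Hq Hb He Hz.
  assert (Hsmall : locally' 0 (fun x => q * Rabs x <= / 2)).
  { apply (locally'_intro _ (/ (2 * q))); [apply Rinv_0_lt_compat; lra |].
    intros x _ Hx; replace (/ 2) with (q * / (2 * q)) by (field; lra).
    apply Rmult_le_compat_l; lra. }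
  apply (expands_ext K
    (fun x => sum_f_R0 (fun i => th i x) K + Series (fun i => th (S K + i)%nat x)) _
    (fun k => sum_f_R0 (fun i => s i k) K + 0)).
  - generalize (filter_and _ _ Hb Hsmall); apply filter_imp; intros x [Hx Hx2].
    symmetry; apply (Series_incr_n (fun i => th i x) (S K)); [lia |].
    apply (Series_abs_le _ (fun i => C * (q * Rabs x) ^ i)); trivial.
    apply (ex_series_scal_l C (fun i => (q * Rabs x) ^ i)), ex_series_geom.
    rewrite Rabs_right; [lra |].
    apply Rle_ge, Rmult_le_pos; [lra | apply Rabs_pos].
  - intros k Hk; rewrite Rplus_0_r; apply sum_f_R0_trunc; [lia |].
    intros i Hi; apply Hz; lia.
  - apply (expands_plus K _ _ (fun k => sum_f_R0 (fun i => s i k) K) (fun _ => 0)).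
    + now apply expands_sum.
    + apply (expands_of_bound K _ _ (C * q ^ K)).
      generalize (filter_and _ _ Hb Hsmall); apply filter_imp; intros x [Hx Hx2].
      rewrite trunc_0, Rminus_0_r.
      assert (Hq0 : 0 <= q * Rabs x) by (apply Rmult_le_pos; [lra | apply Rabs_pos]).
      assert (Hgeo : ex_series (fun i => (/ 2) ^ i)).
      { apply ex_series_geom; rewrite Rabs_right; lra. }
      set (r := q * Rabs x) in *.
      apply Rle_trans with (Series (fun i => C * r ^ S K * (/ 2) ^ i)).
      * apply Series_abs_le.
        -- intros i; apply Rle_trans with (1 := Hx _).
           rewrite pow_add, <- Rmult_assoc; apply Rmult_le_compat_l.
           ++ apply Rmult_le_pos; [lra | now apply pow_le].
           ++ apply pow_incr; lra.
        -- apply (ex_series_scal_l (C * r ^ S K) (fun i => (/ 2) ^ i) Hgeo).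
      * rewrite Series_scal_l, Series_geom by (rewrite Rabs_right; lra).
        replace (C * q ^ K * Rabs x ^ K) with (C * r ^ K)
          by (unfold r; rewrite Rpow_mult_distr; ring).
        replace (C * r ^ S K * / (1 - / 2)) with (C * r ^ K * (2 * r))
          by (simpl; field).
        assert (0 <= C * r ^ K) by (apply Rmult_le_pos; [lra | now apply pow_le]).
        nra.
Qed.

Lemma expands_monomial K c i :
  expands K (fun x => c * x ^ i) (fun k => if Nat.eqb k i then c else 0).
Proof.
  apply expands_ext with (3 := expands_shift_n K _ _ i (expands_const K c)).
  - apply filter_forall; intros; ring.
  - intros k _; rewrite PS_incr_n_simplify.
    destruct (le_lt_dec i k) as [H | H]; destruct (Nat.eqb_spec k i) as [E | E];
      try (exfalso; lia); try reflexivity.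
    + subst; now rewrite Nat.sub_diag.
    + destruct (k - i)%nat eqn:E'; [lia | reflexivity].
Qed.

Lemma sum_f_R0_delta (a : nat -> R) k :
  sum_f_R0 (fun i => if Nat.eqb k i then a i else 0) k = a k.
Proof.
  destruct k as [| k]; [reflexivity |].
  rewrite tech5, Nat.eqb_refl, (sum_eq _ (fun _ => 0)), sum_cte; [ring |].
  intros i Hi; destruct (Nat.eqb_spec (S k) i); [lia | reflexivity].
Qed.

Lemma expands_PSeries K a C q : 0 <= C -> 0 < q ->
  (forall k, Rabs (a k) <= C * q ^ k) -> expands K (PSeries a) a.
Proof.
  intros HC Hq Ha.
  apply (expands_ext K (PSeries a) (PSeries a)
    (fun k => sum_f_R0 (fun i => if Nat.eqb k i then a i else 0) k)).
  - now apply filter_forall.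
  - intros k _; apply sum_f_R0_delta.
  - apply (expands_series K (fun i x => a i * x ^ i)
      (fun i k => if Nat.eqb k i then a i else 0) C q); trivial.
    + apply filter_forall; intros x i.
      rewrite Rabs_mult, <- RPow_abs, Rpow_mult_distr, <- Rmult_assoc.
      apply Rmult_le_compat_r; [apply pow_le, Rabs_pos | apply Ha].
    + intros i; apply expands_monomial.
    + intros i k Hk; destruct (Nat.eqb_spec k i); [lia | reflexivity].
Qed.

Lemma is_derive_trunc s x K :
  is_derive (fun y => trunc s y (S K)) x (trunc (PS_derive s) x K).
Proof.
  induction K as [| K IH].
  - simpl; auto_derive; trivial; ring.
  - change (trunc (PS_derive s) x (S K))
      with (trunc (PS_derive s) x K + PS_derive s K * x ^ K).
    apply (is_derive_plus (fun y => trunc s y (S K)) (fun y => s (S K) * y ^ S K)); trivial.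
    unfold PS_derive; evar_last.
    + apply (is_derive_scal (fun y => y ^ S K)), is_derive_pow, is_derive_id.
    + simpl pred; change one with 1; rewrite S_INR; ring.
Qed.

Lemma smooth_Derive m x : (forall n, ex_derive_n m n x) ->
  (forall n, ex_derive_n (Derive m) n x).
Proof.
  intros H [| n]; [exact I |].
  apply (ex_derive_ext (Derive_n m (S n))); [| apply (H (S (S n)))].
  intros t; rewrite <- (Nat.add_1_r n), <- (Derive_n_comp m n 1); reflexivity.
Qed.

Definition taylor_coef (m : R -> R) (k : nat) : R := / INR (fact k) * Derive_n m k 0.

Lemma taylor_coef_Derive m k : taylor_coef (Derive m) k = PS_derive (taylor_coef m) k.
Proof.
  unfold taylor_coef, PS_derive; change (Derive m) with (Derive_n m 1).
  rewrite Derive_n_comp, Nat.add_1_r.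
  change (fact (S k)) with (S k * fact k)%nat; rewrite mult_INR.
  assert (H := INR_fact_lt_0 k); assert (H' := lt_0_INR (S k) ltac:(lia)).
  field; lra.
Qed.

Lemma trunc_ext s t x K : (forall k, s k = t k) -> trunc s x K = trunc t x K.
Proof. intros H; induction K as [| K IH]; simpl; [| rewrite IH, H]; reflexivity. Qed.

(** Induction on the order with the mean value theorem: the derivative of the
    remainder of m is the remainder of m'. *)
Lemma taylor_remainder K m : locally 0 (fun x => forall n, ex_derive_n m n x) ->
  exists C d, 0 <= C /\ 0 < d /\ forall x, Rabs x < d ->
    Rabs (m x - trunc (taylor_coef m) x K) <= C * Rabs x ^ K.
Proof.
  revert m; induction K as [| K IH]; intros m Hm.
  - assert (Hc : continuous m 0).
    { apply (ex_derive_continuous m), (locally_singleton _ _ Hm 1%nat). }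
    destruct (Hc _ (locally_ball (m 0) (mkposreal 1 Rlt_0_1))) as [d Hd].
    exists (Rabs (m 0) + 1), d; split; [generalize (Rabs_pos (m 0)); lra |].
    split; [apply d |]; intros x Hx.
    assert (Hb : Rabs (m x - m 0) < 1).
    { apply (Hd x); change (Rabs (x - 0) < d); now rewrite Rminus_0_r. }
    simpl; rewrite Rminus_0_r, Rmult_1_r.
    replace (m x) with (m x - m 0 + m 0) by ring.
    apply Rle_trans with (1 := Rabs_triang _ _); lra.
  - assert (Hm' : locally 0 (fun x => forall n, ex_derive_n (Derive m) n x))
      by (generalize Hm; apply filter_imp, smooth_Derive).
    destruct (IH _ Hm') as (C & d & HC & Hd & HCd); destruct Hm as [d' Hd'].
    exists C, (Rmin d d'); split; [exact HC |].
    split; [apply Rmin_glb_lt; [exact Hd | apply d'] |].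
    intros x Hx.
    assert (Hx1 : Rabs x < d) by (apply Rlt_le_trans with (1 := Hx), Rmin_l).
    assert (Hx2 : Rabs x < d') by (apply Rlt_le_trans with (1 := Hx), Rmin_r).
    assert (H0 : m 0 - trunc (taylor_coef m) 0 (S K) = 0).
    { rewrite trunc_S; unfold taylor_coef; simpl; field. }
    assert (Hseg : forall t, Rmin 0 x <= t <= Rmax 0 x -> Rabs t <= Rabs x).
    { intros t Ht; unfold Rmin, Rmax in Ht; destruct (Rle_dec 0 x) as [Hx0 | Hx0].
      - rewrite 2!Rabs_right; lra.
      - rewrite 2!Rabs_left1; lra. }
    destruct (MVT_gen (fun t => m t - trunc (taylor_coef m) t (S K)) 0 x
      (fun t => Derive m t - trunc (PS_derive (taylor_coef m)) t K)) as [t [Ht Et]].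
    + intros t Ht.
      apply (is_derive_minus m (fun t => trunc (taylor_coef m) t (S K)));
        [| apply is_derive_trunc].
      apply Derive_correct; refine (Hd' t _ 1%nat).
      change (Rabs (t - 0) < d'); rewrite Rminus_0_r.
      apply Rle_lt_trans with (2 := Hx2), Hseg; lra.
    + intros t Ht.
      apply continuity_pt_minus.
      * apply continuity_pt_filterlim, (ex_derive_continuous m).
        refine (Hd' t _ 1%nat).
        change (Rabs (t - 0) < d'); rewrite Rminus_0_r.
        apply Rle_lt_trans with (2 := Hx2), Hseg; lra.
      * apply continuity_pt_filterlim.
        apply (ex_derive_continuous (fun t => trunc (taylor_coef m) t (S K))).
        eexists; apply is_derive_trunc.
    + rewrite H0, !Rminus_0_r in Et; rewrite Et, Rabs_mult.
      assert (Htx := Hseg t Ht).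
      rewrite <- (trunc_ext _ _ t K (taylor_coef_Derive m)).
      assert (B := HCd t ltac:(lra)).
      simpl; replace (C * (Rabs x * Rabs x ^ K)) with (C * Rabs x ^ K * Rabs x) by ring.
      apply Rmult_le_compat_r; [apply Rabs_pos |].
      apply Rle_trans with (1 := B), Rmult_le_compat_l; trivial.
      apply pow_incr; split; [apply Rabs_pos | exact Htx].
Qed.

Lemma expands_taylor K m : locally 0 (fun x => forall n, ex_derive_n m n x) ->
  expands K m (taylor_coef m).
Proof.
  intros Hm; destruct (taylor_remainder K m Hm) as (C & d & _ & Hd & H).
  apply (expands_of_bound K _ _ C), (locally'_intro _ d); auto.
Qed.

(** * Center manifolds *)

Lemma PS_pow_low u l k : u O = 0 -> (k < l)%nat -> PS_pow u l k = 0.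
Proof.
  intros U0; revert k; induction l as [| l IH]; intros k Hk; [lia |].
  change (PS_mult u (PS_pow u l) k = 0); unfold PS_mult.
  rewrite (sum_eq _ (fun _ => 0)), sum_cte; [ring |].
  intros [| j] Hj; [rewrite U0; ring | rewrite IH by lia; ring].
Qed.

Lemma expands_pow K f s l : expands K f s -> expands K (fun x => f x ^ l) (PS_pow s l).
Proof.
  intros H; induction l as [| l IH].
  - apply expands_ext with (3 := expands_const K 1).
    + apply filter_forall; reflexivity.
    + intros [| k] _; reflexivity.
  - now apply (expands_mult K f (fun x => f x ^ l) s (PS_pow s l)).
Qed.

Lemma locally_deleted (P : R -> Prop) : locally 0 P -> locally' 0 P.
Proof. apply filter_le_within. Qed.

Section CenterManifold.
Variables (rho B cl dl : R) (p : params) (m : R -> R).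
Hypotheses (Hrho : 0 < rho) (HB : 0 < B) (Hadm : admissible rho B cl dl p).

(** Since m(x) = O(x), the l-th term of the composed series is O(x^l). *)
Lemma expands_composed_series K c q :
  c O = 0 -> expands K m c ->
  locally' 0 (fun x => Rabs (m x) <= Rabs x) -> 0 < q ->
  forall a C, 0 <= C -> (forall l, Rabs (a l) <= C * q ^ l) ->
  expands K (fun x => PSeries a (m x)) (fun k => sum_f_R0 (fun l => a l * PS_pow c l k) k).
Proof.
  intros C0 Hm Hmx Hq a C HC Ha.
  apply (expands_series K (fun l x => a l * m x ^ l) (fun l k => a l * PS_pow c l k) C q);
    trivial.
  - generalize Hmx; apply filter_imp; intros x Hx l.
    rewrite Rpow_mult_distr, <- Rmult_assoc.
    apply Rabs_mult_le; [apply Ha |].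
    rewrite <- RPow_abs; apply pow_incr; split; [apply Rabs_pos | exact Hx].
  - intros l; apply expands_scal; now apply expands_pow.
  - intros l k Hk; rewrite PS_pow_low by trivial; ring.
Qed.

(** Two nested applications of the series lemma, first in y for each power of x and
    then in x.  On |x|, |m(x)| <= rho / 2 the inner sums are bounded by 2 rho^(-i). *)
Lemma expands_gfun K c : c O = 0 -> c 1%nat = 0 -> expands K m c -> expands 2 m c ->
  expands K (fun x => gfun p x (m x)) (g_coef p c).
Proof.
  intros C0 C1 Hm Hm2; destruct Hadm as (_ & _ & _ & Hf & Hh0 & Hh).
  assert (Hri : 0 < / rho) by now apply Rinv_0_lt_compat.
  assert (Hmx : locally' 0 (fun x => Rabs (m x) <= Rabs x /\ Rabs x <= rho / 2)).
  { destruct Hm2 as [g [Hg [g' [Hg' [C HC]]]]].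
    assert (HC1 : 0 < Rabs C + 1) by (generalize (Rabs_pos C); lra).
    assert (Hsm : locally' 0 (fun x => Rabs x < Rmin (/ (Rabs C + 1)) (rho / 2))).
    { apply (locally'_intro _ (Rmin (/ (Rabs C + 1)) (rho / 2))); trivial.
      apply Rmin_glb_lt; [now apply Rinv_0_lt_compat | lra]. }
    generalize (filter_and _ _ (filter_and _ _ Hg Hg') (filter_and _ _ HC Hsm)).
    apply filter_imp; intros x [[-> ->] [Hx Hx']].
    assert (Hx1 := Rlt_le_trans _ _ _ Hx' (Rmin_l _ _)).
    assert (Hx2 := Rlt_le_trans _ _ _ Hx' (Rmin_r _ _)).
    split; [| lra].
    rewrite C0, C1; replace (0 + x * (0 + x * g' x)) with (x * (x * g' x)) by ring.
    rewrite 2!Rabs_mult.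
    assert (P := Rabs_pos x); assert (Q := Rle_abs C).
    assert (Rabs x * (Rabs C + 1) <= 1).
    { replace 1 with (/ (Rabs C + 1) * (Rabs C + 1)) at 2 by (field; lra).
      apply Rmult_le_compat_r; lra. }
    assert (Rabs x * Rabs (g' x) <= 1) by nra.
    nra. }
  unfold gfun, g_coef; apply (expands_plus K _ _ (fc p)).
  - apply (expands_PSeries K (fc p) B (/ rho)); trivial; [lra |].
    intros k; rewrite pow_inv; apply Hf.
  - apply expands_scal.
    set (s i k := sum_f_R0 (fun l => hc p i l * PS_pow c l k) k).
    assert (Hs : forall i, expands K (fun x => PSeries (hc p i) (m x)) (s i)).
    { intros i; apply (expands_composed_series K c (/ rho)) with (C := / rho ^ i); trivial.
      - generalize Hmx; apply filter_imp; tauto.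
      - left; now apply Rinv_0_lt_compat, pow_lt.
      - intros l; rewrite pow_inv, <- Rinv_mult, <- pow_add; apply Hh. }
    apply (expands_ext K (fun x => Series (fun i => PSeries (hc p i) (m x) * x ^ i)) _
      (fun k => sum_f_R0 (fun i => PS_incr_n (s i) i k) k)).
    + apply filter_forall; reflexivity.
    + intros k _; apply sum_eq; intros i Hi.
      rewrite PS_incr_n_simplify; destruct (le_lt_dec i k) as [H | H]; [| lia].
      unfold s; symmetry; apply sum_f_R0_trunc; [lia |].
      intros l Hl; rewrite PS_pow_low by (trivial; lia); ring.
    + apply (expands_series K (fun i x => PSeries (hc p i) (m x) * x ^ i)
        (fun i k => PS_incr_n (s i) i k) 2 (/ rho)); trivial; [lra | | |].
      * generalize Hmx; apply filter_imp; intros x [Hx1 Hx2] i.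
        rewrite Rabs_mult, Rpow_mult_distr, <- RPow_abs, <- Rmult_assoc.
        apply Rmult_le_compat_r; [apply pow_le, Rabs_pos |].
        unfold PSeries; apply Rle_trans with (Series (fun l => (/ rho) ^ i * (/ 2) ^ l)).
        -- apply Series_abs_le.
           ++ intros l; replace ((/ 2) ^ l) with ((/ rho) ^ l * (rho / 2) ^ l).
              2:{ rewrite <- Rpow_mult_distr; f_equal; field; lra. }
              rewrite <- Rmult_assoc; apply Rabs_mult_le.
              ** rewrite <- pow_add, pow_inv; apply Hh.
              ** rewrite <- RPow_abs; apply pow_incr; split; [apply Rabs_pos | lra].
           ++ apply (ex_series_scal_l ((/ rho) ^ i) (fun l => (/ 2) ^ l)), ex_series_geom.
              rewrite Rabs_right; lra.
        -- rewrite Series_scal_l, Series_geom by (rewrite Rabs_right; lra).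
           right; field; lra.
      * intros i; apply expands_ext with (3 := expands_shift_n K _ _ i (Hs i)); trivial.
        apply filter_forall; intros; apply Rmult_comm.
      * intros i k Hk; rewrite PS_incr_n_simplify.
        destruct (le_lt_dec i k) as [H | H]; [lia | reflexivity].
Qed.

Hypothesis Hm : center_manifold p m.

(** Both sides of the differential equation have asymptotic expansions, and these are
    unique. *)
Lemma center_manifold_formal : formal_solution p (taylor_coef m).
Proof.
  destruct Hm as (M0 & M1 & Hloc).
  assert (Hsm : locally 0 (fun x => forall n, ex_derive_n m n x))
    by (generalize Hloc; apply filter_imp; tauto).
  assert (Hode : locally' 0 (fun x =>
            x ^ 2 * Derive m x + m x * (1 + lin p * x) = gfun p x (m x))).
  { apply locally_deleted; generalize Hloc; apply filter_imp; tauto. }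
  assert (C0 : taylor_coef m 0 = 0) by (unfold taylor_coef; simpl; rewrite M0; ring).
  assert (C1 : taylor_coef m 1 = 0).
  { unfold taylor_coef; change (Derive_n m 1 0) with (Derive m 0); rewrite M1; ring. }
  split; [exact C0 | split; [exact C1 |]]; intros k.
  refine (expands_unique (S k) (fun x => gfun p x (m x))
    (fun k => PS_incr_n (PS_derive (taylor_coef m)) 2 k +
              (taylor_coef m k + lin p * PS_incr_1 (taylor_coef m) k))
    (g_coef p (taylor_coef m)) _ _ k _); [| | lia].
  - apply (expands_ext (S k) (fun x => x ^ 2 * Derive m x + (m x + lin p * (x * m x))) _
      (fun k => PS_incr_n (PS_derive (taylor_coef m)) 2 k +
                (taylor_coef m k + lin p * PS_incr_1 (taylor_coef m) k))).
    + generalize Hode; apply filter_imp; intros x <-; ring.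
    + reflexivity.
    + assert (Hd : expands (S k) (Derive m) (PS_derive (taylor_coef m))).
      { apply (expands_ext _ (Derive m) _ (taylor_coef (Derive m))).
        - now apply filter_forall.
        - intros; apply taylor_coef_Derive.
        - apply expands_taylor; generalize Hsm; apply filter_imp, smooth_Derive. }
      apply (expands_plus (S k) _ _ (PS_incr_n (PS_derive (taylor_coef m)) 2)).
      * now apply expands_shift_n.
      * apply (expands_plus (S k) m); [now apply expands_taylor |].
        apply expands_scal, expands_shift; now apply expands_taylor.
  - apply expands_gfun; trivial; now apply expands_taylor.
Qed.

Lemma analytic_taylor_bound : analytic_at_0 m ->
  exists C q, 0 < q /\ forall k, Rabs (taylor_coef m k) <= C * q ^ k.
Proof.
  intros [a Ha].
  assert (Hsm : locally 0 (fun x => forall n, ex_derive_n m n x))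
    by (destruct Hm as (_ & _ & Hloc); generalize Hloc; apply filter_imp; tauto).
  assert (Hb : exists C q, 0 <= C /\ 0 < q /\ forall k, Rabs (a k) <= C * q ^ k).
  { destruct Ha as [d Hd]; assert (Hd0 : 0 < d) by apply d.
    assert (Hs : ex_series (fun k => scal (pow_n (d / 2) k) (a k))).
    { exists (m (d / 2)); apply (Hd (d / 2)).
      change (Rabs (d / 2 - 0) < d); rewrite Rabs_right; lra. }
    assert (Hl : exists x : R, filterlim (fun k => scal (pow_n (d / 2) k) (a k))
              eventually (locally x)) by (exists 0; exact (ex_series_lim_0 _ Hs)).
    destruct (filterlim_bounded (V := R_NormedModule) _ Hl) as [C HC].
    exists (Rabs C), (/ (d / 2)); split; [apply Rabs_pos |].
    split; [apply Rinv_0_lt_compat; lra |]; intros k.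
    specialize (HC k); rewrite pow_n_pow in HC.
    change (Rabs ((d / 2) ^ k * a k) <= C) in HC.
    assert (P : 0 < (d / 2) ^ k) by (apply pow_lt; lra).
    rewrite Rabs_mult, (Rabs_right ((d / 2) ^ k)) in HC by lra.
    rewrite pow_inv; apply Rmult_le_reg_l with ((d / 2) ^ k); [exact P |].
    replace ((d / 2) ^ k * (Rabs C * / (d / 2) ^ k)) with (Rabs C) by (field; lra).
    generalize (Rle_abs C); lra. }
  destruct Hb as (C & q & HC & Hq & Hb); exists C, q; split; [exact Hq |].
  intros k; rewrite (expands_unique (S k) m (taylor_coef m) a); trivial; [| | lia].
  - now apply expands_taylor.
  - apply expands_ext with (3 := expands_PSeries (S k) a C q HC Hq Hb); [| trivial].
    apply locally_deleted; generalize Ha; apply filter_imp.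
    intros x Hx; now apply is_pseries_unique.
Qed.

End CenterManifold.

Lemma geometric_growth_limit a u C q : -2 < a -> 0 < q ->
  (forall k, Rabs (u k) <= C * q ^ k) ->
  is_lim_seq (fun k => (-1) ^ k / Gamma (INR k + a) * u k) 0.
Proof.
  intros Ha Hq Hu; apply (is_lim_seq_incr_n _ 2).
  assert (Hg := Gamma_pos (2 + a) ltac:(lra)).
  assert (Hiq : 0 < / q) by now apply Rinv_0_lt_compat.
  assert (Hlim := ex_series_lim_0 _
    (ex_series_forcing (/ q) (C / Gamma (2 + a)) a Hiq Ha)).
  apply is_lim_seq_abs_0.
  apply (is_lim_seq_le_le (fun _ => 0) _
    (forcing_term (/ q) (C / Gamma (2 + a)) a)); trivial.
  2: apply is_lim_seq_const.
  intros n; split; [apply Rabs_pos |]; unfold forcing_term.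
  replace (n + 2)%nat with (S (S n)) by lia.
  rewrite Gamma_poch by exact Ha.
  assert (P := poch_pos a n Ha).
  unfold Rdiv; rewrite 2!Rabs_mult, pow_1_abs, Rmult_1_l.
  rewrite Rabs_right by (left; apply Rinv_0_lt_compat, Rmult_lt_0_compat; lra).
  rewrite pow_inv, Rinv_inv.
  replace (C * / Gamma (2 + a) * q ^ S (S n) * / poch a n)
    with (/ (poch a n * Gamma (2 + a)) * (C * q ^ S (S n))) by (field; lra).
  apply Rmult_le_compat_l; [| apply Hu].
  left; apply Rinv_0_lt_compat, Rmult_lt_0_compat; lra.
Qed.

(** * Dependence on the parameters and the limit constant *)

Lemma C11_bound_affine_lin rho D x m : 0 <= m ->
  (forall p, D p -> Rabs (x + lin p) <= m) ->
  C11_bound rho D (fun p => x + lin p) (fun _ v => lin v) m 1 0.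
Proof.
  intros Hm H; constructor; simpl.
  - lra.
  - intros; ring.
  - intros; ring.
  - exact H.
  - intros p v r Hp [Hv _]; lra.
  - intros p q r Hp Hq [Hr _]; simpl in Hr.
    replace (x + lin q - (x + lin p)) with (lin q - lin p) by ring; lra.
  - intros p q r Hp Hq Hr.
    replace (x + lin q - (x + lin p) - (lin q - lin p)) with 0 by ring.
    rewrite Rabs_R0; lra.
  - intros; rewrite Rminus_diag, Rabs_R0; lra.
Qed.

(** The left side is the weighted norm of 1 / (n + a) computed from the jet (x, 1, 0)
    of n + a; it is the truncation of the geometric series for 1 / (x - c). *)
Lemma inv_jet_le x c : 0 < c < x ->
  / x + c * (/ x * / x * 1) +
    c ^ 2 / 2 * (/ x * / x * 0 + 2 * (/ x * (/ x * / x)) * (1 * 1)) <= / (x - c).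
Proof.
  intros Hc.
  apply Rmult_le_reg_r with ((x - c) * x ^ 3).
  { apply Rmult_lt_0_compat; [lra | apply pow_lt; lra]. }
  replace (/ (x - c) * ((x - c) * x ^ 3)) with (x ^ 3) by (field; lra).
  replace ((/ x + c * (/ x * / x * 1) +
    c ^ 2 / 2 * (/ x * / x * 0 + 2 * (/ x * (/ x * / x)) * (1 * 1))) * ((x - c) * x ^ 3))
    with (x ^ 3 - c ^ 3) by (field; lra).
  assert (0 < c ^ 3) by (apply pow_lt; lra); lra.
Qed.

Section LinearPart.
Variables (rho c a0 eps A : R) (D : params -> Prop).
Hypotheses (Hc : 0 < c) (Heps : 0 < eps) (HA : -2 < A) (HA0 : A + eps + c <= a0)
  (HA1 : a0 + eps + c <= A + 1) (HD : forall p, D p -> Rabs (lin p - a0) < eps).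

Lemma C11_bound_index_lin n :
  C11_bound rho D (fun p => 2 + INR n + lin p) (fun _ v => lin v)
    (2 + INR n + a0 + eps) 1 0.
Proof.
  assert (Pn := pos_INR n).
  apply (C11_bound_affine_lin rho D (2 + INR n)).
  - lra.
  - intros p Hp; assert (H := HD p Hp); apply Rabs_lt_between in H.
    apply Rabs_le; lra.
Qed.

(** Together with the next lemma: the parameter a varies by less than eps around a^0,
    and its derivative has weight c, so a behaves like a number between A and
    A + 1. *)
Lemma C11_le_index_lin n :
  C11_le rho c D (fun p => 2 + INR n + lin p) (2 + INR n + (A + 1)).
Proof.
  apply C11_le_weaken with (2 + INR n + a0 + eps + c * 1 + c ^ 2 / 2 * 0); [| lra].
  apply (C11_le_of_bound _ _ _ _ (fun _ v => lin v)), C11_bound_index_lin.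
Qed.

Lemma C11_le_inv_index_lin n :
  C11_le rho c D (fun p => / (2 + INR n + lin p)) (/ (2 + INR n + A)).
Proof.
  assert (Pn := pos_INR n).
  set (x := 2 + INR n + a0 - eps).
  apply C11_le_weaken with (/ (x - c)).
  2:{ apply Rinv_le_contravar; unfold x; lra. }
  eapply C11_le_weaken; [| apply (inv_jet_le x c); unfold x; lra].
  apply C11_le_of_bound with
    (L := fun p v => - (/ (2 + INR n + lin p) * / (2 + INR n + lin p) * lin v)).
  apply (C11_bound_inv rho D (fun p => 2 + INR n + lin p) (fun _ v => lin v)
    (2 + INR n + a0 + eps) 1 0 x).
  - unfold x; lra.
  - intros p Hp; assert (H := HD p Hp); apply Rabs_lt_between in H; unfold x; lra.
  - apply C11_bound_index_lin.
Qed.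

Lemma C11_le_inv_Gamma : exists k nu, 0 < k /\
  (forall p, D p -> k <= Gamma (2 + lin p)) /\
  C11_le rho c D (fun p => / Gamma (2 + lin p)) nu.
Proof.
  assert (Hrange : forall p, D p -> 2 + A <= 2 + lin p <= 2 + (A + 1)).
  { intros p Hp; assert (H := HD p Hp); apply Rabs_lt_between in H; lra. }
  destruct (Gamma_lower_bound (2 + A) (2 + (A + 1)) ltac:(lra)) as [k [Hk Hlow]].
  destruct (Gamma_taylor_bounds (2 + A) (2 + (A + 1)) ltac:(lra)) as [G1 [K [HK H]]].
  assert (HB : C11_bound rho D (fun p => Gamma (2 + lin p))
                 (fun p v => lin v * G1 (2 + lin p)) K K K).
  { apply (C11_bound_comp_lin rho D (fun x => Gamma (2 + x)) (fun x => G1 (2 + x)));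
      trivial.
    intros p q Hp Hq; assert (Rp := Hrange p Hp); assert (Rq := Hrange q Hq).
    destruct (H _ _ Rp Rq) as (E1 & E2 & E3 & E4 & E5).
    replace (2 + lin q - (2 + lin p)) with (lin q - lin p) in * by ring.
    rewrite (Rabs_right (Gamma _)) by (left; apply Gamma_pos; lra).
    tauto. }
  assert (HI := C11_bound_inv rho D _ _ K K K k Hk
                  (fun p Hp => Hlow _ (Hrange p Hp)) HB).
  exists k; eexists; split; [exact Hk | split].
  - intros p Hp; apply Hlow, (Hrange p Hp).
  - exact (C11_le_of_bound _ _ _ _ _ _ _ _ HI).
Qed.

End LinearPart.

(** The direction in parameter space along which only f_2 varies. *)
Definition f2_direction : params :=
  Params 0 0 (fun k => if Nat.eqb k 2 then 1 else 0) (fun _ _ => 0).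

Lemma params_sub_with_f2 p s t :
  params_sub (with_f2 p t) (with_f2 p s) = params_scal (t - s) f2_direction.
Proof.
  unfold params_sub, with_f2, params_scal, f2_direction; simpl; f_equal; try ring.
  - apply functional_extensionality; intros k; destruct (Nat.eqb k 2); ring.
  - apply functional_extensionality; intros k;
      apply functional_extensionality; intros l; ring.
Qed.

Lemma with_f2_same p : with_f2 p (fc p 2) = p.
Proof.
  destruct p as [a u f h]; unfold with_f2; simpl; f_equal.
  apply functional_extensionality; intros k.
  destruct (Nat.eqb_spec k 2) as [-> | _]; reflexivity.
Qed.

Lemma f2_direction_norm rho s : 0 < rho ->
  params_norm_le rho (params_scal s f2_direction) (Rabs s * rho ^ 2).
Proof.
  intros Hrho; assert (Ps := Rabs_pos s); assert (Pr := pow_lt rho 2 Hrho).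
  assert (P0 : 0 <= Rabs s * rho ^ 2) by (apply Rmult_le_pos; lra).
  repeat split; simpl; try (rewrite Rmult_0_r, Rabs_R0; exact P0).
  - intros k; destruct (Nat.eqb_spec k 2) as [-> | _].
    + rewrite Rmult_1_r; right; field; lra.
    + rewrite Rmult_0_r, Rabs_R0; apply Rmult_le_pos; [exact P0 |].
      left; now apply Rinv_0_lt_compat, pow_lt.
  - intros k l; rewrite Rmult_0_r, Rabs_R0; apply Rmult_le_pos; [exact P0 |].
    left; now apply Rinv_0_lt_compat, pow_lt.
Qed.

Lemma f2_direction_norm_1 rho : 0 < rho -> params_norm_le rho f2_direction (rho ^ 2).
Proof.
  intros Hrho; assert (E := f2_direction_norm rho 1 Hrho).
  rewrite Rabs_R1, Rmult_1_l in E.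
  replace (params_scal 1 f2_direction) with f2_direction in E; [exact E |].
  unfold params_scal, f2_direction; simpl; f_equal; try ring.
  - apply functional_extensionality; intros k; destruct (Nat.eqb k 2); ring.
  - apply functional_extensionality; intros k;
      apply functional_extensionality; intros l; ring.
Qed.

(** Only the term with index 0 contains f_2, with coefficient 1. *)
Lemma lin_sum_with_f2 p t :
  ex_series (fun n => (-1) ^ n * (fc p (S (S n)) * / poch (lin p) n)) ->
  ex_series (fun n => (-1) ^ n * (fc (with_f2 p t) (S (S n)) *
               / poch (lin (with_f2 p t)) n)) ->
  lin_sum (with_f2 p t) - lin_sum p = t - fc p 2.
Proof.
  intros H1 H2; unfold lin_sum.
  rewrite (Series_incr_1 _ H1), (Series_incr_1 _ H2).
  simpl; field.
Qed.

Lemma param_domain_with_f2 rho B cl dl a0 eps mu0 p t :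
  (forall t, cl <= t <= dl -> Rabs t <= B / rho ^ 2) -> cl <= t <= dl ->
  param_domain rho B cl dl a0 eps mu0 p ->
  param_domain rho B cl dl a0 eps mu0 (with_f2 p t).
Proof.
  intros HI Ht ((F0 & F1 & F2 & Hf & Hh) & Hrest); split; [| exact Hrest].
  repeat split; try apply Hh; simpl; trivial; try lra.
  intros k; destruct (Nat.eqb_spec k 2) as [-> | _]; [now apply HI | apply Hf].
Qed.

Lemma f2_nearby cl dl x eta : cl < dl -> cl <= x <= dl -> 0 < eta ->
  exists t, cl <= t <= dl /\ t <> x /\ Rabs (t - x) < eta.
Proof.
  intros Hcd Hx He; destruct (Rlt_dec x dl) as [H | H].
  - exists (x + Rmin (eta / 2) (dl - x)).
    assert (P : 0 < Rmin (eta / 2) (dl - x)) by (apply Rmin_glb_lt; lra).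
    assert (P1 := Rmin_l (eta / 2) (dl - x)); assert (P2 := Rmin_r (eta / 2) (dl - x)).
    split; [lra | split; [lra |]].
    rewrite Rabs_right; lra.
  - exists (x - Rmin (eta / 2) (dl - cl)).
    assert (P : 0 < Rmin (eta / 2) (dl - cl)) by (apply Rmin_glb_lt; lra).
    assert (P1 := Rmin_l (eta / 2) (dl - cl)); assert (P2 := Rmin_r (eta / 2) (dl - cl)).
    split; [lra | split; [lra |]].
    rewrite Rabs_left; lra.
Qed.

Section PartialDerivative.
Variables (rho B cl dl a0 eps mu0 : R) (F : params -> R)
  (L : params -> params -> R) (m0 m1 m2 : R).
Hypotheses (Hrho : 0 < rho) (Hcd : cl < dl)
  (HI : forall t, cl <= t <= dl -> Rabs t <= B / rho ^ 2).
Local Notation D := (param_domain rho B cl dl a0 eps mu0).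
Hypothesis HF : C11_bound rho D F L m0 m1 m2.

Lemma f2_quotient p t : D p -> cl <= t <= dl -> t <> fc p 2 ->
  Rabs ((F (with_f2 p t) - F p) / (t - fc p 2) - L p f2_direction)
    <= m2 * rho ^ 4 * Rabs (t - fc p 2).
Proof.
  intros Hp Ht Hne; assert (Hq := param_domain_with_f2 _ _ _ _ _ _ _ p t HI Ht Hp).
  set (s := t - fc p 2); assert (Hs : 0 < Rabs s) by (apply Rabs_pos_lt; unfold s; lra).
  assert (Es : params_sub (with_f2 p t) p = params_scal s f2_direction).
  { rewrite <- (with_f2_same p) at 2; apply params_sub_with_f2. }
  assert (Hn := f2_direction_norm rho s Hrho).
  assert (HR := C11_rem _ _ _ _ _ _ _ HF p (with_f2 p t) (Rabs s * rho ^ 2) Hp Hq).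
  rewrite Es in HR; specialize (HR Hn).
  assert (H1 := f2_direction_norm_1 rho Hrho).
  rewrite (C11_scal _ _ _ _ _ _ _ HF p s f2_direction _ Hp H1) in HR.
  apply Rmult_le_reg_l with (Rabs s); [exact Hs |].
  rewrite <- Rabs_mult.
  replace (s * ((F (with_f2 p t) - F p) / s - L p f2_direction))
    with (F (with_f2 p t) - F p - s * L p f2_direction) by (field; unfold s; lra).
  apply Rle_trans with (1 := HR); right; ring.
Qed.

Lemma f2_derivative p : D p ->
  filterlim (fun t => (F (with_f2 p t) - F p) / (t - fc p 2))
    (within (fun t => cl <= t <= dl) (locally' (fc p 2)))
    (locally (L p f2_direction)).
Proof.
  intros Hp; apply (proj2 (filterlim_locally _ _)); intros e.
  assert (Hm : 0 <= m2 * rho ^ 4).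
  { apply Rmult_le_pos; [apply (C11_nonneg _ _ _ _ _ _ _ HF) | apply pow_le; lra]. }
  assert (He : 0 < e / (m2 * rho ^ 4 + 1)) by (apply Rdiv_lt_0_compat; [apply e | lra]).
  exists (mkposreal _ He); intros t Ht Hne Hcl.
  change (Rabs (t - fc p 2) < e / (m2 * rho ^ 4 + 1)) in Ht.
  change (Rabs ((F (with_f2 p t) - F p) / (t - fc p 2) - L p f2_direction) < e).
  apply Rle_lt_trans with (1 := f2_quotient p t Hp Hcl Hne).
  replace (pos e) with ((m2 * rho ^ 4 + 1) * (e / (m2 * rho ^ 4 + 1))) by (field; lra).
  assert (P := Rabs_pos (t - fc p 2)).
  apply Rle_lt_trans with ((m2 * rho ^ 4 + 1) * Rabs (t - fc p 2)); [nra |].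
  apply Rmult_lt_compat_l; lra.
Qed.

Lemma f2_derivative_continuous p : D p ->
  continuous_on (fun t => cl <= t <= dl) (fun t => L (with_f2 p t) f2_direction).
Proof.
  intros Hp s Hs; apply (proj2 (filterlim_locally _ _)); intros e.
  assert (Hm : 0 <= m2 * rho ^ 4).
  { apply Rmult_le_pos; [apply (C11_nonneg _ _ _ _ _ _ _ HF) | apply pow_le; lra]. }
  assert (He : 0 < e / (m2 * rho ^ 4 + 1)) by (apply Rdiv_lt_0_compat; [apply e | lra]).
  exists (mkposreal _ He); intros t Ht Hcl.
  change (Rabs (t - s) < e / (m2 * rho ^ 4 + 1)) in Ht.
  change (Rabs (L (with_f2 p t) f2_direction - L (with_f2 p s) f2_direction) < e).
  assert (Hq := param_domain_with_f2 _ _ _ _ _ _ _ p t HI Hcl Hp).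
  assert (Hq' := param_domain_with_f2 _ _ _ _ _ _ _ p s HI Hs Hp).
  assert (H1 := f2_direction_norm_1 rho Hrho).
  assert (Hn := f2_direction_norm rho (t - s) Hrho).
  rewrite <- (params_sub_with_f2 p) in Hn.
  apply Rle_lt_trans with
    (1 := C11_der_lip _ _ _ _ _ _ _ HF _ _ _ _ _ Hq' Hq Hn H1).
  replace (pos e) with ((m2 * rho ^ 4 + 1) * (e / (m2 * rho ^ 4 + 1))) by (field; lra).
  assert (P := Rabs_pos (t - s)).
  apply Rle_lt_trans with ((m2 * rho ^ 4 + 1) * Rabs (t - s)); [| apply Rmult_lt_compat_l; lra].
  replace (m2 * (Rabs (t - s) * rho ^ 2 * rho ^ 2)) with (m2 * rho ^ 4 * Rabs (t - s)) by ring.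
  nra.
Qed.

(** The derivative is a limit of quotients with t different from f_2, and such t exist
    in the interval arbitrarily close to f_2. *)
Lemma f2_derivative_bound p x y : D p ->
  (forall t, cl <= t <= dl -> t <> fc p 2 ->
    Rabs ((F (with_f2 p t) - F p) / (t - fc p 2) - x) <= y) ->
  Rabs (L p f2_direction - x) <= y.
Proof.
  intros Hp H; apply Rnot_lt_le; intros Hlt.
  assert (Hm : 0 <= m2 * rho ^ 4).
  { apply Rmult_le_pos; [apply (C11_nonneg _ _ _ _ _ _ _ HF) | apply pow_le; lra]. }
  set (g := Rabs (L p f2_direction - x) - y).
  assert (Hg : 0 < g / (m2 * rho ^ 4 + 1)) by (apply Rdiv_lt_0_compat; unfold g; lra).
  assert (Hcl : cl <= fc p 2 <= dl) by apply Hp.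
  destruct (f2_nearby cl dl (fc p 2) _ Hcd Hcl Hg) as (t & Ht & Hne & Hd).
  assert (H1 := H t Ht Hne); assert (H2 := f2_quotient p t Hp Ht Hne).
  assert (H3 : m2 * rho ^ 4 * Rabs (t - fc p 2) < g).
  { replace g with ((m2 * rho ^ 4 + 1) * (g / (m2 * rho ^ 4 + 1))) by (field; lra).
    assert (P := Rabs_pos (t - fc p 2)).
    apply Rle_lt_trans with ((m2 * rho ^ 4 + 1) * Rabs (t - fc p 2)); [nra |].
    apply Rmult_lt_compat_l; [lra | exact Hd]. }
  set (Q := (F (with_f2 p t) - F p) / (t - fc p 2)) in *.
  assert (T := Rabs_triang (L p f2_direction - Q) (Q - x)).
  replace (L p f2_direction - Q + (Q - x)) with (L p f2_direction - x) in T by ring.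
  rewrite (Rabs_minus_sym (L p f2_direction) Q) in T; unfold g in *; lra.
Qed.

End PartialDerivative.

Lemma forcing_sum_pos rho K A : 0 < rho -> 0 < K -> -2 < A ->
  0 < Series (forcing_term rho K A).
Proof.
  intros Hrho HK HA.
  apply Rlt_le_trans with (1 := forcing_term_pos rho K A 0 Hrho HK HA).
  apply (Series_partial_le (forcing_term rho K A) 0).
  - now apply ex_series_forcing.
  - intros k; left; now apply forcing_term_pos.
Qed.

Theorem theorem3p2 (rho B c d a0 : R)
  (hrho : 0 < rho) (hB : 0 < B) (hcd : c < d)
  (hI : forall t, c <= t <= d -> Rabs t <= B / rho ^ 2)
  (ha0 : -2 < a0) :
  exists mu0 eps : R, 0 < mu0 /\ 0 < eps /\
  exists Sinf : params -> R,
    (forall p, param_domain rho B c d a0 eps mu0 p ->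
       (exists u : nat -> R, formal_solution p u /\
          is_lim_seq (fun k => (-1) ^ k / Gamma (INR k + lin p) * u k)
            (Sinf p)) /\
       (forall m : R -> R, center_manifold p m ->
          is_lim_seq (fun k => (-1) ^ k / Gamma (INR k + lin p) *
                        (/ INR (fact k) * Derive_n m k 0))
            (Sinf p) /\
          (Sinf p <> 0 -> ~ analytic_at_0 m))) /\
    C1_on rho (param_domain rho B c d a0 eps mu0) Sinf /\
    exists (dS : params -> R) (C : R),
      forall p, param_domain rho B c d a0 eps mu0 p ->
        filterlim (fun t => (Sinf (with_f2 p t) - Sinf p) / (t - fc p 2))
          (within (fun t => c <= t <= d) (locally' (fc p 2)))
          (locally (dS p)) /\
        continuous_on (fun t => c <= t <= d) (fun t => dS (with_f2 p t)) /\
        Rabs (dS p - / Gamma (2 + lin p)) <= C * mu p /\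
        dS p <> 0.
Proof.
  (* Half the distance from a0 to -2, capped so that the window A, A + 1 around a0 has
     room for eps + w on both sides. *)
  set (delta := Rmin ((2 + a0) / 2) (1 / 2)).
  assert (Hd0 : 0 < delta) by (apply Rmin_glb_lt; lra).
  assert (Hd1 : delta <= (2 + a0) / 2) by apply Rmin_l.
  assert (Hd2 : delta <= 1 / 2) by apply Rmin_r.
  set (A := a0 - delta); set (eps := delta / 2).
  assert (HA : -2 < A) by (unfold A; lra).
  set (Phi := Series (forcing_term rho (B + 1) A)).
  set (Psi := Series (nonlinear_weight A)).
  set (K := nonlinear_bound rho B A).
  assert (HPhi : 0 < Phi) by (apply forcing_sum_pos; lra).
  assert (HPsi : 0 <= Psi) by exact (proj2 (growth_series_nonneg rho B A hrho hB HA)).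
  assert (HK : 0 <= K) by exact (proj2 (growth_const_nonneg rho B A hrho hB HA)).
  assert (HKP : 0 <= K * Psi) by now apply Rmult_le_pos.
  (* nu bounds the norm mu0 + w of the coordinate mu, so it restricts both the range
     of mu and the weight w of derivatives; it is chosen for the bootstrap. *)
  set (nu := Phi / (K * Psi + 1)).
  assert (Hnu : 0 < nu) by (apply Rdiv_lt_0_compat; lra).
  set (w := Rmin (delta / 2) (nu / 2)).
  assert (Hw : 0 < w) by (apply Rmin_glb_lt; lra).
  assert (Hw1 : w <= delta / 2) by apply Rmin_l.
  assert (Hw2 : w <= nu / 2) by apply Rmin_r.
  assert (Hr2 := pow_lt rho 2 hrho).
  (* kappa is the Lipschitz constant of the nonlinear sum as a function of f_2. *)
  set (kappa := K * Psi / w * rho ^ 2).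
  assert (Hkappa : 0 <= kappa).
  { apply Rmult_le_pos; [apply Rmult_le_pos; [exact HKP |] | lra].
    left; now apply Rinv_0_lt_compat. }
  (* The second bound gives mu kappa <= 1/2, so the derivative cannot vanish. *)
  set (mu0 := Rmin (nu / 2) (/ (2 * (kappa + 1)))).
  assert (Hmu0 : 0 < mu0).
  { apply Rmin_glb_lt; [lra | apply Rinv_0_lt_compat; lra]. }
  assert (Hmu1 : mu0 <= nu / 2) by apply Rmin_l.
  assert (Hmu2 : mu0 * (2 * (kappa + 1)) <= 1).
  { apply Rle_trans with (/ (2 * (kappa + 1)) * (2 * (kappa + 1))); [| right; field; lra].
    apply Rmult_le_compat_r; [lra | apply Rmin_r]. }
  set (D := param_domain rho B c d a0 eps mu0).
  assert (Hadm : forall p, D p -> admissible rho B c d p) by (intros p Hp; apply Hp).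
  assert (HDlin : forall p, D p -> Rabs (lin p - a0) < eps) by (intros p Hp; apply Hp).
  assert (Hlin := C11_le_index_lin rho w a0 eps A D Hw ltac:(unfold eps; lra) HA ltac:(unfold A, eps; lra)
                    ltac:(unfold A, eps; lra) HDlin).
  assert (Hinv := C11_le_inv_index_lin rho w a0 eps A D Hw ltac:(unfold eps; lra) HA ltac:(unfold A, eps; lra)
                    HDlin).
  destruct (C11_le_inv_Gamma rho w a0 eps A D Hw HA ltac:(unfold A, eps; lra)
    ltac:(unfold A, eps; lra) HDlin) as (kG & nuG & HkG & HGlow & HGle).
  assert (Hmu : C11_le rho w D mu nu).
  { apply C11_le_weaken with (mu0 + w * 1); [| lra].
    apply C11_le_linear; try reflexivity; try lra.
    - intros v r (_ & H & _); lra.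
    - intros p (_ & _ & _ & H1 & H2); rewrite Rabs_right; lra. }
  assert (Hsmall : nu * K * Psi <= Phi).
  { replace Phi with (nu * (K * Psi + 1)) by (unfold nu; field; lra); nra. }
  assert (Hw' : 0 < w <= 1) by lra.
  assert (HL := C11_le_lin_sum rho B c d A w D hrho hB HA Hw' Hadm Hinv).
  assert (HN := C11_le_nonlin_sum rho B c d A w nu D hrho hB HA Hw' Hadm Hlin Hinv Hmu
                  Hsmall).
  assert (Hlim := fsol_limit rho B c d A w nu D hrho hB HA Hw' Hadm Hlin Hinv Hmu Hsmall).
  assert (Hex := ex_series_lin_sum rho B c d A w D hrho hB HA Hw' Hadm Hinv).
  fold Phi in HL; fold K Psi in HN.
  set (Sinf p := / Gamma (2 + lin p) * (lin_sum p + mu p * nonlin_sum p)).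
  destruct (C11_le_mult rho w D Hw _ _ _ _ HGle
    (C11_le_plus rho w D _ _ _ _ HL (C11_le_mult rho w D Hw _ _ _ _ Hmu HN)))
    as (L & m0 & m1 & m2 & HS & _).
  change (C11_bound rho D Sinf L m0 m1 m2) in HS.
  exists mu0, eps; split; [exact Hmu0 | split; [unfold eps; lra |]].
  exists Sinf; split; [| split; [exact (C11_bound_C1_on _ _ _ _ _ _ _ HS) |]].
  - intros p Hp.
    assert (Ha : -2 < lin p) by apply Hp.
    assert (Hh0 : forall l, hc p 0 l = 0).
    { intros l; destruct (Hadm p Hp) as (_ & _ & _ & _ & Hh & _); apply Hh; lia. }
    split.
    + exists (fsol p); split; [| exact (Hlim p Hp Ha)].
      apply (formal_solution_rec rho B c d p (fsol p) (Hadm p Hp)), fsol_rec, Hh0.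
    + intros m Hm.
      assert (Hu : forall k, taylor_coef m k = fsol p k).
      { apply (rec_step_unique p); trivial; [| now apply fsol_rec].
        apply (formal_solution_rec rho B c d p _ (Hadm p Hp)).
        exact (center_manifold_formal rho B c d p m hrho hB (Hadm p Hp) Hm). }
      assert (Hlm : is_lim_seq
                (fun k => (-1) ^ k / Gamma (INR k + lin p) * taylor_coef m k) (Sinf p)).
      { apply (is_lim_seq_ext (fun k => (-1) ^ k / Gamma (INR k + lin p) * fsol p k));
          [intros k; now rewrite Hu | exact (Hlim p Hp Ha)]. }
      split; [exact Hlm |].
      intros HS0 Han; apply HS0.
      destruct (analytic_taylor_bound p m Hm Han) as (C & q & Hq & Hb).
      assert (H0 := geometric_growth_limit (lin p) (taylor_coef m) C q Ha Hq Hb).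
      apply is_lim_seq_unique in Hlm; apply is_lim_seq_unique in H0.
      rewrite Hlm in H0; now injection H0.
  - exists (fun p => L p f2_direction), (/ kG * kappa); intros p Hp.
    assert (Hbound : Rabs (L p f2_direction - / Gamma (2 + lin p)) <=
              / Gamma (2 + lin p) * (mu p * kappa)).
    { apply (f2_derivative_bound rho B c d a0 eps mu0 Sinf L m0 m1 m2 hrho hcd hI HS p);
        trivial.
      intros t Ht Hne.
      assert (Hq := param_domain_with_f2 _ _ _ _ _ _ _ p t hI Ht Hp).
      assert (Hn := f2_direction_norm rho (t - fc p 2) hrho).
      rewrite <- (params_sub_with_f2 p), (with_f2_same p) in Hn.
      assert (HNl := C11_le_lip rho w D Hw _ _ p (with_f2 p t) _ HN Hp Hq Hn).
      assert (HG : 0 < / Gamma (2 + lin p)).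
      { apply Rinv_0_lt_compat; generalize (HGlow p Hp); lra. }
      assert (Hmup : 0 <= mu p) by apply Hp.
      set (s := t - fc p 2) in *; assert (Hs : s <> 0) by (unfold s; lra).
      assert (Els : lin_sum (with_f2 p t) = lin_sum p + s).
      { generalize (lin_sum_with_f2 p t (Hex p Hp) (Hex _ Hq)); unfold s; lra. }
      replace ((Sinf (with_f2 p t) - Sinf p) / s - / Gamma (2 + lin p))
        with (/ Gamma (2 + lin p) *
              (mu p * ((nonlin_sum (with_f2 p t) - nonlin_sum p) / s))).
      2:{ unfold Sinf; rewrite Els; simpl lin; simpl mu; field; split; trivial.
          generalize (HGlow p Hp); lra. }
      rewrite Rabs_mult, (Rabs_right (/ Gamma _)) by lra.
      apply Rmult_le_compat_l; [lra |].
      rewrite Rabs_mult, (Rabs_right (mu p)) by lra.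
      apply Rmult_le_compat_l; [exact Hmup |].
      unfold Rdiv at 1; rewrite Rabs_mult, Rabs_inv.
      assert (Hsp := Rabs_pos_lt s Hs).
      apply Rmult_le_reg_r with (Rabs s); [exact Hsp |].
      rewrite Rmult_assoc, Rinv_l, Rmult_1_r by lra.
      apply Rle_trans with (1 := HNl); right; unfold kappa; ring. }
    assert (HGp := HGlow p Hp).
    assert (HG : 0 < / Gamma (2 + lin p)) by (apply Rinv_0_lt_compat; lra).
    assert (Hmup : 0 <= mu p < mu0) by apply Hp.
    assert (Hmk : mu p * kappa <= 1 / 2) by nra.
    split; [| split; [| split]].
    + exact (f2_derivative rho B c d a0 eps mu0 Sinf L m0 m1 m2 hrho hI HS p Hp).
    + exact (f2_derivative_continuous rho B c d a0 eps mu0 Sinf L m0 m1 m2 hrho hI HS p Hp).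
    + apply Rle_trans with (1 := Hbound).
      replace (/ kG * kappa * mu p) with (/ kG * (mu p * kappa)) by ring.
      apply Rmult_le_compat_r; [apply Rmult_le_pos; lra |].
      apply Rinv_le_contravar; lra.
    + intros H0; rewrite H0, Rminus_0_l, Rabs_Ropp, Rabs_right in Hbound by lra.
      nra.
Qed.
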